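(* Let $F\subset\mathbb{R}^2$ be an ellipse (a solid elliptical region) centered at the origin and let $S\subset\mathbb{R}^2$ be a well-shaped domain. For each $R>1$ let $F(R)=\{Rx: x\in F\}$ and define $$T_R := P_{F(R)}\,B_S\,P_{F(R)} : L^2(\mathbb{R}^2)\to L^2(\mathbb{R}^2),$$ whose eigenvalue sequence $\{\lambda_k(T_R)\}_{k\ge 0}$ lies in $[0,1]$. Then for each $s>1$ there exists a constant $C_{s,S,F}$, depending only on $s$, $S$ and $F$, such that for all $\varepsilon\in(0,1/2)$ and all $R>1$, $$\#\{k : \lambda_k(T_R)\in(\varepsilon,1-\varepsilon)\}\ \le\ C_{s,S,F}\, R\,\bigl(\log(R/\varepsilon)\bigr)^{1+2s}.$$
   Context: $\log$ is the base-2 logarithm. A domain is a bounded, open, connected subset of $\mathbb{R}^2$. A domain $S\subset\mathbb{R}^2$ is called well-shaped if its topological boundary $\partial S$ has finite one-dimensional Hausdorff measure $\mathcal{H}^1(\partial S)$ and there is a constant $C>0$ such that for all $t>0$, $$|\{x\in\mathbb{R}^2:\operatorname{dist}(x,\partial S)\le t\}|\le C\max\{t^2,\ t\,\mathcal{H}^1(\partial S)\},$$ where $|\cdot|$ is Lebesgue measure and $\operatorname{dist}$ is Euclidean distance. For measurable $E\subset\mathbb{R}^2$, $P_E f:=\mathbf{1}_E f$ and $B_S f:=\mathcal{F}^{-1}(\mathbf{1}_S\,\mathcal{F}f)$ on $L^2(\mathbb{R}^2)$, where $\mathcal{F}f(\xi)=\widehat f(\xi)=\frac{1}{2\pi}\int_{\mathbb{R}^2}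 f(x)e^{-ix\cdot\xi}\,dx$, extended to $L^2$ as a unitary operator. The operator $T_R$ is compact, positive and self-adjoint; its eigenvalues $\lambda_k(T_R)$ are listed in non-increasing order and counted with multiplicity. *)

(* Defs.v *)
From HB Require Import structures.
From mathcomp Require Import all_boot all_order all_algebra finmap.
From mathcomp Require Import complex.
From mathcomp Require Import all_classical all_reals all_analysis.

Set Implicit Arguments.
Unset Strict Implicit.
Unset Printing Implicit Defensive.

Import Order.TTheory GRing.Theory Num.Theory.
Import numFieldNormedType.Exports.

Local Open Scope classical_set_scope.
Local Open Scope ring_scope.
Local Open Scope complex_scope.

Notation lebesgue2 R := (@lebesgue_measure R \x @lebesgue_measure R)%E.

Section plane.
Context {R : realType}.

Definition dot (x y : R * R) : R := x.1 * y.1 + x.2 * y.2.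

(* Euclidean distance; the library's norm on the product type is the sup norm *)
Definition edist2 (x y : R * R) : R := Num.sqrt (dot (x - y) (x - y)).

(* equals +oo when A is empty *)
Definition dist_set (x : R * R) (A : set (R * R)) : \bar R :=
  ereal_inf [set (edist2 x a)%:E | a in A].

(* 0 is adjoined so that the diameter of the empty set is 0 *)
Definition diam (A : set (R * R)) : \bar R :=
  ereal_sup ([set 0%E] `|` [set (edist2 p.1 p.2)%:E | p in A `*` A]).

Definition hausdorff1_pre (delta : R) (A : set (R * R)) : \bar R :=
  ereal_inf [set (\sum_(0 <= i <oo) diam (U i))%E | U in
    [set U : nat -> set (R * R) |
      A `<=` \bigcup_i U i /\ forall i, (diam (U i) <= delta%:E)%E]].

(* one-dimensional Hausdorff measure; the supremum is the limit as delta
   tends to 0, by monotonicity *)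
Definition hausdorff1 (A : set (R * R)) : \bar R :=
  ereal_sup [set hausdorff1_pre delta A | delta in [set delta | 0 < delta]].

Definition boundary (A : set (R * R)) : set (R * R) := closure A `\` interior A.

Definition domain (S : set (R * R)) : Prop :=
  [/\ bounded_set S, open S & connected S].

Definition well_shaped (S : set (R * R)) : Prop :=
  (hausdorff1 (boundary S) < +oo)%E /\
  exists2 C : R, 0 < C & forall t : R, 0 < t ->
    (lebesgue2 R [set x | dist_set x (boundary S) <= t%:E] <=
     C%:E * maxe (t ^+ 2)%:E (t%:E * hausdorff1 (boundary S)))%E.

(* semi-axes a, b, the first one at angle theta with the horizontal axis *)
Definition centered_ellipse (F : set (R * R)) : Prop :=
  exists a b theta : R, [/\ 0 < a, 0 < b &
    F = [set x | ((x.1 * cos theta + x.2 * sin theta) / a) ^+ 2 +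
                 ((x.2 * cos theta - x.1 * sin theta) / b) ^+ 2 <= 1]].

Definition dilate (r : R) (A : set (R * R)) : set (R * R) :=
  [set (r * x.1, r * x.2) | x in A].

End plane.

(* Elements of L^2(R^2) are represented by functions, identified when they
   are almost everywhere equal. The library's Lebesgue measure lives on the
   Borel sets, so the representatives are Borel functions. *)
Section operators.
Context {R : realType}.
Local Notation cfun := (R * R -> R[i]).

Definition cLfun (p : \bar R) (f : cfun) : Prop :=
  (fun x => complex.Re (f x)) \in Lfun (lebesgue2 R) p /\
  (fun x => complex.Im (f x)) \in Lfun (lebesgue2 R) p.

Definition L2norm (f : cfun) : \bar R :=
  Lnorm (lebesgue2 R) 2%:E
    (fun x => (Normc.normc (f x))%:E).

Definition ae_equal (f g : cfun) : Prop :=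
  {ae (lebesgue2 R), forall x, f x = g x}.

Definition cintegral (f : cfun) : R[i] :=
  Rintegral (lebesgue2 R) setT (fun x => complex.Re (f x)) +i*
  Rintegral (lebesgue2 R) setT (fun x => complex.Im (f x)).

(* exp (- i t) *)
Definition cexpNi (t : R) : R[i] := cos t -i* sin t.

Definition fourierL1 (f : cfun) : cfun := fun xi =>
  ((2 * pi)^-1)%:C * cintegral (fun x => f x * cexpNi (dot x xi)).

(* g is the image of f under the extension by continuity of fourierL1 from
   L^1 `&` L^2 to L^2 *)
Definition is_fourier (f g : cfun) : Prop :=
  [/\ cLfun 2%:E f, cLfun 2%:E g &
   exists f_ : nat -> cfun,
   [/\ forall n, cLfun 1%:E (f_ n) /\ cLfun 2%:E (f_ n),
       L2norm (fun x => f_ n x - f x) @[n --> \oo] --> 0%E &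
       L2norm (fun x => fourierL1 (f_ n) x - g x) @[n --> \oo] --> 0%E]].

Definition fourier (f : cfun) : cfun := xget (fun=> 0) [set g | is_fourier f g].

Definition fourier_inv (g : cfun) : cfun :=
  xget (fun=> 0) [set f | is_fourier f g].

Definition space_limit (E : set (R * R)) (f : cfun) : cfun :=
  fun x => (\1_E x)%:C * f x.

Definition band_limit (S : set (R * R)) (f : cfun) : cfun :=
  fourier_inv (space_limit S (fourier f)).

Definition space_band_limit (E S : set (R * R)) (f : cfun) : cfun :=
  space_limit E (band_limit S (space_limit E f)).

Definition eigenfunction (T : cfun -> cfun) (mu : R) (f : cfun) : Prop :=
  cLfun 2%:E f /\ ae_equal (T f) (fun x => mu%:C * f x).

(* the eigenspace of T for mu (0 included) has dimension n in L^2 *)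
Definition multiplicity (T : cfun -> cfun) (mu : R) (n : nat) : Prop :=
  exists e : 'I_n -> cfun,
  [/\ forall i, eigenfunction T mu (e i),
      forall c : 'I_n -> R[i],
        ae_equal (fun x => \sum_(i < n) c i * e i x) (fun=> 0) ->
        forall i, c i = 0 &
      forall f, eigenfunction T mu f -> exists c : 'I_n -> R[i],
        ae_equal f (fun x => \sum_(i < n) c i * e i x)].

(* the eigenvalues of a compact positive self-adjoint T, in non-increasing
   order and with multiplicity; as every nonzero real number occurs as often
   as its multiplicity, the sequence is determined by T, and it ends with
   zeros when T has finite rank *)
Definition eigenvalue_sequence (T : cfun -> cfun) (lambda : nat -> R) : Prop :=
  (forall j k : nat, (j <= k)%N -> lambda k <= lambda j) /\
  (forall mu : R, mu != 0 -> exists2 n : nat,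
     multiplicity T mu n & ([set k | lambda k = mu] #= `I_n)%card).

End operators.

Definition log2 {R : realType} (x : R) : R := ln x / ln 2.

(* Main.v *)
(* Write E for the dilated ellipse. If f is a combination of eigenfunctions
   with eigenvalues in (eps, 1 - eps), then the part v outside E of the
   band-limited f satisfies |v|^2 = <1_S f^, v^> and
   |v|^2 >= eps (1 - eps) |f|^2. The number of these eigenvalues is therefore
   at most the codimension of a space of functions f supported in E such that
   |<1_S f^, v^>| <= eta |f| |v| for all v vanishing on E, where
   eta^2 < eps (1 - eps).

   Cut E into pieces of diameter comparable to their distance l to the
   complement, about 2^j pieces with l of order r 2^-j, down to l of order 1.
   On a piece, average 1_S over intervals of length 4 / l, n times in each
   coordinate direction. This multiplies the convolution kernel by products of
   n factors sin(t) / t, so by at most 2^-n at distances at least l, and it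
   alters 1_S only at distance O(n / l) from the boundary of S. As S is well
   shaped, this neighbourhood is covered by O(1 + l) squares of side O(n / l),
   and by Taylor's formula f^ is O(2^-n) on such a square as soon as O(n^2)
   moments of f vanish. With n of order log (r / eps), the codimension is
   O(n^2) times the sum over the O(log r) scales of 2^j (1 + r 2^-j), that is
   O(r log(r / eps)^3), and 3 <= 1 + 2 s. *)
Require Import Defs.
From HB Require Import structures.
From mathcomp Require Import all_boot all_order all_algebra finmap.
From mathcomp Require Import complex.
From mathcomp Require Import all_classical all_reals all_analysis.
From mathcomp Require Import measurable_realfun ring lra zify.

Set Implicit Arguments.
Unset Strict Implicit.
Unset Printing Implicit Defensive.

Import Order.TTheory GRing.Theory Num.Theory.
Import numFieldNormedType.Exports.

Local Open Scope classical_set_scope.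
Local Open Scope ring_scope.

(** * Integrable and square integrable functions *)

(** The energy inequality rests on two identities: for an eigenfunction [h] with eigenvalue [m] and
    band-limited part [u], |u|^2 = m |h|^2 and |1_E u|^2 = m^2 |h|^2, so that [u] has energy m (1 -
    m) |h|^2 outside [E]. Orthogonality of eigenfunctions for different eigenvalues carries this
    over to combinations. Truncated to the bounded set [E], eigenfunctions lie in L^1 and have a
    Fourier integral. Their band-limited parts lie only in L^2 and are met through pairings with
    test functions, which Plancherel's identity evaluates; that identity is derived from the Poisson
    kernel. The subdivision stops at distance O(1) from the complement, since further scales would
    cost more than O(r) pieces. There the pieces have bounded diameter, and moments at the single
    frequency 0 do, as [S] is bounded. The accuracy 2^-n has to absorb three powers of [r]: one from
    the pieces on a scale, one from the number of scales (crudely bounded by a multiple of [r]), one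
    from |f|_1 <= C r |f|_2. Hence n is of order log (r^3 / eps). *)

Section real_integrals.
Context d (T : measurableType d) (R : realType) (mu : {measure set T -> \bar R}).
Implicit Types f g h : T -> R.

Definition rint f : Prop := mu.-integrable setT (EFin \o f).

Lemma rint_measurable f : rint f -> measurable_fun setT f.
Proof. by move=> /measurable_int/measurable_EFinP. Qed.

Lemma eq_rint f g : f =1 g -> rint f -> rint g.
Proof. by move=> /funext ->. Qed.

Lemma rintD f g : rint f -> rint g -> rint (fun x => f x + g x).
Proof.
by move=> rf rg; apply: eq_integrable (integrableD measurableT rf rg).
Qed.

Lemma rintZ k f : rint f -> rint (fun x => k * f x).
Proof.
by move=> rf; apply: eq_integrable (integrableZl measurableT k rf).
Qed.

Lemma rintN f : rint f -> rint (fun x => - f x).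
Proof. by move=> /(rintZ (-1)); apply: eq_rint => x; rewrite mulN1r. Qed.

Lemma rintB f g : rint f -> rint g -> rint (fun x => f x - g x).
Proof. by move=> rf /rintN; exact: rintD. Qed.

Lemma rint0 : rint (fun=> 0).
Proof. exact: integrable0. Qed.

Lemma rint_sum (I : Type) (s : seq I) (F : I -> T -> R) :
  (forall i, rint (F i)) -> rint (fun x => \sum_(i <- s) F i x).
Proof.
move=> rF; elim: s => [|i s IH].
  by apply: eq_rint rint0 => x; rewrite big_nil.
by apply: eq_rint (rintD (rF i) IH) => x; rewrite big_cons.
Qed.

Lemma rint_le f g : measurable_fun setT f -> (forall x, `|f x| <= g x) ->
  rint g -> rint f.
Proof.
move=> mf fg; apply: le_integrable => //; first exact/measurable_EFinP.
by move=> x _ /=; rewrite lee_fin (le_trans (fg x))// ler_norm.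
Qed.

Lemma rint_norm f : rint f -> rint (fun x => `|f x|).
Proof. exact: integrable_norm. Qed.

Lemma rintM_bounded h f (M : R) : measurable_fun setT h ->
  (forall x, `|h x| <= M) -> rint f -> rint (fun x => h x * f x).
Proof.
move=> mh hM rf; apply: (@rint_le _ (fun x => M * `|f x|)).
- by apply: measurable_funM => //; exact: rint_measurable.
- by move=> x; rewrite normrM ler_wpM2r.
- exact/rintZ/rint_norm.
Qed.

Lemma rint_indic (A : set T) : measurable A -> (mu A < +oo)%E -> rint (\1_A).
Proof.
move=> mA fA; apply/integrableP; split.
  exact/measurable_EFinP.
rewrite (eq_integral (fun x => (\1_A x)%:E)); last first.
  by move=> t _; rewrite gee0_abs// lee_fin.
by rewrite integral_indic// setIT.
Qed.

Lemma rintegral_indic (A : set T) : measurable A ->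
  \int[mu]_x (\1_A x : R) = fine (mu A).
Proof. by move=> mA; rewrite /Rintegral integral_indic// setIT. Qed.

Lemma rintegralD f g : rint f -> rint g ->
  \int[mu]_x (f x + g x) = \int[mu]_x f x + \int[mu]_x g x.
Proof. exact: RintegralD. Qed.

Lemma rintegralB f g : rint f -> rint g ->
  \int[mu]_x (f x - g x) = \int[mu]_x f x - \int[mu]_x g x.
Proof. exact: RintegralB. Qed.

Lemma rintegralZ k f : rint f -> \int[mu]_x (k * f x) = k * \int[mu]_x f x.
Proof. exact: RintegralZl. Qed.

Lemma rintegral_sum (I : Type) (s : seq I) (F : I -> T -> R) :
  (forall i, rint (F i)) ->
  \int[mu]_x (\sum_(i <- s) F i x) = \sum_(i <- s) \int[mu]_x F i x.
Proof.
move=> rF; elim: s => [|i s IH].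
  rewrite big_nil (@eq_Rintegral _ _ _ _ _ (fun=> 0)).
    by rewrite Rintegral_cst// mul0r.
  by move=> x _; rewrite big_nil.
rewrite big_cons -IH -rintegralD//; last exact: rint_sum.
by apply: eq_Rintegral => x _; rewrite big_cons.
Qed.

Lemma rintegral_ge0 f : (forall x, 0 <= f x) -> 0 <= \int[mu]_x f x.
Proof. by move=> f0; apply: Rintegral_ge0. Qed.

Lemma rintegral_le f g : rint f -> rint g -> (forall x, f x <= g x) ->
  \int[mu]_x f x <= \int[mu]_x g x.
Proof. by move=> rf rg fg; apply: le_Rintegral. Qed.

Lemma rintegral_norm f : rint f -> `|\int[mu]_x f x| <= \int[mu]_x `|f x|.
Proof. exact: le_normr_Rintegral. Qed.

Lemma EFin_rintegral f : rint f ->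
  (\int[mu]_x f x)%:E = (\int[mu]_x (f x)%:E)%E.
Proof. by move=> rf; rewrite fineK//; exact: integrable_fin_num. Qed.

Lemma rintegral_ae f g : rint f -> measurable_fun setT g ->
  {ae mu, forall x, f x = g x} ->
  rint g /\ \int[mu]_x f x = \int[mu]_x g x.
Proof.
move=> rf mg fg.
have mf := rint_measurable rf.
have E : {ae mu, forall x, [set: T] x -> (EFin \o f) x = (EFin \o g) x}.
  by apply: filterS fg => x /= ->.
have e := ae_eq_integral (EFin \o g) (EFin \o f) measurableT
  (measurable_int _ rf) ((measurable_EFinP _ _).2 mg) E.
split; last by rewrite /Rintegral e.
apply/integrableP; split; first exact/measurable_EFinP.
case/integrableP : rf => _; congr (_ < _)%E.
apply: ae_eq_integral => //.
- by apply: measurableT_comp => //; exact/measurable_EFinP.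
- by apply: measurableT_comp => //; exact/measurable_EFinP.
- by apply: filterS fg => x /= ->.
Qed.

Lemma rintegral0_ae f : rint f -> (forall x, 0 <= f x) ->
  \int[mu]_x f x = 0 -> {ae mu, forall x, f x = 0}.
Proof.
move=> rf f0 If.
have mf := rint_measurable rf.
have : (\int[mu]_x `|(EFin \o f) x|)%E = 0%E.
  under eq_integral do rewrite gee0_abs ?lee_fin//.
  by rewrite -EFin_rintegral// If.
move=> /(ae_eq_integral_abs mu measurableT) H.
have /H : measurable_fun setT (EFin \o f) by exact/measurable_EFinP.
by apply: filterS => x /(_ I) /= [].
Qed.

Lemma l2P f : f \in Lfun mu 2%:E <->
  measurable_fun setT f /\ rint (fun x => f x ^+ 2).
Proof.
split=> [lf|[mf rf]].
  split; last exact: Lfun2_integrable_sqr.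
  by move: lf; rewrite inE => /andP[]; rewrite inE.
rewrite inE; apply/andP; split; rewrite inE//=.
rewrite /finite_norm unlock.
apply: poweR_lty; case/integrableP: rf => _.
congr (_ < _)%E; apply: eq_integral => x _ /=.
by rewrite powR_mulrn// normrX.
Qed.

Lemma l2M f g : f \in Lfun mu 2%:E -> g \in Lfun mu 2%:E ->
  rint (fun x => f x * g x).
Proof. by move=> lf lg; have /Lfun1_integrable := Lfun2_mul_Lfun1 lf lg. Qed.

Lemma l2D f g : f \in Lfun mu 2%:E -> g \in Lfun mu 2%:E ->
  (fun x => f x + g x) \in Lfun mu 2%:E.
Proof.
by move=> lf lg; apply: (@Lfun_addr_closed _ _ _ mu 2%:E _).2 => //;
  rewrite lee_fin ler1n.
Qed.

Lemma l2Mbounded h f (M : R) : measurable_fun setT h ->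
  (forall x, `|h x| <= M) -> f \in Lfun mu 2%:E ->
  (fun x => h x * f x) \in Lfun mu 2%:E.
Proof.
move=> mh hM /l2P[mf rf]; apply/l2P; split; first exact: measurable_funM.
apply: eq_rint (rintM_bounded (h := fun x => h x ^+ 2) (M := M ^+ 2) _ _ rf).
- by move=> x; rewrite exprMn.
- exact: measurable_funX.
- by move=> x; rewrite normrX lerXn2r// nnegrE// (le_trans _ (hM x)).
Qed.

Lemma l2Z k f : f \in Lfun mu 2%:E -> (fun x => k * f x) \in Lfun mu 2%:E.
Proof. by apply: (@l2Mbounded _ _ `|k|) => //; exact: measurable_cst. Qed.

Lemma rint_l2 h f : rint f -> measurable_fun setT h ->
  (exists M, forall x, `|h x| <= M) -> rint (fun x => f x * h x).
Proof.
move=> rf mh [M hM]; apply: eq_rint (rintM_bounded mh hM rf) => x.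
by rewrite mulrC.
Qed.

End real_integrals.

(** * Fubini's theorem for bounded kernels *)

Section swap.
Context d1 d2 (X : measurableType d1) (Y : measurableType d2) (R : realType).
Variable m1 : {sigma_finite_measure set X -> \bar R}.
Variable m2 : {sigma_finite_measure set Y -> \bar R}.

Lemma measurable_kernel_integral (u : X -> R) (k : X * Y -> R) (M : R) :
  rint m1 u -> measurable_fun setT k -> (forall z, `|k z| <= M) ->
  measurable_fun setT (fun y => \int[m1]_x (u x * k (x, y))).
Proof.
move=> ru mk kM.
have mu := rint_measurable ru.
have M0 : 0 <= M by rewrite (le_trans _ (kM point)).
(* Tonelli's measurability statement wants a nonnegative integrand; the added term |u| M provides it
   and integrates to a constant in [y]. *)
pose F (z : X * Y) : \bar R := (`|u z.1| * M + u z.1 * k z)%:E.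
have mF : measurable_fun setT F.
  apply/measurable_EFinP; apply: measurable_funD; apply: measurable_funM => //.
  - apply: measurableT_comp => //; exact: measurableT_comp.
  - exact: measurableT_comp.
have F0 z : (0 <= F z)%E.
  rewrite lee_fin -lerBlDl sub0r lerNl (le_trans (ler_norm _))// normrN normrM.
  by rewrite ler_wpM2l.
have rk y : rint m1 (fun x => u x * k (x, y)).
  apply: (@rint_l2 _ _ _ _ (fun x => k (x, y))) => //; last by exists M => x.
  exact: measurableT_comp.
have E y : \int[m1]_x (u x * k (x, y)) =
    fine (\int[m1]_x F (x, y))%E - \int[m1]_x (M * `|u x|).
  rewrite -[fine _]/(\int[m1]_x (`|u x| * M + u x * k (x, y))).
  rewrite rintegralD//; last by apply: eq_rint (rintZ M (rint_norm ru)) => x; rewrite mulrC.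
  under [in RHS]eq_Rintegral do rewrite mulrC.
  by rewrite addrAC subrr add0r.
apply: (eq_measurable_fun (fun y =>
  fine (\int[m1]_x F (x, y))%E - \int[m1]_x (M * `|u x|))).
  by move=> y _; rewrite E.
apply: measurable_funB => //; apply: measurableT_comp => //.
exact: (measurable_fun_fubini_tonelli_G F).
Qed.

Lemma kernel_integral_bound (u : X -> R) (k : X * Y -> R) (M : R) y :
  rint m1 u -> measurable_fun setT k -> (forall z, `|k z| <= M) ->
  `|\int[m1]_x (u x * k (x, y))| <= M * \int[m1]_x `|u x|.
Proof.
move=> ru mk kM.
have rk : rint m1 (fun x => u x * k (x, y)).
  apply: (@rint_l2 _ _ _ _ (fun x => k (x, y))) => //; last by exists M => x.
  exact: measurableT_comp.
apply: (le_trans (rintegral_norm rk)).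
rewrite -rintegralZ; last exact: rint_norm.
apply: rintegral_le; [exact: rint_norm|exact/rintZ/rint_norm|].
by move=> x; rewrite normrM mulrC ler_wpM2r.
Qed.

(** Fubini, with M |u| |w| as integrable majorant. In the uses the kernel is a cosine or sine of
    [dot], or a bounded symbol at a translated point. *)
Lemma rintegral_swap (u : X -> R) (w : Y -> R) (k : X * Y -> R) (M : R) :
  rint m1 u -> rint m2 w -> measurable_fun setT k -> (forall z, `|k z| <= M) ->
  \int[m1]_x (u x * \int[m2]_y (w y * k (x, y))) =
  \int[m2]_y (w y * \int[m1]_x (u x * k (x, y))).
Proof.
move=> ru rw mk kM.
have mu := rint_measurable ru.
have mw := rint_measurable rw.
have M0 : 0 <= M by rewrite (le_trans _ (kM point)).
pose F (z : X * Y) : \bar R := (u z.1 * (w z.2 * k z))%:E.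
have mF : measurable_fun setT F.
  apply/measurable_EFinP; apply: measurable_funM => //.
    exact: measurableT_comp.
  by apply: measurable_funM => //; exact: measurableT_comp.
have rw' x : rint m2 (fun y => w y * k (x, y)).
  apply: (@rint_l2 _ _ _ _ (fun y => k (x, y))) => //; last by exists M => y.
  exact: measurableT_comp.
have ru' y : rint m1 (fun x => u x * k (x, y)).
  apply: (@rint_l2 _ _ _ _ (fun x => k (x, y))) => //; last by exists M => x.
  exact: measurableT_comp.
have iF : (m1 \x m2)%E.-integrable setT F.
  apply: (@integrable12ltyP _ _ _ _ _ m1 m2 _ mF).2.
  apply: (@le_lt_trans _ _
    (\int[m1]_x ((M * \int[m2]_y `|w y|) * `|u x|)%:E)%E); last first.
    by rewrite -EFin_rintegral ?ltry//; exact/rintZ/rint_norm.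
  apply: ge0_le_integral => //.
  - by move=> x _; exact: integral_ge0.
  - apply: (measurable_fun_fubini_tonelli_F (abse \o F)).
      exact: measurableT_comp.
    by move=> x; exact: abse_ge0.
  - apply/measurable_EFinP/measurable_funM => //; exact: measurableT_comp.
  - move=> x _.
    under eq_integral do rewrite /F/= normrM EFinM.
    rewrite ge0_integralZl//=; last first.
      apply/measurable_EFinP; apply: measurableT_comp => //.
      exact: rint_measurable (rw' x).
    rewrite -EFin_rintegral; last exact: rint_norm.
    rewrite -EFinM lee_fin mulrC ler_wpM2r//.
    rewrite -rintegralZ; last exact: rint_norm.
    apply: rintegral_le; [exact: rint_norm|exact/rintZ/rint_norm|].
    by move=> y; rewrite normrM mulrC ler_wpM2r.
rewrite /Rintegral; congr fine.
transitivity (\int[m1]_x \int[m2]_y F (x, y))%E.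
  apply: eq_integral => x _; rewrite -[fine _]/(\int[m2]_y (w y * k (x, y))).
  by rewrite -rintegralZ// EFin_rintegral//; exact: rintZ.
rewrite (Fubini iF); apply: eq_integral => y _.
rewrite -[fine _]/(\int[m1]_x (u x * k (x, y))).
rewrite -rintegralZ// EFin_rintegral; last exact: rintZ.
by apply: eq_integral => x _; rewrite /F /= mulrCA.
Qed.

End swap.

Section leb2.
Context {R : realType}.
Local Notation T := (measurableTypeR R * measurableTypeR R)%type.

(** A name for [lebesgue2 R] that carries the structure of a sigma-finite measure, as Fubini's
    theorem and the lemmas on [rint] expect; the two are convertible. *)
Definition leb2 : set T -> \bar R := lebesgue2 R.

HB.instance Definition _ := Measure.on leb2.

Let leb2_sigma_finite : sigma_finite setT leb2.
Proof.
have /sigma_finiteP[F [TF ndF Foo]] := sigma_finiteT (@lebesgue_measure R).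
exists (fun n => F n `*` F n).
  rewrite -setXTT TF predeqE => -[x y]; split.
    move=> [/= [n _ Fnx] [k _ Gky]]; exists (maxn n k) => //; split.
    - by move: x Fnx; exact/subsetPset/ndF/leq_maxl.
    - by move: y Gky; exact/subsetPset/ndF/leq_maxr.
  by move=> [n _ []/= ? ?]; split; exists n.
move=> k; have [? ?] := Foo k.
split; first exact: measurableX.
by rewrite /leb2 product_measure1E// lte_mul_pinfty// ge0_fin_numE.
Qed.

HB.instance Definition _ := Measure_isSigmaFinite.Build _ _ _ leb2
  leb2_sigma_finite.

End leb2.

Section complex_parts.
Local Open Scope complex_scope.
Context {R : realType}.
Implicit Types (a : R) (z w : R[i]).

Lemma ReZ a z : complex.Re (a%:C * z) = a * complex.Re z.
Proof. by case: z => x y /=; rewrite mul0r subr0. Qed.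

Lemma ImZ a z : complex.Im (a%:C * z) = a * complex.Im z.
Proof. by case: z => x y /=; rewrite mul0r addr0. Qed.

Lemma ReD z w : complex.Re (z + w) = complex.Re z + complex.Re w.
Proof. by case: z; case: w. Qed.

Lemma ImD z w : complex.Im (z + w) = complex.Im z + complex.Im w.
Proof. by case: z; case: w. Qed.

Lemma ReB z w : complex.Re (z - w) = complex.Re z - complex.Re w.
Proof. by case: z; case: w. Qed.

Lemma ImB z w : complex.Im (z - w) = complex.Im z - complex.Im w.
Proof. by case: z; case: w. Qed.

Lemma Re0 : complex.Re (0 : R[i]) = 0. Proof. by []. Qed.

Lemma Im0 : complex.Im (0 : R[i]) = 0. Proof. by []. Qed.

Lemma complex_ext z w : complex.Re z = complex.Re w ->
  complex.Im z = complex.Im w -> z = w.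
Proof. by case: z => x y; case: w => x' y' /= -> ->. Qed.

End complex_parts.

Definition ReImE {R : realType} :=
  (@ReZ R, @ImZ R, @ReD R, @ImD R, @ReB R, @ImB R, @Re0 R, @Im0 R).

Section inner_product.
Local Open Scope complex_scope.
Context {R : realType}.
Local Notation cfun := (R * R -> R[i]).
Local Notation mu := (@leb2 R).
Implicit Types (f g h : cfun) (a : R).

(* [L^2] is treated as a real Hilbert space: this is the real part of the
   Hermitian inner product. *)
Definition ip f g : R := \int[mu]_x
  (complex.Re (f x) * complex.Re (g x) + complex.Im (f x) * complex.Im (g x)).

Lemma cL1P f : cLfun 1%:E f <->
  rint mu (fun x => complex.Re (f x)) /\ rint mu (fun x => complex.Im (f x)).
Proof. by rewrite /cLfun; split => -[/Lfun1_integrable ? /Lfun1_integrable ?]. Qed.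

Lemma cL2D f g : cLfun 2%:E f -> cLfun 2%:E g -> cLfun 2%:E (fun x => f x + g x).
Proof.
move=> [f1 f2] [g1 g2]; split.
- by rewrite (_ : (fun x => _) = fun x => complex.Re (f x) + complex.Re (g x));
    [exact: l2D|apply/funext => x; rewrite ReD].
- by rewrite (_ : (fun x => _) = fun x => complex.Im (f x) + complex.Im (g x));
    [exact: l2D|apply/funext => x; rewrite ImD].
Qed.

Lemma cL1D f g : cLfun 1%:E f -> cLfun 1%:E g -> cLfun 1%:E (fun x => f x + g x).
Proof.
move=> /cL1P[f1 f2] /cL1P[g1 g2]; apply/cL1P; split.
- by apply: eq_rint (rintD f1 g1) => x; rewrite ReD.
- by apply: eq_rint (rintD f2 g2) => x; rewrite ImD.
Qed.

Lemma cL2M (h : R * R -> R) (M : R) f : measurable_fun setT h ->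
  (forall x, `|h x| <= M) -> cLfun 2%:E f -> cLfun 2%:E (fun x => (h x)%:C * f x).
Proof.
move=> mh hM [f1 f2]; split.
- by rewrite (_ : (fun x => _) = fun x => h x * complex.Re (f x));
    [exact: (@l2Mbounded _ _ _ mu _ _ M)|apply/funext => x; rewrite ReZ].
- by rewrite (_ : (fun x => _) = fun x => h x * complex.Im (f x));
    [exact: (@l2Mbounded _ _ _ mu _ _ M)|apply/funext => x; rewrite ImZ].
Qed.

Lemma cL1M (h : R * R -> R) (M : R) f : measurable_fun setT h ->
  (forall x, `|h x| <= M) -> cLfun 1%:E f -> cLfun 1%:E (fun x => (h x)%:C * f x).
Proof.
move=> mh hM /cL1P[f1 f2]; apply/cL1P; split.
- by apply: eq_rint (@rintM_bounded _ _ _ mu h _ M mh hM f1) => x; rewrite ReZ.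
- by apply: eq_rint (@rintM_bounded _ _ _ mu h _ M mh hM f2) => x; rewrite ImZ.
Qed.

Lemma cL2Z a f : cLfun 2%:E f -> cLfun 2%:E (fun x => a%:C * f x).
Proof. by apply: (@cL2M (fun=> a) `|a|) => //; exact: measurable_cst. Qed.

Lemma cL1Z a f : cLfun 1%:E f -> cLfun 1%:E (fun x => a%:C * f x).
Proof. by apply: (@cL1M (fun=> a) `|a|) => //; exact: measurable_cst. Qed.

Lemma cL2B f g : cLfun 2%:E f -> cLfun 2%:E g -> cLfun 2%:E (fun x => f x - g x).
Proof.
move=> lf /(cL2Z (-1)) /(cL2D lf); congr (cLfun _ _).
by apply/funext => x; rewrite rmorphN rmorph1 mulN1r.
Qed.

Lemma cL1B f g : cLfun 1%:E f -> cLfun 1%:E g -> cLfun 1%:E (fun x => f x - g x).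
Proof.
move=> lf /(cL1Z (-1)) /(cL1D lf); congr (cLfun _ _).
by apply/funext => x; rewrite rmorphN rmorph1 mulN1r.
Qed.

Lemma cL2_0 : cLfun 2%:E (fun=> 0 : R[i]).
Proof.
by split; apply/l2P; (split; first exact: measurable_cst);
  apply: eq_rint (rint0 _) => x; rewrite expr0n.
Qed.

Lemma cL1_0 : cLfun 1%:E (fun=> 0 : R[i]).
Proof. by apply/cL1P; split; exact: rint0. Qed.

Lemma cL2_sum (I : Type) (s : seq I) (F : I -> cfun) :
  (forall i, cLfun 2%:E (F i)) -> cLfun 2%:E (fun x => \sum_(i <- s) F i x).
Proof.
move=> lF; elim: s => [|i s IH].
  by under eq_fun do rewrite big_nil; exact: cL2_0.
by under eq_fun do rewrite big_cons; exact: cL2D.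
Qed.

Lemma cL1_sum (I : Type) (s : seq I) (F : I -> cfun) :
  (forall i, cLfun 1%:E (F i)) -> cLfun 1%:E (fun x => \sum_(i <- s) F i x).
Proof.
move=> lF; elim: s => [|i s IH].
  by under eq_fun do rewrite big_nil; exact: cL1_0.
by under eq_fun do rewrite big_cons; exact: cL1D.
Qed.

Lemma rint_ip f g : cLfun 2%:E f -> cLfun 2%:E g -> rint mu (fun x =>
  complex.Re (f x) * complex.Re (g x) + complex.Im (f x) * complex.Im (g x)).
Proof. by move=> [f1 f2] [g1 g2]; apply: rintD; exact: l2M. Qed.

Lemma ipC f g : ip f g = ip g f.
Proof.
by apply: eq_Rintegral => x _; rewrite mulrC [X in _ + X]mulrC.
Qed.

Lemma ipDl f g h : cLfun 2%:E f -> cLfun 2%:E g -> cLfun 2%:E h ->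
  ip (fun x => f x + g x) h = ip f h + ip g h.
Proof.
move=> lf lg lh; rewrite /ip -rintegralD; [|exact: rint_ip|exact: rint_ip].
by apply: eq_Rintegral => x _; rewrite !ReImE; ring.
Qed.

Lemma ipZl a f g : cLfun 2%:E f -> cLfun 2%:E g ->
  ip (fun x => a%:C * f x) g = a * ip f g.
Proof.
move=> lf lg; rewrite /ip -rintegralZ; last exact: rint_ip.
by apply: eq_Rintegral => x _; rewrite !ReImE; ring.
Qed.

Lemma ipBl f g h : cLfun 2%:E f -> cLfun 2%:E g -> cLfun 2%:E h ->
  ip (fun x => f x - g x) h = ip f h - ip g h.
Proof.
move=> lf lg lh; rewrite /ip -rintegralB; [|exact: rint_ip|exact: rint_ip].
by apply: eq_Rintegral => x _; rewrite !ReImE; ring.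
Qed.

Lemma ipDr f g h : cLfun 2%:E f -> cLfun 2%:E g -> cLfun 2%:E h ->
  ip h (fun x => f x + g x) = ip h f + ip h g.
Proof. by move=> *; rewrite ipC ipDl// !(ipC _ h). Qed.

Lemma ipBr f g h : cLfun 2%:E f -> cLfun 2%:E g -> cLfun 2%:E h ->
  ip h (fun x => f x - g x) = ip h f - ip h g.
Proof. by move=> *; rewrite ipC ipBl// !(ipC _ h). Qed.

Lemma ipZr a f g : cLfun 2%:E f -> cLfun 2%:E g ->
  ip g (fun x => a%:C * f x) = a * ip g f.
Proof. by move=> *; rewrite ipC ipZl// ipC. Qed.

Lemma ip_suml (I : Type) (s : seq I) (F : I -> cfun) g :
  (forall i, cLfun 2%:E (F i)) -> cLfun 2%:E g ->
  ip (fun x => \sum_(i <- s) F i x) g = \sum_(i <- s) ip (F i) g.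
Proof.
move=> lF lg; elim: s => [|i s IH].
  rewrite big_nil; under [X in ip X _]eq_fun do rewrite big_nil.
  rewrite /ip (@eq_Rintegral _ _ _ _ _ (fun=> 0)).
    by rewrite Rintegral_cst// mul0r.
  by move=> x _; rewrite Re0 Im0 !mul0r addr0.
under [X in ip X _]eq_fun do rewrite big_cons.
by rewrite ipDl// ?IH ?big_cons//; exact: cL2_sum.
Qed.

Lemma ip_sumr (I : Type) (s : seq I) (F : I -> cfun) g :
  (forall i, cLfun 2%:E (F i)) -> cLfun 2%:E g ->
  ip g (fun x => \sum_(i <- s) F i x) = \sum_(i <- s) ip g (F i).
Proof. by move=> lF lg; rewrite ipC ip_suml//; under eq_bigr do rewrite ipC. Qed.

Lemma ip_ge0 f : 0 <= ip f f.
Proof. by apply: rintegral_ge0 => x; rewrite addr_ge0// -expr2 sqr_ge0. Qed.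

Lemma aeS2 (P1 P2 Q : R * R -> Prop) : (forall x, P1 x -> P2 x -> Q x) ->
  {ae (lebesgue2 R), forall x, P1 x} -> {ae (lebesgue2 R), forall x, P2 x} ->
  {ae (lebesgue2 R), forall x, Q x}.
Proof.
exact: (@filterS2 _ _ (ae_filter_ringOfSetsType mu)).
Qed.

Lemma aeS (P Q : R * R -> Prop) : (forall x, P x -> Q x) ->
  {ae (lebesgue2 R), forall x, P x} -> {ae (lebesgue2 R), forall x, Q x}.
Proof. by move=> PQ H; apply: (aeS2 _ H H) => x + _; exact: PQ. Qed.

Lemma ip_eq_ae f f' g g' : cLfun 2%:E f -> cLfun 2%:E g -> cLfun 2%:E f' ->
  cLfun 2%:E g' -> ae_equal f f' -> ae_equal g g' -> ip f g = ip f' g'.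
Proof.
move=> lf lg lf' lg' ff' gg'.
apply: (rintegral_ae _ _ _).2.
- exact: rint_ip.
- exact: rint_measurable (rint_ip lf' lg').
- by apply: (aeS2 _ ff' gg') => x /= -> ->.
Qed.

Lemma ip0_ae f : cLfun 2%:E f -> ip f f = 0 -> ae_equal f (fun=> 0).
Proof.
move=> lf /(rintegral0_ae (rint_ip lf lf)) H.
have /H : forall x, 0 <= complex.Re (f x) * complex.Re (f x) +
    complex.Im (f x) * complex.Im (f x).
  by move=> x; rewrite addr_ge0// -expr2 sqr_ge0.
apply: aeS => x /eqP; rewrite -!expr2 paddr_eq0 ?sqr_ge0// !sqrf_eq0.
by move=> /andP[/eqP a /eqP b]; apply: complex_ext.
Qed.

Lemma ae_ip0 f : cLfun 2%:E f -> ae_equal f (fun=> 0) -> ip f f = 0.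
Proof.
move=> lf f0; rewrite (ip_eq_ae lf lf cL2_0 cL2_0 f0 f0) /ip.
rewrite (@eq_Rintegral _ _ _ _ _ (fun=> 0)).
  by rewrite Rintegral_cst// mul0r.
by move=> x _; rewrite Re0 Im0 !mul0r addr0.
Qed.

Lemma ip_cauchy f g : cLfun 2%:E f -> cLfun 2%:E g ->
  ip f g ^+ 2 <= ip f f * ip g g.
Proof.
move=> lf lg.
pose A := ip f f; pose B := ip f g; pose C := ip g g.
have q t : 0 <= t ^+ 2 * A + 2 * t * B + C.
  have lt := cL2Z t lf.
  have := ip_ge0 (fun x => t%:C * f x + g x).
  rewrite ipDl ?ipDr ?ipZl ?ipZr ?(ipC g f) -/A -/B -/C//; last exact: cL2D.
  by move=> h; apply: le_trans h _; rewrite le_eqVlt; apply/orP; left; apply/eqP; ring.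
have A0 : 0 <= A by exact: ip_ge0.
rewrite -/A -/B -/C.
move: A0; rewrite le_eqVlt => /predU1P[A0|A0].
  rewrite -A0 mul0r; have [->|B0] := eqVneq B 0; first by rewrite expr0n.
  (* For A = 0 the polynomial is affine in [t], and this [t] gives it the value -1. *)
  have := q (- (C + 1) / (2 * B)); rewrite -A0.
  suff -> : (- (C + 1) / (2 * B)) ^+ 2 * 0 + 2 * (- (C + 1) / (2 * B)) * B + C = - 1.
    by rewrite oppr_ge0 ler10.
  by field.
have := q (- B / A).
suff -> : (- B / A) ^+ 2 * A + 2 * (- B / A) * B + C = (A * C - B ^+ 2) / A.
  by rewrite pmulr_lge0 ?invr_gt0// subr_ge0.
by field; rewrite gt_eqF.
Qed.

Lemma ip_cauchy_sqrt f g : cLfun 2%:E f -> cLfun 2%:E g ->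
  `|ip f g| <= Num.sqrt (ip f f) * Num.sqrt (ip g g).
Proof.
move=> lf lg; rewrite -sqrtrM ?ip_ge0// -sqrtr_sqr ler_wsqrtr//.
exact: ip_cauchy.
Qed.

End inner_product.

(** * The Fourier transform of integrable functions *)

Section trigonometric_transforms.
Local Open Scope complex_scope.
Context {R : realType}.
Local Notation cfun := (R * R -> R[i]).
Local Notation T := (measurableTypeR R * measurableTypeR R)%type.
Local Notation mu := (@leb2 R).
Implicit Types (u v m : R * R -> R) (f g : cfun).

Lemma measurable_cos : measurable_fun setT (@cos R).
Proof. by apply: continuous_measurable_fun; exact: continuous_cos. Qed.

Lemma measurable_sin : measurable_fun setT (@sin R).
Proof. by apply: continuous_measurable_fun; exact: continuous_sin. Qed.

Lemma measurable_dot : measurable_fun setT (fun z : T * T => dot z.1 z.2).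
Proof.
apply: measurable_funD; apply: measurable_funM.
- by apply: (measurableT_comp measurable_fst); exact: measurable_fst.
- by apply: (measurableT_comp measurable_fst); exact: measurable_snd.
- by apply: (measurableT_comp measurable_snd); exact: measurable_fst.
- by apply: (measurableT_comp measurable_snd); exact: measurable_snd.
Qed.

Lemma dotC (x y : R * R) : dot x y = dot y x.
Proof. by rewrite /dot mulrC [X in _ + X]mulrC. Qed.

Lemma dotBl (x y z : R * R) : dot (x - y) z = dot x z - dot y z.
Proof. by rewrite /dot /=; ring. Qed.

(** What cosine and sine have in common here: the real and imaginary parts of the Fourier kernel are
    then handled by the same lemmas. *)
Definition trig (tr : R -> R) : Prop :=
  measurable_fun setT tr /\ forall t, `|tr t| <= 1.

Lemma trig_cos : trig cos.
Proof. by split; [exact: measurable_cos|exact: cos_max]. Qed.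

Lemma trig_sin : trig sin.
Proof. by split; [exact: measurable_sin|exact: sin_max]. Qed.

Definition trigt (tr : R -> R) u (xi : R * R) : R :=
  \int[mu]_x (u x * tr (dot x xi)).

Lemma measurable_trig_dot tr : trig tr ->
  measurable_fun setT (fun z : T * T => tr (dot z.1 z.2)).
Proof. by move=> [mt _]; apply: measurableT_comp => //; exact: measurable_dot. Qed.

Lemma measurable_trig_dotl tr (xi : R * R) : trig tr ->
  measurable_fun setT (fun x : T => tr (dot x xi)).
Proof.
move=> /measurable_trig_dot H.
apply: (measurableT_comp H (g := fun x : T => (x, xi : T))).
exact: measurable_fun_pair.
Qed.

Lemma rint_trig tr u (xi : R * R) : trig tr -> rint mu u ->
  rint mu (fun x => u x * tr (dot x xi)).
Proof.
move=> ttr ru; apply: (@rint_l2 _ _ _ mu (fun x => tr (dot x xi))) => //.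
  exact: measurable_trig_dotl.
by exists 1 => x; exact: ttr.2.
Qed.

Lemma measurable_trigt tr u : trig tr -> rint mu u ->
  measurable_fun setT (trigt tr u : T -> R).
Proof.
move=> ttr ru.
apply: (@measurable_kernel_integral _ _ _ _ _ mu u _ 1 ru (measurable_trig_dot ttr)).
by move=> z; exact: ttr.2.
Qed.

Lemma trigt_bound tr u xi : trig tr -> rint mu u ->
  `|trigt tr u xi| <= \int[mu]_x `|u x|.
Proof.
move=> ttr ru.
have := @kernel_integral_bound _ _ _ _ _ mu u _ 1 xi ru (measurable_trig_dot ttr).
by rewrite mul1r; apply => z; exact: ttr.2.
Qed.

Lemma rint_mul_trigt tr m u : trig tr -> rint mu m -> rint mu u ->
  rint mu (fun xi => m xi * trigt tr u xi).
Proof.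
move=> ttr rm ru; apply: rint_l2 => //; first exact: measurable_trigt.
by exists (\int[mu]_x `|u x|) => xi; exact: trigt_bound.
Qed.

Lemma trigt_swap tr u v : trig tr -> rint mu u -> rint mu v ->
  \int[mu]_x (u x * trigt tr v x) = \int[mu]_x (v x * trigt tr u x).
Proof.
move=> ttr ru rv.
rewrite -(@rintegral_swap _ _ _ _ _ mu mu u v _ 1 ru rv (measurable_trig_dot ttr)).
  apply: eq_Rintegral => x _; congr (_ * _).
  by apply: eq_Rintegral => y _; rewrite dotC.
by move=> z; exact: ttr.2.
Qed.

Lemma trigtM tr tr' m u x : trig tr -> trig tr' -> rint mu m -> rint mu u ->
  trigt tr (fun xi => m xi * trigt tr' u xi) x =
  \int[mu]_y (u y * trigt tr' (fun xi => m xi * tr (dot xi x)) y).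
Proof.
move=> ttr ttr' rm ru; rewrite trigt_swap//; last exact: rint_trig.
by apply: eq_Rintegral => xi _; ring.
Qed.

Lemma trigtD tr u v xi : trig tr -> rint mu u -> rint mu v ->
  trigt tr (fun x => u x + v x) xi = trigt tr u xi + trigt tr v xi.
Proof.
move=> ttr ru rv; rewrite /trigt -rintegralD; [|exact: rint_trig|exact: rint_trig].
by apply: eq_Rintegral => x _; rewrite mulrDl.
Qed.

Lemma trigtB tr u v xi : trig tr -> rint mu u -> rint mu v ->
  trigt tr (fun x => u x - v x) xi = trigt tr u xi - trigt tr v xi.
Proof.
move=> ttr ru rv; rewrite /trigt -rintegralB; [|exact: rint_trig|exact: rint_trig].
by apply: eq_Rintegral => x _; rewrite mulrBl.
Qed.

Lemma trigtZ tr a u xi : trig tr -> rint mu u ->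
  trigt tr (fun x => a * u x) xi = a * trigt tr u xi.
Proof.
move=> ttr ru; rewrite /trigt -rintegralZ; last exact: rint_trig.
by apply: eq_Rintegral => x _; rewrite mulrA.
Qed.

Local Notation re f := (fun x : R * R => complex.Re (f x)).
Local Notation im f := (fun x : R * R => complex.Im (f x)).
Local Notation c0 := ((2 * @pi R)^-1).

Lemma Re_fourierL1 f xi : cLfun 1%:E f ->
  complex.Re (fourierL1 f xi) = c0 * (trigt cos (re f) xi + trigt sin (im f) xi).
Proof.
move=> /cL1P[f1 f2]; rewrite /fourierL1 ReZ /cintegral; congr (_ * _).
rewrite /trigt -rintegralD; [|exact: (rint_trig _ trig_cos f1)|exact: (rint_trig _ trig_sin f2)].
apply: eq_Rintegral => x _; rewrite /cexpNi; case: (f x) => a b /=; ring.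
Qed.

Lemma Im_fourierL1 f xi : cLfun 1%:E f ->
  complex.Im (fourierL1 f xi) = c0 * (trigt cos (im f) xi - trigt sin (re f) xi).
Proof.
move=> /cL1P[f1 f2]; rewrite /fourierL1 ImZ /cintegral; congr (_ * _).
rewrite /trigt -rintegralB; [|exact: (rint_trig _ trig_cos f2)|exact: (rint_trig _ trig_sin f1)].
apply: eq_Rintegral => x _; rewrite /cexpNi; case: (f x) => a b /=; ring.
Qed.

(* the adjoint of [fourierL1], with kernel [exp (+ i t)] *)
Definition fourierL1_adj g : cfun := fun x =>
  (c0 * (trigt cos (re g) x - trigt sin (im g) x)) +i*
  (c0 * (trigt cos (im g) x + trigt sin (re g) x)).

Lemma measurable_fourierL1 f : cLfun 1%:E f ->
  measurable_fun setT (re (fourierL1 f) : T -> R) /\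
  measurable_fun setT (im (fourierL1 f) : T -> R).
Proof.
move=> lf; have /cL1P[f1 f2] := lf; split.
- rewrite (_ : (fun x => _) = fun xi : T =>
    c0 * (trigt cos (re f) xi + trigt sin (im f) xi)).
    apply: measurable_funM => //; apply: measurable_funD.
      exact: (measurable_trigt trig_cos f1).
    exact: (measurable_trigt trig_sin f2).
  by apply/funext => xi; rewrite Re_fourierL1.
- rewrite (_ : (fun x => _) = fun xi : T =>
    c0 * (trigt cos (im f) xi - trigt sin (re f) xi)).
    apply: measurable_funM => //; apply: measurable_funB.
      exact: (measurable_trigt trig_cos f2).
    exact: (measurable_trigt trig_sin f1).
  by apply/funext => xi; rewrite Im_fourierL1.
Qed.

Lemma c0_ge0 : 0 <= c0.
Proof. by rewrite invr_ge0 mulr_ge0// pi_ge0. Qed.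

Lemma fourierL1_bound f xi : cLfun 1%:E f ->
  `|complex.Re (fourierL1 f xi)| <=
    c0 * \int[mu]_x (`|complex.Re (f x)| + `|complex.Im (f x)|) /\
  `|complex.Im (fourierL1 f xi)| <=
    c0 * \int[mu]_x (`|complex.Re (f x)| + `|complex.Im (f x)|).
Proof.
move=> lf; have /cL1P[f1 f2] := lf.
rewrite Re_fourierL1// Im_fourierL1// !normrM (ger0_norm c0_ge0).
rewrite rintegralD; [|exact: rint_norm|exact: rint_norm].
split; rewrite ler_wpM2l ?c0_ge0//.
- rewrite (le_trans (ler_normD _ _))// lerD//; apply: trigt_bound => //.
    exact: trig_cos.
  exact: trig_sin.
- rewrite (le_trans (ler_normB _ _))// addrC lerD//; apply: trigt_bound => //.
    exact: trig_sin.
  exact: trig_cos.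
Qed.

Let shuffle (c a b d e : R) : c * (a + b + (d - e)) = c * (d + b + (a - e)).
Proof. by ring. Qed.

Lemma fourierL1_adjP f g : cLfun 1%:E f -> cLfun 1%:E g ->
  ip (fourierL1 f) g = ip f (fourierL1_adj g).
Proof.
move=> lf lg; have /cL1P[f1 f2] := lf; have /cL1P[g1 g2] := lg.
have [tc ts] := (trig_cos, trig_sin).
pose I := (trigt_swap tc f1 g1, trigt_swap tc f2 g2,
           trigt_swap ts f1 g2, trigt_swap ts f2 g1).
have A u v u' v' : rint mu u -> rint mu v -> rint mu u' -> rint mu v' ->
    \int[mu]_x (v x * (c0 * (trigt cos u x + trigt sin u' x)) +
                v' x * (c0 * (trigt cos u' x - trigt sin u x))) =
    c0 * (\int[mu]_x (v x * trigt cos u x) + \int[mu]_x (v x * trigt sin u' x) +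
     (\int[mu]_x (v' x * trigt cos u' x) - \int[mu]_x (v' x * trigt sin u x))).
  move=> ru rv ru' rv'.
  have [h1 h2] := (rint_mul_trigt tc rv ru, rint_mul_trigt ts rv ru').
  have [h3 h4] := (rint_mul_trigt tc rv' ru', rint_mul_trigt ts rv' ru).
  rewrite -rintegralD// -rintegralB// -rintegralD//; last 2 first.
  - exact: rintD.
  - exact: rintB.
  rewrite -rintegralZ; last by apply: rintD; [exact: rintD|exact: rintB].
  by apply: eq_Rintegral => x _; ring.
transitivity (\int[mu]_x (complex.Re (g x) * (c0 * (trigt cos (re f) x + trigt sin (im f) x)) +
                complex.Im (g x) * (c0 * (trigt cos (im f) x - trigt sin (re f) x)))).
  apply: eq_Rintegral => x _; rewrite Re_fourierL1// Im_fourierL1//; ring.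
rewrite (A _ _ _ _ f1 g1 f2 g2).
transitivity (\int[mu]_x (complex.Im (f x) * (c0 * (trigt cos (im g) x + trigt sin (re g) x)) +
                complex.Re (f x) * (c0 * (trigt cos (re g) x - trigt sin (im g) x)))).
  by rewrite (A _ _ _ _ g2 f2 g1 f1) !I; exact: shuffle.
by apply: eq_Rintegral => x _; rewrite /= addrC.
Qed.

Lemma trigt_cosB m x y : rint mu m ->
  trigt cos m (x - y) = trigt cos (fun xi => m xi * cos (dot xi x)) y +
    trigt sin (fun xi => m xi * sin (dot xi x)) y.
Proof.
move=> rm; have [tc ts] := (trig_cos, trig_sin).
have [hc hs] := (rint_trig x tc rm, rint_trig x ts rm).
rewrite /trigt -rintegralD; [|exact: rint_trig|exact: rint_trig].
by apply: eq_Rintegral => xi _; rewrite dotC dotBl cosB !(dotC _ xi); ring.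
Qed.

Lemma trigt_sinB m x y : rint mu m ->
  trigt sin m (x - y) = trigt cos (fun xi => m xi * sin (dot xi x)) y -
    trigt sin (fun xi => m xi * cos (dot xi x)) y.
Proof.
move=> rm; have [tc ts] := (trig_cos, trig_sin).
have [hc hs] := (rint_trig x tc rm, rint_trig x ts rm).
rewrite /trigt -rintegralB; [|exact: rint_trig|exact: rint_trig].
by apply: eq_Rintegral => xi _; rewrite dotC dotBl sinB !(dotC _ xi); ring.
Qed.

Lemma rint_conv_cos m u x : rint mu m -> rint mu u ->
  rint mu (fun y => u y * trigt cos m (x - y)).
Proof.
move=> rm ru; have [tc ts] := (trig_cos, trig_sin).
have [hc hs] := (rint_trig x tc rm, rint_trig x ts rm).
have := rintD (rint_mul_trigt tc ru hc) (rint_mul_trigt ts ru hs).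
by apply: eq_rint => y; rewrite trigt_cosB// mulrDr.
Qed.

Lemma rint_conv_sin m u x : rint mu m -> rint mu u ->
  rint mu (fun y => u y * trigt sin m (x - y)).
Proof.
move=> rm ru; have [tc ts] := (trig_cos, trig_sin).
have [hc hs] := (rint_trig x tc rm, rint_trig x ts rm).
have := rintB (rint_mul_trigt tc ru hs) (rint_mul_trigt ts ru hc).
by apply: eq_rint => y; rewrite trigt_sinB// mulrBr.
Qed.

Lemma conv_cos m u x : rint mu m -> rint mu u ->
  \int[mu]_y (u y * trigt cos m (x - y)) =
  trigt cos (fun xi => m xi * trigt cos u xi) x +
  trigt sin (fun xi => m xi * trigt sin u xi) x.
Proof.
move=> rm ru; have [tc ts] := (trig_cos, trig_sin).
have [hc hs] := (rint_trig x tc rm, rint_trig x ts rm).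
rewrite !trigtM// -rintegralD; [|exact: rint_mul_trigt|exact: rint_mul_trigt].
by apply: eq_Rintegral => y _; rewrite trigt_cosB// mulrDr.
Qed.

Lemma conv_sin m u x : rint mu m -> rint mu u ->
  \int[mu]_y (u y * trigt sin m (x - y)) =
  trigt sin (fun xi => m xi * trigt cos u xi) x -
  trigt cos (fun xi => m xi * trigt sin u xi) x.
Proof.
move=> rm ru; have [tc ts] := (trig_cos, trig_sin).
have [hc hs] := (rint_trig x tc rm, rint_trig x ts rm).
rewrite !trigtM// -rintegralB; [|exact: rint_mul_trigt|exact: rint_mul_trigt].
by apply: eq_Rintegral => y _; rewrite trigt_sinB// mulrBr.
Qed.

Let shuffle_re (c a b d e : R) :
  c * (c * (a + b) - c * (d - e)) = c ^+ 2 * (a + e - (d - b)).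
Proof. by ring. Qed.

Let shuffle_im (c a b d e : R) :
  c * (c * (a - b) + c * (d + e)) = c ^+ 2 * (a + e + (d - b)).
Proof. by ring. Qed.

(** A Fourier multiplier is a convolution operator whose kernel is the transform of [m]. It serves
    twice: with Abel's factor for Plancherel's identity, and with a smoothed indicator of [S] for
    the decay away from the diagonal. *)
Lemma fourierL1_adjM m f x : rint mu m -> cLfun 1%:E f ->
  fourierL1_adj (fun xi => (m xi)%:C * fourierL1 f xi) x =
  (c0 ^+ 2 * \int[mu]_y (complex.Re (f y) * trigt cos m (x - y) -
                         complex.Im (f y) * trigt sin m (x - y))) +i*
  (c0 ^+ 2 * \int[mu]_y (complex.Im (f y) * trigt cos m (x - y) +
                         complex.Re (f y) * trigt sin m (x - y))).
Proof.
move=> rm lf; have /cL1P[f1 f2] := lf; have [tc ts] := (trig_cos, trig_sin).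
have [k1 k2] := (rint_mul_trigt tc rm f1, rint_mul_trigt ts rm f1).
have [k3 k4] := (rint_mul_trigt tc rm f2, rint_mul_trigt ts rm f2).
rewrite rintegralB ?rintegralD; [|exact: rint_conv_cos|exact: rint_conv_sin
  |exact: rint_conv_cos|exact: rint_conv_sin].
rewrite !conv_cos// !conv_sin//.
have E1 tr : trig tr -> trigt tr (re (fun xi => (m xi)%:C * fourierL1 f xi)) x =
    c0 * (trigt tr (fun xi => m xi * trigt cos (re f) xi) x +
          trigt tr (fun xi => m xi * trigt sin (im f) xi) x).
  move=> ttr; rewrite -trigtD// -trigtZ//; last exact: rintD.
  by apply: eq_Rintegral => xi _; rewrite ReZ Re_fourierL1//; ring.
have E2 tr : trig tr -> trigt tr (im (fun xi => (m xi)%:C * fourierL1 f xi)) x =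
    c0 * (trigt tr (fun xi => m xi * trigt cos (im f) xi) x -
          trigt tr (fun xi => m xi * trigt sin (re f) xi) x).
  move=> ttr; rewrite -trigtB// -trigtZ//; last exact: rintB.
  by apply: eq_Rintegral => xi _; rewrite ImZ Im_fourierL1//; ring.
rewrite /fourierL1_adj !E1// !E2//.
exact: (congr2 (fun p q => p +i* q) (shuffle_re _ _ _ _ _) (shuffle_im _ _ _ _ _)).
Qed.

End trigonometric_transforms.

Section measure_preserving.
Context d (X : measurableType d) (R : realType) (mu : {measure set X -> \bar R}).

(** Integrability is assumed of [g \o phi] and deduced for [g]. To transport an integrable function
    along a shift or reflection, the lemma is therefore applied with the inverse map as [phi]. *)
Lemma rintegral_invariant (phi : X -> X) (g : X -> R) :
  measurable_fun setT phi ->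
  (forall A, measurable A -> mu (phi @^-1` A) = mu A) ->
  measurable_fun setT g -> rint mu (g \o phi) ->
  rint mu g /\ \int[mu]_x g x = \int[mu]_x g (phi x).
Proof.
move=> mphi phiA mg rg.
have mg' : measurable_fun setT (EFin \o g) by exact/measurable_EFinP.
have i1 : (pushforward mu phi).-integrable setT (EFin \o g).
  exact: (@integrable_pushforward _ _ _ _ R phi mphi mu setT (EFin \o g)).
split.
  case/integrableP : i1 => _ i1; apply/integrableP; split => //.
  move: i1; rewrite (eq_measure_integral (pushforward mu phi))// => A mA _.
  by rewrite /= /pushforward phiA.
rewrite /Rintegral; congr fine.
rewrite -(@integral_pushforward _ _ _ _ R phi mphi mu setT (EFin \o g))//.
by apply: eq_measure_integral => A mA _; rewrite /= /pushforward phiA.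
Qed.

End measure_preserving.

Section line_integrals.
Context {R : realType}.
Local Notation leb := (@lebesgue_measure R).
Implicit Types f F g : R -> R.

Lemma lebesgue_measure_shift (a : R) (A : set R) : measurable A ->
  leb ((fun x => x + a) @^-1` A) = leb A.
Proof.
move=> mA; apply/esym.
have mshift : measurable_fun setT ((fun x => x + a) : measurableTypeR R -> measurableTypeR R).
  exact: measurable_funD.
pose nu := pushforward leb ((fun x => x + a) : measurableTypeR R -> measurableTypeR R).
change (leb A = nu A).
apply: (@lebesgue_measure_unique R nu) => // _ [[u v]] _ <-.
have P : (fun x => x + a) @^-1` `]u, v]%classic = `]u - a, v - a]%classic.
  by apply/seteqP; split => x /=; rewrite !in_itv/= ltrBlDr lerBrDr.
transitivity (leb `]u - a, v - a]%classic); last by rewrite /nu /pushforward/= -P.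
rewrite !lebesgue_measure_itv/= !lte_fin ltrD2r -!EFinD; case: ifP => // _.
congr EFin; ring.
Qed.

Lemma rintegral_shift (a : R) g : rint leb g ->
  rint leb (fun x => g (x + a)) /\ \int[leb]_x g (x + a) = \int[leb]_x g x.
Proof.
move=> rg.
have mg := rint_measurable rg.
have ms (b : R) : measurable_fun setT (fun x : R => x + b).
  exact: measurable_funD.
have [] := @rintegral_invariant _ (measurableTypeR R) R leb (fun x => x - a) (fun x => g (x + a)).
- exact: ms.
- by move=> A mA; exact: (lebesgue_measure_shift (- a)).
- exact: (measurableT_comp mg (ms a)).
- by apply: eq_rint rg => x /=; rewrite subrK.
move=> r e; split => //; rewrite e; apply: eq_Rintegral => x _.
by rewrite subrK.
Qed.

Lemma rintegral_opp g : rint leb g ->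
  rint leb (fun x => g (- x)) /\ \int[leb]_x g (- x) = \int[leb]_x g x.
Proof.
move=> rg.
have mg := rint_measurable rg.
have [] := @rintegral_invariant _ (measurableTypeR R) R leb (fun x => - x) (fun x => g (- x)).
- exact: oppr_measurable.
- by move=> A mA; exact: lebesgue_measureN.
- by apply: measurableT_comp => //; exact: oppr_measurable.
- by apply: eq_rint rg => x /=; rewrite opprK.
move=> r e; split => //; rewrite e; apply: eq_Rintegral => x _.
by rewrite opprK.
Qed.

Lemma rintegral_odd g : rint leb g -> (forall x, g (- x) = - g x) ->
  \int[leb]_x g x = 0.
Proof.
move=> rg og; have [_] := rintegral_opp rg.
under eq_Rintegral do rewrite og -mulN1r.
by rewrite rintegralZ// => H; lra.
Qed.

Lemma is_derive_continuous f g : (forall x : R, is_derive x 1 f (g x)) -> continuous f.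
Proof.
move=> df x; apply: differentiable_continuous.
by apply/derivable1_diffP; have [] := df x.
Qed.

Lemma integral_ftc_y f F a l : (forall x : R, is_derive x 1 F (f x)) -> continuous f ->
  (forall x, 0 <= f x) -> F x @[x --> +oo] --> l ->
  (\int[leb]_(x in `[a, +oo[) (f x)%:E = (l - F a)%:E)%E.
Proof.
move=> dF cf f0 Fl.
have cF := is_derive_continuous dF.
rewrite (@ge0_continuous_FTC2y _ f F a l)//.
- exact: continuous_subspaceT.
- exact/cvg_at_right_filter/cF.
- by move=> x _; rewrite derive1E; exact: (@derive_val _ _ _ _ _ _ _ (dF x)).
Qed.

Lemma integral_ftc f F a b : (forall x : R, is_derive x 1 F (f x)) -> continuous f ->
  a < b -> (\int[leb]_(x in `[a, b]) (f x)%:E = (F b - F a)%:E)%E.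
Proof.
move=> dF cf ab.
have cF := is_derive_continuous dF.
rewrite (@continuous_FTC2 _ f F a b)//.
- exact: continuous_subspaceT.
- split.
  + by move=> x _; have [] := dF x.
  + exact/cvg_at_right_filter/cF.
  + exact/cvg_at_left_filter/cF.
- by move=> x _; rewrite derive1E; exact: (@derive_val _ _ _ _ _ _ _ (dF x)).
Qed.

End line_integrals.

(** * The Poisson kernel on the line as the transform of Abel's factor *)

Section poisson_line.
Context {R : realType}.
Local Notation leb := (@lebesgue_measure R).
Context (t : R) (t0 : 0 < t).

Definition abel (s : R) : R := expR (- (t * `|s|)).

(** The Cauchy density t / (pi (t^2 + z^2)), in the form in which it is the derivative of
    [pi^-1 * atan (z / t)]. Up to the factor 2 pi it is the cosine transform of [abel]; being
    positive, of mass 1 and concentrating at 0 as t tends to 0, it lets Plancherel's identity be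
    reached without Fourier inversion. *)
Definition poisson (z : R) : R := pi^-1 * (t^-1 * (1 + (z / t) ^+ 2)^-1).

Lemma abel_ge0 s : 0 <= abel s. Proof. exact: expR_ge0. Qed.

Lemma abel_le1 s : abel s <= 1.
Proof. by rewrite -expR0 ler_expR oppr_le0 mulr_ge0// ltW. Qed.

Lemma continuous_abel : continuous abel.
Proof.
move=> x; apply: continuous_comp; last exact: continuous_expR.
apply: continuousN; apply: cvgM; first exact: cvg_cst.
exact: norm_continuous.
Qed.

Lemma poisson_ge0 z : 0 <= poisson z.
Proof.
by rewrite !mulr_ge0// ?invr_ge0 ?pi_ge0 ?(ltW t0)// addr_ge0// sqr_ge0.
Qed.

Lemma poisson_le z : poisson z <= (pi * t)^-1.
Proof.
rewrite /poisson invfM ler_wpM2l ?invr_ge0 ?pi_ge0//.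
rewrite -[leRHS]mulr1 ler_wpM2l ?invr_ge0 ?(ltW t0)//.
by rewrite invf_le1 ?lerDl ?sqr_ge0// ltr_wpDr ?sqr_ge0.
Qed.

Lemma continuous_poisson : continuous poisson.
Proof.
move=> x; apply: cvgM; first exact: cvg_cst.
apply: cvgM; first exact: cvg_cst.
apply: cvgV; first by rewrite gt_eqF// ltr_wpDr ?sqr_ge0.
apply: cvgD; first exact: cvg_cst.
by apply: cvgM; (apply: cvgM; [exact: cvg_id|exact: cvg_cst]).
Qed.

Lemma poissonN z : poisson (- z) = poisson z.
Proof. by rewrite /poisson mulNr sqrrN. Qed.

Lemma is_derive_atan_scaled (x : R) :
  is_derive x 1 (fun z => pi^-1 * atan (z / t)) (poisson x).
Proof.
have -> : (fun z => pi^-1 * atan (z / t)) = pi^-1 \*: (atan \o (fun z : R => t^-1 *: z)).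
  by apply/funext => z; rewrite /= /GRing.scale /= (mulrC z).
apply: is_derive_eq.
rewrite /poisson /= /GRing.scale /= mulr1 (mulrC t^-1 x).
by congr (_ * _); exact: mulrC.
Qed.

Lemma cvg_atan_scaled : pi^-1 * atan (z / t) @[z --> +oo] --> (2^-1 : R).
Proof.
have -> : (2^-1 : R) = pi^-1 * (pi / 2) by rewrite mulrA mulVf ?mul1r// gt_eqF// pi_gt0.
apply: cvgM; first exact: cvg_cst.
apply: (@cvg_comp _ _ _ (fun z => z / t) atan _ (pinfty_nbhs R)); last exact: cvgy_atan.
by apply: gt0_cvgMly => //; rewrite invr_gt0.
Qed.

Lemma integral_poisson : (\int[leb]_z (poisson z)%:E = 1)%E.
Proof.
rewrite ge0_symfun_integralT; first last.
- by move=> z /=; rewrite poissonN.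
- exact: continuous_poisson.
- exact: poisson_ge0.
rewrite -set_itvcy (integral_ftc_y 0 is_derive_atan_scaled continuous_poisson
  poisson_ge0 cvg_atan_scaled) mul0r atan0 mulr0 subr0.
by rewrite -EFinM divff.
Qed.

Lemma rint_poisson : rint leb poisson.
Proof.
apply/integrableP; split.
  by apply/measurable_EFinP; apply: continuous_measurable_fun; exact: continuous_poisson.
under eq_integral do rewrite gee0_abs ?lee_fin ?poisson_ge0//.
by rewrite integral_poisson ltry.
Qed.

Lemma rintegral_poisson : \int[leb]_z poisson z = 1.
Proof. by rewrite /Rintegral integral_poisson. Qed.

Lemma rintegral_poissonB x : rint leb (fun y => poisson (x - y)) /\
  \int[leb]_y poisson (x - y) = 1.
Proof.
have [r e] := rintegral_shift (- x) rint_poisson.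
rewrite -rintegral_poisson -e; split.
  by apply: eq_rint r => y; rewrite -poissonN opprB.
by apply: eq_Rintegral => y _; rewrite -poissonN opprB.
Qed.

(** A primitive of exp (- t s) (1 + cos (z s)). The summand 1 makes the integrand nonnegative, as
    [integral_ftc_y] demands; its contribution is half of the case z = 0 and is subtracted
    afterwards. *)
Let prim (z s : R) : R := expR (- (t * s)) *
  ((z * sin (z * s) - t * cos (z * s)) / (t ^+ 2 + z ^+ 2) - t^-1).

Let dprim (z s : R) : is_derive s 1 (prim z) (expR (- (t * s)) * (1 + cos (z * s))).
Proof.
have tz : t ^+ 2 + z ^+ 2 != 0 by rewrite gt_eqF// ltr_pwDl ?exprn_gt0 ?sqr_ge0.
have -> : prim z = (expR \o (fun s : R => (- t) *: s)) *
   ((t ^+ 2 + z ^+ 2)^-1 \*: (z \*: (sin \o (fun s : R => z *: s)) -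
      t \*: (cos \o (fun s : R => z *: s))) - cst t^-1).
  apply/funext => u; rewrite /prim; rewrite -mulNr.
  by congr (_ * _); congr (_ - _); exact: mulrC.
apply: is_derive_eq.
rewrite !fctE /= /GRing.scale /= mulNr.
by field; rewrite tz gt_eqF.
Qed.

Let prim_cvg z : prim z s @[s --> +oo] --> (0 : R).
Proof.
have tz : 0 < t ^+ 2 + z ^+ 2 by rewrite ltr_pwDl ?exprn_gt0 ?sqr_ge0.
pose C := (`|z| + t) / (t ^+ 2 + z ^+ 2) + t^-1.
have E : expR (- (t * s)) @[s --> +oo] --> (0 : R).
  apply: (@cvg_comp _ _ _ (fun s => t * s) (fun u => expR (- u)) _ (pinfty_nbhs R)).
    exact: gt0_cvgMry.
  exact: cvgr_expR.
have ECy : C * expR (- (t * s)) @[s --> +oo] --> (0 : R).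
  by rewrite -(mulr0 C); apply: cvgM => //; exact: cvg_cst.
have EmC : - (C * expR (- (t * s))) @[s --> +oo] --> (0 : R).
  by rewrite -oppr0; exact: cvgN.
apply: (squeeze_cvgr _ EmC ECy); near=> s.
rewrite -ler_norml /prim normrM ger0_norm ?expR_ge0// mulrC ler_wpM2r ?expR_ge0//.
rewrite (le_trans (ler_normB _ _))// /C lerD//; last by rewrite ger0_norm// invr_ge0 ltW.
rewrite normrM (ger0_norm (x := _^-1)) ?invr_ge0 ?(ltW tz)// ler_wpM2r ?invr_ge0 ?(ltW tz)//.
rewrite (le_trans (ler_normB _ _))// lerD// normrM.
  by rewrite ler_piMr// sin_max.
by rewrite (gtr0_norm t0) ler_piMr ?cos_max// ltW.
Unshelve. all: by end_near. Qed.

Let integral_abel1Dcos z : (\int[leb]_s (abel s * (1 + cos (z * s)))%:E =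
  (2 * (t^-1 + t / (t ^+ 2 + z ^+ 2)))%:E)%E.
Proof.
have c1 : continuous (fun s => 1 + cos (z * s)).
  move=> s; apply: cvgD; first exact: cvg_cst.
  apply: (@continuous_comp _ _ _ (fun s => z * s) cos); last exact: continuous_cos.
  by apply: cvgM; [exact: cvg_cst|exact: cvg_id].
have p1 s : 0 <= 1 + cos (z * s) by have := cos_geN1 (z * s); lra.
rewrite (@ge0_symfun_integralT _ (fun s => abel s * (1 + cos (z * s)))); first last.
- by move=> s /=; rewrite /abel normrN mulrN cosN.
- by move=> s; apply: cvgM; [exact: continuous_abel|exact: c1].
- by move=> s; rewrite mulr_ge0// abel_ge0.
rewrite -set_itvcy.
have -> : (\int[leb]_(s in `[0%R, +oo[) (abel s * (1 + cos (z * s)))%:E =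
    \int[leb]_(s in `[0%R, +oo[) (expR (- (t * s)) * (1 + cos (z * s)))%:E)%E.
  by apply: eq_integral => s; rewrite inE/= in_itv/= andbT => s0; rewrite /abel ger0_norm.
rewrite (integral_ftc_y 0 (dprim z) _ _ (prim_cvg z)).
- rewrite -EFinM /prim !mulr0 oppr0 expR0 sin0 cos0; congr EFin.
  by field; rewrite !gt_eqF// ltr_pwDl ?exprn_gt0 ?sqr_ge0.
- move=> s; apply: cvgM; last exact: c1.
  apply: (@continuous_comp _ _ _ (fun s => - (t * s)) expR); last exact: continuous_expR.
  by apply: cvgN; apply: cvgM; [exact: cvg_cst|exact: cvg_id].
- by move=> s; rewrite mulr_ge0// expR_ge0.
Qed.

Let rint_abel1Dcos z : rint leb (fun s => abel s * (1 + cos (z * s))).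
Proof.
have p1 s : 0 <= 1 + cos (z * s) by have := cos_geN1 (z * s); lra.
apply/integrableP; split.
  apply/measurable_EFinP; apply: measurable_funM.
    by apply: continuous_measurable_fun; exact: continuous_abel.
  apply: measurable_funD => //; apply: measurableT_comp => //.
    by apply: continuous_measurable_fun; exact: continuous_cos.
under eq_integral do rewrite gee0_abs ?lee_fin ?mulr_ge0 ?abel_ge0//.
by rewrite integral_abel1Dcos ltry.
Qed.

Lemma rint_abel : rint leb abel.
Proof.
have := rintZ 2^-1 (rint_abel1Dcos 0); apply: eq_rint => s.
by rewrite mul0r cos0; field.
Qed.

Lemma rintegral_abel_cos z : rint leb (fun s => abel s * cos (z * s)) /\
  \int[leb]_s (abel s * cos (z * s)) = 2 * pi * poisson z.
Proof.
have r1 := rint_abel1Dcos z; have r0 := rint_abel.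
have E s : abel s * cos (z * s) = abel s * (1 + cos (z * s)) - abel s by ring.
split; first by apply: eq_rint (rintB r1 r0) => s; rewrite E.
under eq_Rintegral do rewrite E.
rewrite rintegralB// [X in X - _]/Rintegral integral_abel1Dcos/=.
have -> : \int[leb]_s abel s = 2^-1 * \int[leb]_s (abel s * (1 + cos (0 * s))).
  by rewrite -rintegralZ//; apply: eq_Rintegral => s _; rewrite mul0r cos0; field.
rewrite {1}/Rintegral integral_abel1Dcos/= /poisson expr0n /= addr0.
have : pi != 0 :> R by rewrite gt_eqF// pi_gt0.
move: (pi : R) => p p0.
by field; rewrite p0 !gt_eqF// ltr_pwDl ?exprn_gt0 ?sqr_ge0.
Qed.

Lemma rintegral_abel_sin z : rint leb (fun s => abel s * sin (z * s)) /\
  \int[leb]_s (abel s * sin (z * s)) = 0.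
Proof.
have r : rint leb (fun s => abel s * sin (z * s)).
  apply: (@rint_l2 _ _ _ leb (fun s => sin (z * s)) abel); first exact: rint_abel.
    apply: measurableT_comp; last exact: measurable_funM.
    by apply: continuous_measurable_fun; exact: continuous_sin.
  by exists 1 => s; exact: sin_max.
split => //; apply: rintegral_odd => // s.
by rewrite /abel normrN mulrN sinN mulrN.
Qed.

End poisson_line.

Section limit_theorems.
Context d (T : measurableType d) (R : realType) (mu : {measure set T -> \bar R}).

Lemma rint_monotone (g : nat -> T -> R) (G : T -> R) (B : R) :
  (forall n, rint mu (g n)) -> (forall n x, 0 <= g n x) ->
  (forall x, {homo g^~ x : m n / (m <= n)%N >-> m <= n}) ->
  (forall x, g n x @[n --> \oo] --> G x) ->
  (forall n, \int[mu]_x g n x <= B) ->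
  rint mu G /\ \int[mu]_x G x <= B.
Proof.
move=> rg g0 gnd gG gB.
have E : (\int[mu]_x (EFin (G x)) <= B%:E)%E.
  have H := @monotone_convergence _ T R mu setT measurableT
    (fun n x => (g n x)%:E) _ _ _.
  have -> : (fun x => (G x)%:E) = (fun x => limn (fun n => (g n x)%:E)).
    apply/funext => x; apply/esym/cvg_lim => //.
    by apply: cvg_EFin; [exact: nearW|exact: gG].
  rewrite H; first last.
  - by move=> x _ m n mn; rewrite lee_fin; exact: gnd.
  - by move=> n x _; rewrite lee_fin.
  - by move=> n; apply/measurable_EFinP; exact: rint_measurable (rg n).
  apply: lime_le.
    apply: ereal_nondecreasing_is_cvgn => m n mn.
    rewrite -!EFin_rintegral// lee_fin; apply: rintegral_le => //.
    by move=> x; exact: gnd.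
  by apply: nearW => n; rewrite -EFin_rintegral// lee_fin.
have G0 x : 0 <= G x.
  rewrite -(cvg_lim _ (gG x))//; apply: limr_ge; last exact: nearW.
  by apply/cvg_ex; exists (G x); exact: gG.
have mG : measurable_fun setT G.
  by apply: (measurable_fun_cvg (fun n => rint_measurable (rg n))) => x _; exact: gG.
have rG : rint mu G.
  apply/integrableP; split; first exact/measurable_EFinP.
  under eq_integral do rewrite gee0_abs ?lee_fin//.
  by rewrite (le_lt_trans E)// ltry.
by split=> //; rewrite -lee_fin EFin_rintegral.
Qed.

Lemma rint_dominated (g : nat -> T -> R) (G h : T -> R) :
  (forall n, measurable_fun setT (g n)) -> rint mu h ->
  (forall x, g n x @[n --> \oo] --> G x) ->
  (forall n x, `|g n x| <= h x) ->
  rint mu G /\ \int[mu]_x g n x @[n --> \oo] --> \int[mu]_x G x.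
Proof.
move=> mg rh gG gh.
have mG : measurable_fun setT G.
  by apply: (measurable_fun_cvg mg) => x _; exact: gG.
have rg n : rint mu (g n) by apply: rint_le rh.
have gGE x : (g n x)%:E @[n --> \oo] --> (G x)%:E.
  by apply: cvg_EFin; [exact: nearW|exact: gG].
have [rG _ cv] := @dominated_convergence _ T R mu setT measurableT
  (fun n => EFin \o g n) (EFin \o G) (EFin \o h)
  (fun n => (measurable_EFinP _ _).2 (mg n)) ((measurable_EFinP _ _).2 mG)
  (aeW _ (fun x _ => gGE x))
  rh (aeW _ (fun x n _ => gh n x)).
split => //; have := cv; rewrite -(EFin_rintegral rG) => /fine_cvg; exact.
Qed.

End limit_theorems.

Section products.
Context d1 d2 (X : measurableType d1) (Y : measurableType d2) (R : realType).
Variable m1 : {sigma_finite_measure set X -> \bar R}.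
Variable m2 : {sigma_finite_measure set Y -> \bar R}.

Lemma rint_prod (a : X -> R) (b : Y -> R) : rint m1 a -> rint m2 b ->
  rint (m1 \x m2)%E (fun x => a x.1 * b x.2) /\
  \int[(m1 \x m2)%E]_x (a x.1 * b x.2) = \int[m1]_x a x * \int[m2]_x b x.
Proof.
move=> ra rb.
have ma := rint_measurable ra; have mb := rint_measurable rb.
pose F (z : X * Y) : \bar R := (a z.1 * b z.2)%:E.
have mF : measurable_fun setT F.
  apply/measurable_EFinP; apply: measurable_funM => //; exact: measurableT_comp.
have iF : (m1 \x m2)%E.-integrable setT F.
  apply: (@integrable12ltyP _ _ _ _ _ m1 m2 _ mF).2.
  apply: (@le_lt_trans _ _
    (\int[m1]_x ((\int[m2]_y `|b y|) * `|a x|)%:E)%E); last first.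
    by rewrite -EFin_rintegral ?ltry//; exact/rintZ/rint_norm.
  apply: ge0_le_integral => //.
  - by move=> x _; exact: integral_ge0.
  - apply: (measurable_fun_fubini_tonelli_F (abse \o F)).
      exact: measurableT_comp.
    by move=> x; exact: abse_ge0.
  - apply/measurable_EFinP/measurable_funM => //; exact: measurableT_comp.
  - move=> x _.
    have -> : (\int[m2]_y `|F (x, y)| = (\int[m2]_y (`|a x| * `|b y|))%:E)%E.
      rewrite EFin_rintegral; last exact/rintZ/rint_norm.
      by apply: eq_integral => y _; rewrite /F/= normrM.
    by rewrite rintegralZ ?lee_fin 1?mulrC//; exact: rint_norm.
split => //.
rewrite {1}/Rintegral -(integral12_prod_meas1 iF) /fubini_F.
have -> : (\int[m1]_x \int[m2]_y F (x, y) =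
    \int[m1]_x ((\int[m2]_y b y) * a x)%:E)%E.
  apply: eq_integral => x _.
  by rewrite mulrC -rintegralZ// EFin_rintegral//; exact: rintZ.
by rewrite -[LHS]/(\int[m1]_x ((\int[m2]_y b y) * a x)) rintegralZ// mulrC.
Qed.

Lemma rint_markov_kernel (g : Y -> R) (k : X * Y -> R) : rint m2 g ->
  (forall y, 0 <= g y) -> measurable_fun setT k -> (forall z, 0 <= k z) ->
  (forall y, rint m1 (fun x => k (x, y)) /\ \int[m1]_x k (x, y) = 1) ->
  (forall x, rint m2 (fun y => g y * k (x, y))) ->
  rint m1 (fun x => \int[m2]_y (g y * k (x, y))) /\
  \int[m1]_x \int[m2]_y (g y * k (x, y)) = \int[m2]_y g y.
Proof.
move=> rg g0 mk k0 k1 rgk.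
have mg := rint_measurable rg.
pose F (z : X * Y) : \bar R := (g z.2 * k z)%:E.
have mF : measurable_fun setT F.
  by apply/measurable_EFinP; apply: measurable_funM => //; exact: measurableT_comp.
have F0 z : (0 <= F z)%E by rewrite lee_fin mulr_ge0.
have E : (\int[m1]_x (\int[m2]_y (g y * k (x, y)))%:E = (\int[m2]_y g y)%:E)%E.
  transitivity (\int[m1]_x \int[m2]_y F (x, y))%E.
    by apply: eq_integral => x _; rewrite EFin_rintegral.
  rewrite fubini_tonelli// EFin_rintegral//; apply: eq_integral => y _.
  have [ky1 ky2] := k1 y.
  transitivity ((\int[m1]_x (g y * k (x, y)))%:E).
    by rewrite EFin_rintegral//; exact: rintZ.
  by rewrite rintegralZ// ky2 mulr1.
have mI : measurable_fun setT (fun x => \int[m2]_y (g y * k (x, y))).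
  apply: measurableT_comp => //.
  exact: (measurable_fun_fubini_tonelli_F F).
split; last by rewrite {1}/Rintegral E.
apply/integrableP; split; first exact/measurable_EFinP.
apply: (@le_lt_trans _ _ (\int[m1]_x (\int[m2]_y (g y * k (x, y)))%:E)%E).
  rewrite le_eqVlt; apply/orP; left; apply/eqP; apply: eq_integral => x _.
  by rewrite gee0_abs// lee_fin; apply: rintegral_ge0 => y; rewrite mulr_ge0.
by rewrite E ltry.
Qed.

End products.

(** * The Fourier transform does not increase the L^2 norm *)

Section contraction.
Local Open Scope complex_scope.
Context {R : realType}.
Local Notation cfun := (R * R -> R[i]).
Local Notation T := (measurableTypeR R * measurableTypeR R)%type.
Local Notation leb := (@lebesgue_measure R).
Local Notation mu := (@leb2 R).
Local Notation c0 := ((2 * @pi R)^-1).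

Definition abel2 (t : R) (x : R * R) : R := abel t x.1 * abel t x.2.

Definition poisson2 (t : R) (x : R * R) : R := poisson t x.1 * poisson t x.2.

Lemma abel2_ge0 t x : 0 <= abel2 t x.
Proof. by rewrite mulr_ge0// abel_ge0. Qed.

Lemma rint_abel2 t : 0 < t -> rint mu (abel2 t).
Proof. by move=> t0; exact: (rint_prod (rint_abel t0) (rint_abel t0)).1. Qed.

Lemma poisson2_ge0 t x : 0 < t -> 0 <= poisson2 t x.
Proof. by move=> t0; rewrite mulr_ge0// poisson_ge0. Qed.

Lemma poisson2_le t x : 0 < t -> `|poisson2 t x| <= (pi * t)^-1 ^+ 2.
Proof.
move=> t0; rewrite ger0_norm ?poisson2_ge0// expr2.
by rewrite ler_pM ?poisson_ge0 ?poisson_le.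
Qed.

Lemma trigt_cos_abel2 t z : 0 < t ->
  trigt cos (abel2 t) z = (2 * pi) ^+ 2 * poisson2 t z.
Proof.
move=> t0; have [r1 e1] := rintegral_abel_cos t0 z.1.
have [r2 e2] := rintegral_abel_cos t0 z.2.
have [r3 e3] := rintegral_abel_sin t0 z.1.
have [r4 e4] := rintegral_abel_sin t0 z.2.
have [rc ec] := rint_prod r1 r2; have [rs es] := rint_prod r3 r4.
transitivity (\int[mu]_x (abel t x.1 * cos (z.1 * x.1) * (abel t x.2 * cos (z.2 * x.2)) -
   abel t x.1 * sin (z.1 * x.1) * (abel t x.2 * sin (z.2 * x.2)))).
  apply: eq_Rintegral => x _; rewrite /abel2 /dot cosD !(mulrC (z.1)) !(mulrC (z.2)); ring.
by rewrite rintegralB// ec es e1 e2 e3 mul0r subr0 /poisson2; ring.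
Qed.

Lemma trigt_sin_abel2 t z : 0 < t -> trigt sin (abel2 t) z = 0.
Proof.
move=> t0; have [r1 e1] := rintegral_abel_cos t0 z.1.
have [r2 e2] := rintegral_abel_cos t0 z.2.
have [r3 e3] := rintegral_abel_sin t0 z.1.
have [r4 e4] := rintegral_abel_sin t0 z.2.
have [rc ec] := rint_prod r1 r4; have [rs es] := rint_prod r3 r2.
transitivity (\int[mu]_x (abel t x.1 * sin (z.1 * x.1) * (abel t x.2 * cos (z.2 * x.2)) +
   abel t x.1 * cos (z.1 * x.1) * (abel t x.2 * sin (z.2 * x.2)))).
  apply: eq_Rintegral => x _; rewrite /abel2 /dot sinD !(mulrC (z.1)) !(mulrC (z.2)); ring.
by rewrite rintegralD// ec es e3 e4 mul0r mulr0 addr0.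
Qed.

Lemma measurable_poisson2B t : 0 < t ->
  measurable_fun setT (fun z : T * T => poisson2 t (z.1 - z.2)).
Proof.
move=> t0.
have mp : measurable_fun setT (poisson t).
  by apply: continuous_measurable_fun; exact: continuous_poisson.
apply: measurable_funM; apply: (measurableT_comp mp); apply: measurable_funB.
- by apply: (measurableT_comp measurable_fst); exact: measurable_fst.
- by apply: (measurableT_comp measurable_fst); exact: measurable_snd.
- by apply: (measurableT_comp measurable_snd); exact: measurable_fst.
- by apply: (measurableT_comp measurable_snd); exact: measurable_snd.
Qed.

Lemma poisson2C t x y : poisson2 t (x - y) = poisson2 t (y - x).
Proof. by rewrite /poisson2 /= -(opprB (y.1)) -(opprB (y.2)) !poissonN. Qed.

Lemma rintegral_poisson2B t x : 0 < t ->
  rint mu (fun y => poisson2 t (x - y)) /\ \int[mu]_y poisson2 t (x - y) = 1.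
Proof.
move=> t0; have [r1 e1] := rintegral_poissonB t0 x.1.
have [r2 e2] := rintegral_poissonB t0 x.2.
by have [r e] := rint_prod r1 r2; split; [exact: r|rewrite [LHS]e e1 e2 mulr1].
Qed.

Lemma rint_poisson2M t u x : 0 < t -> rint mu u ->
  rint mu (fun y => u y * poisson2 t (x - y)).
Proof.
move=> t0 ru; apply: (@rint_l2 _ _ _ mu (fun y => poisson2 t (x - y))) => //.
  exact: rint_measurable (rintegral_poisson2B x t0).1.
by exists ((pi * t)^-1 ^+ 2) => y; exact: poisson2_le.
Qed.

(** The quadratic form of convolution with the Poisson kernel, that is the energy of the transform
    weighted by [abel2 t], seen on the space side. *)
Definition abel_form t u := \int[mu]_x (u x * \int[mu]_y (u y * poisson2 t (x - y))).

Lemma measurable_conv_poisson2 t u : 0 < t -> rint mu u ->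
  measurable_fun setT (fun x : T => \int[mu]_y (u y * poisson2 t (x - y))).
Proof.
move=> t0 ru; rewrite (_ : (fun x => _) = fun x : T => \int[mu]_y (u y * poisson2 t (y - x))).
  have := @measurable_kernel_integral _ _ _ _ _ mu u
    (fun z : T * T => poisson2 t (z.1 - z.2)) ((pi * t)^-1 ^+ 2) ru
    (measurable_poisson2B t0).
  by apply => z; exact: poisson2_le.
by apply/funext => x; apply: eq_Rintegral => y _; rewrite poisson2C.
Qed.

Lemma conv_poisson2_bound t u x : 0 < t -> rint mu u ->
  `|\int[mu]_y (u y * poisson2 t (x - y))| <= (pi * t)^-1 ^+ 2 * \int[mu]_y `|u y|.
Proof.
move=> t0 ru.
apply: (le_trans (rintegral_norm (rint_poisson2M x t0 ru))).
rewrite -rintegralZ; last exact: rint_norm.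
apply: rintegral_le; [exact/rint_norm/rint_poisson2M|exact/rintZ/rint_norm|].
by move=> y; rewrite normrM mulrC ler_wpM2r// poisson2_le.
Qed.

Lemma rint_abel_form t u : 0 < t -> rint mu u ->
  rint mu (fun x => u x * \int[mu]_y (u y * poisson2 t (x - y))).
Proof.
move=> t0 ru; apply: (@rint_l2 _ _ _ mu (fun x => \int[mu]_y (u y * poisson2 t (x - y)))) => //.
  exact: measurable_conv_poisson2.
by eexists => x; exact: conv_poisson2_bound.
Qed.

(* Schur's test for the Markov kernel [poisson2], via [u x * u y <= (u x ^+ 2 + u y ^+ 2) / 2] *)
Lemma abel_form_le t u : 0 < t -> rint mu u -> rint mu (fun x => u x ^+ 2) ->
  abel_form t u <= \int[mu]_x (u x ^+ 2).
Proof.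
move=> t0 ru ru2.
pose h x := \int[mu]_y (u y ^+ 2 * poisson2 t (x - y)).
have [rh eh] : rint mu h /\ \int[mu]_x h x = \int[mu]_x (u x ^+ 2).
  apply: (@rint_markov_kernel _ _ _ _ _ mu mu (fun y => u y ^+ 2) (fun z => poisson2 t (z.1 - z.2))) => //.
  - by move=> y; exact: sqr_ge0.
  - exact: measurable_poisson2B.
  - by move=> z; exact: poisson2_ge0.
  - move=> y /=; have [r e] := rintegral_poisson2B y t0.
    by split; [apply: eq_rint r => x|rewrite -e; apply: eq_Rintegral => x _]; rewrite poisson2C.
  - by move=> x; exact: rint_poisson2M.
have -> : \int[mu]_x (u x ^+ 2) = \int[mu]_x (2^-1 * (u x ^+ 2 + h x)).
  rewrite rintegralZ; last exact: rintD.
  by rewrite rintegralD// eh; field.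
apply: rintegral_le; [exact: rint_abel_form|exact/rintZ/rintD|].
move=> x; rewrite -rintegralZ; last exact: rint_poisson2M.
have [rp ep] := rintegral_poisson2B x t0.
have -> : 2^-1 * (u x ^+ 2 + h x) =
    \int[mu]_y (2^-1 * (u x ^+ 2 * poisson2 t (x - y) + u y ^+ 2 * poisson2 t (x - y))).
  rewrite rintegralZ; last by apply: rintD; [exact: rintZ|exact: rint_poisson2M].
  rewrite rintegralD; [|exact: rintZ|exact: rint_poisson2M].
  by rewrite rintegralZ// ep mulr1.
apply: rintegral_le.
- exact/rintZ/rint_poisson2M.
- by apply/rintZ/rintD; [exact: rintZ|exact: rint_poisson2M].
- move=> y; rewrite -mulrDl mulrA [leRHS]mulrA ler_wpM2r ?poisson2_ge0//.
  have := sqr_ge0 (u x - u y); rewrite sqrrB mulr2n; lra.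
Qed.

(** At this stage [fourierL1 f] is only known to be bounded and measurable. The weight [abel2 t]
    makes it integrable, so that the adjoint relation applies, and the explicit transform of the
    weight turns the energy into two Poisson forms. *)
Lemma ip_abel2 t (f : cfun) : 0 < t -> cLfun 1%:E f ->
  rint mu (fun xi => abel2 t xi * (complex.Re (fourierL1 f xi) ^+ 2 +
    complex.Im (fourierL1 f xi) ^+ 2)) /\
  \int[mu]_xi (abel2 t xi * (complex.Re (fourierL1 f xi) ^+ 2 +
    complex.Im (fourierL1 f xi) ^+ 2)) =
  abel_form t (fun x => complex.Re (f x)) + abel_form t (fun x => complex.Im (f x)).
Proof.
move=> t0 lf; have /cL1P[f1 f2] := lf.
have ra := rint_abel2 t0.
have [m1 m2] := measurable_fourierL1 lf.
pose B := c0 * \int[mu]_x (`|complex.Re (f x)| + `|complex.Im (f x)|).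
have lw : cLfun 1%:E (fun xi => (abel2 t xi)%:C * fourierL1 f xi).
  apply/cL1P; split.
  - have hB : exists M, forall xi, `|complex.Re (fourierL1 f xi)| <= M.
      by exists B => xi; exact: (fourierL1_bound xi lf).1.
    by apply: eq_rint (@rint_l2 _ _ _ mu _ _ ra m1 hB) => x; rewrite (ReZ (abel2 t x)).
  - have hB : exists M, forall xi, `|complex.Im (fourierL1 f xi)| <= M.
      by exists B => xi; exact: (fourierL1_bound xi lf).2.
    by apply: eq_rint (@rint_l2 _ _ _ mu _ _ ra m2 hB) => x; rewrite (ImZ (abel2 t x)).
split.
  apply: (@rint_l2 _ _ _ mu (fun xi => complex.Re (fourierL1 f xi) ^+ 2 + complex.Im (fourierL1 f xi) ^+ 2)) => //.
    by apply: measurable_funD; exact: measurable_funX.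
  exists (B ^+ 2 + B ^+ 2) => xi; rewrite ger0_norm ?addr_ge0 ?sqr_ge0//.
  have [b1 b2] := fourierL1_bound xi lf.
  by rewrite lerD// -real_normK ?num_real// lerXn2r// nnegrE (le_trans _ b1).
transitivity (ip (fourierL1 f) (fun xi => (abel2 t xi)%:C * fourierL1 f xi)).
  by apply: eq_Rintegral => xi _; rewrite !ReImE; ring.
rewrite fourierL1_adjP// /abel_form -rintegralD; [|exact: rint_abel_form|exact: rint_abel_form].
apply: eq_Rintegral => x _; rewrite fourierL1_adjM//=.
have pi0 : (2 * pi) != 0 :> R by rewrite mulf_neq0// gt_eqF// pi_gt0.
have E u : rint mu u -> \int[mu]_y (u y * trigt cos (abel2 t) (x - y)) =
    (2 * pi) ^+ 2 * \int[mu]_y (u y * poisson2 t (x - y)).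
  move=> ru; rewrite -rintegralZ; last exact: rint_poisson2M.
  by apply: eq_Rintegral => y _; rewrite trigt_cos_abel2//; ring.
have E' u : \int[mu]_y (u y * trigt sin (abel2 t) (x - y)) = 0.
  under eq_Rintegral do rewrite trigt_sin_abel2// mulr0.
  by rewrite Rintegral_cst// mul0r.
rewrite rintegralB ?rintegralD; [|exact: rint_conv_cos|exact: rint_conv_sin
  |exact: rint_conv_cos|exact: rint_conv_sin].
rewrite !E// !E' subr0 addr0 exprVn !(mulrA _ (_ ^+ 2)) mulVf ?expf_neq0//.
by rewrite !mul1r.
Qed.

(** The weighted energies are bounded by |f|^2 through Schur's test, and they increase to the full
    energy as the Abel parameter 1 / (n + 1) decreases to 0. Besides the inequality this yields that
    the transform is in L^2 at all. The reverse inequality is proved on boxes only and then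
    propagated. *)
Lemma fourierL1_contraction (f : cfun) : cLfun 1%:E f -> cLfun 2%:E f ->
  cLfun 2%:E (fourierL1 f) /\ ip (fourierL1 f) (fourierL1 f) <= ip f f.
Proof.
move=> lf [/l2P[_ f1] /l2P[_ f2]]; have /cL1P[rf1 rf2] := lf.
have [m1 m2] := measurable_fourierL1 lf.
pose G xi := complex.Re (fourierL1 f xi) ^+ 2 + complex.Im (fourierL1 f xi) ^+ 2.
have G0 xi : 0 <= G xi by rewrite addr_ge0// sqr_ge0.
have [rG GI] : rint mu G /\ \int[mu]_xi G xi <= ip f f.
  pose t (n : nat) : R := n.+1%:R^-1.
  have t0 n : 0 < t n by rewrite invr_gt0 ltr0n.
  apply: (@rint_monotone _ _ _ mu (fun n xi => abel2 (t n) xi * G xi)).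
  - by move=> n; exact: (ip_abel2 (t0 n) lf).1.
  - by move=> n xi; rewrite mulr_ge0// abel2_ge0.
  - move=> xi m n mn; rewrite ler_wpM2r// /abel2 ler_pM ?abel_ge0//.
    + by rewrite ler_expR lerN2 ler_wpM2r// lef_pV2 ?posrE ?ltr0n// ler_nat.
    + by rewrite ler_expR lerN2 ler_wpM2r// lef_pV2 ?posrE ?ltr0n// ler_nat.
  - move=> xi; rewrite -[X in _ --> X]mul1r; apply: cvgM; last exact: cvg_cst.
    have ct : t n @[n --> \oo] --> (0 : R) by exact: cvg_harmonic.
    have ca (s : R) : abel (t n) s @[n --> \oo] --> (1 : R).
      rewrite -expR0; apply: continuous_cvg; first exact: continuous_expR.
      rewrite -oppr0 -(mul0r `|s|); apply: cvgN; apply: cvgM => //.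
      exact: cvg_cst.
    by rewrite -[X in _ --> X]mulr1; apply: cvgM.
  - move=> n; rewrite (ip_abel2 (t0 n) lf).2 /ip rintegralD.
    + by rewrite lerD// (le_trans (abel_form_le (t0 n) _ _)).
    + by apply: eq_rint f1 => x; rewrite expr2.
    + by apply: eq_rint f2 => x; rewrite expr2.
split.
  split; apply/l2P; split => //.
  - apply: (@rint_le _ _ _ mu _ G) => //; first exact: measurable_funX.
    by move=> xi; rewrite ger0_norm ?sqr_ge0// lerDl sqr_ge0.
  - apply: (@rint_le _ _ _ mu _ G) => //; first exact: measurable_funX.
    by move=> xi; rewrite ger0_norm ?sqr_ge0// lerDr sqr_ge0.
apply: le_trans GI; rewrite le_eqVlt; apply/orP; left; apply/eqP.
by apply: eq_Rintegral => xi _; rewrite -!expr2.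
Qed.

End contraction.

(** * Plancherel's theorem *)

Section plancherel_class.
Local Open Scope complex_scope.
Context {R : realType}.
Local Notation cfun := (R * R -> R[i]).
Local Notation T := (measurableTypeR R * measurableTypeR R)%type.
Local Notation leb := (@lebesgue_measure R).
Local Notation mu := (@leb2 R).
Implicit Types (f g : cfun) (u : R * R -> R).

Lemma fourierL1D f g xi : cLfun 1%:E f -> cLfun 1%:E g ->
  fourierL1 (fun x => f x + g x) xi = fourierL1 f xi + fourierL1 g xi.
Proof.
move=> lf lg; have /cL1P[f1 f2] := lf; have /cL1P[g1 g2] := lg.
have [tc ts] := (@trig_cos R, @trig_sin R).
have E1 tr : trig tr -> trigt tr (fun x => complex.Re (f x + g x)) xi =
    trigt tr (fun x => complex.Re (f x)) xi + trigt tr (fun x => complex.Re (g x)) xi.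
  by move=> ttr; rewrite -trigtD//; apply: eq_Rintegral => x _; rewrite ReD.
have E2 tr : trig tr -> trigt tr (fun x => complex.Im (f x + g x)) xi =
    trigt tr (fun x => complex.Im (f x)) xi + trigt tr (fun x => complex.Im (g x)) xi.
  by move=> ttr; rewrite -trigtD//; apply: eq_Rintegral => x _; rewrite ImD.
apply: complex_ext.
- rewrite ReD !Re_fourierL1 ?E1 ?E2//; [ring|exact: cL1D].
- rewrite ImD !Im_fourierL1 ?E1 ?E2//; [ring|exact: cL1D].
Qed.

Lemma fourierL1Z (a : R) f xi : cLfun 1%:E f ->
  fourierL1 (fun x => a%:C * f x) xi = a%:C * fourierL1 f xi.
Proof.
move=> lf; have /cL1P[f1 f2] := lf.
have E1 tr : trig tr -> trigt tr (fun x => complex.Re (a%:C * f x)) xi =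
    a * trigt tr (fun x => complex.Re (f x)) xi.
  by move=> ttr; rewrite -trigtZ//; apply: eq_Rintegral => x _; rewrite ReZ.
have E2 tr : trig tr -> trigt tr (fun x => complex.Im (a%:C * f x)) xi =
    a * trigt tr (fun x => complex.Im (f x)) xi.
  by move=> ttr; rewrite -trigtZ//; apply: eq_Rintegral => x _; rewrite ImZ.
have [tc ts] := (@trig_cos R, @trig_sin R).
apply: complex_ext.
- rewrite (ReZ a) !Re_fourierL1 ?E1 ?E2//; [ring|exact: cL1Z].
- rewrite (ImZ a) !Im_fourierL1 ?E1 ?E2//; [ring|exact: cL1Z].
Qed.

Lemma fourierL1B f g xi : cLfun 1%:E f -> cLfun 1%:E g ->
  fourierL1 (fun x => f x - g x) xi = fourierL1 f xi - fourierL1 g xi.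
Proof.
move=> lf lg.
have -> : (fun x => f x - g x) = (fun x => f x + (-1)%:C * g x).
  by apply/funext => x; rewrite rmorphN rmorph1 mulN1r.
rewrite fourierL1D//; last exact: cL1Z.
by rewrite fourierL1Z// rmorphN rmorph1 mulN1r.
Qed.

Lemma complexiM (z : R[i]) :
  complex.Re ((0 +i* 1) * z) = - complex.Im z /\ complex.Im ((0 +i* 1) * z) = complex.Re z.
Proof. by case: z => a b /=; split; ring. Qed.

Lemma fourierL1i f xi : cLfun 1%:E f ->
  fourierL1 (fun x => (0 +i* 1) * f x) xi = (0 +i* 1) * fourierL1 f xi.
Proof.
move=> lf; have /cL1P[f1 f2] := lf.
have lfi : cLfun 1%:E (fun x => (0 +i* 1) * f x).
  apply/cL1P; split.
    by apply: eq_rint (rintN f2) => x; rewrite (complexiM _).1.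
  by apply: eq_rint f1 => x; rewrite (complexiM _).2.
have [tc ts] := (@trig_cos R, @trig_sin R).
have E1 tr : trig tr -> trigt tr (fun x => complex.Re ((0 +i* 1) * f x)) xi =
    - trigt tr (fun x => complex.Im (f x)) xi.
  move=> ttr; rewrite -mulN1r -trigtZ//; apply: eq_Rintegral => x _.
  by rewrite (complexiM _).1 mulN1r.
have E2 tr : trig tr -> trigt tr (fun x => complex.Im ((0 +i* 1) * f x)) xi =
    trigt tr (fun x => complex.Re (f x)) xi.
  by move=> ttr; apply: eq_Rintegral => x _; rewrite (complexiM _).2.
apply: complex_ext.
- by rewrite (complexiM _).1 Re_fourierL1// Im_fourierL1// E1// E2//; ring.
- by rewrite (complexiM _).2 Im_fourierL1// Re_fourierL1// E1// E2//; ring.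
Qed.

Let sub_parallelogram (x y z w x' y' z' w' : R) : x + y = 2 * z + 2 * w ->
  x' + y' = 2 * z' + 2 * w' -> x - x' + (y - y') = 2 * (z - z') + 2 * (w - w').
Proof. by move=> *; lra. Qed.

Let sum_defects0 (x y x' y' : R) : x - y + (x' - y') = 0 ->
  0 <= x - y -> 0 <= x' - y' -> y = x /\ y' = x'.
Proof. by move=> *; split; lra. Qed.

Let defect_half (x y z e : R) : x + y = 2 * z -> 0 <= y -> z <= e / 2 -> x <= e.
Proof. by move=> *; lra. Qed.

(** Equality in the contraction. The defect |f|^2 - |F f|^2 is a nonnegative quadratic form, so its
    zeros form a vector space that is closed for the L^2 norm; this is how equality spreads from
    boxes to every function in L^1 and L^2. *)
Definition planch f := [/\ cLfun 1%:E f, cLfun 2%:E f &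
  ip (fourierL1 f) (fourierL1 f) = ip f f].

Lemma fourierL1_parallelogram f g : cLfun 1%:E f -> cLfun 2%:E f ->
  cLfun 1%:E g -> cLfun 2%:E g ->
  let q h := ip h h - ip (fourierL1 h) (fourierL1 h) in
  q (fun x => f x + g x) + q (fun x => f x - g x) = 2 * q f + 2 * q g.
Proof.
move=> f1 f2 g1 g2 q; rewrite /q.
have [F2 _] := fourierL1_contraction f1 f2; have [G2 _] := fourierL1_contraction g1 g2.
have -> : fourierL1 (fun x => f x + g x) = (fun xi => fourierL1 f xi + fourierL1 g xi).
  by apply/funext => xi; rewrite fourierL1D.
have -> : fourierL1 (fun x => f x - g x) = (fun xi => fourierL1 f xi - fourierL1 g xi).
  by apply/funext => xi; rewrite fourierL1B.
have E (a b : cfun) : cLfun 2%:E a -> cLfun 2%:E b ->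
    ip (fun x => a x + b x) (fun x => a x + b x) +
    ip (fun x => a x - b x) (fun x => a x - b x) = 2 * ip a a + 2 * ip b b.
  move=> la lb; have [lD lB] := (cL2D la lb, cL2B la lb).
  rewrite (ipDl la lb lD) (ipBl la lb lB).
  by rewrite (ipDr la lb la) (ipDr la lb lb) (ipBr la lb la) (ipBr la lb lb); ring.
exact: sub_parallelogram (E _ _ f2 g2) (E _ _ F2 G2).
Qed.

Lemma planch_defect_ge0 f : cLfun 1%:E f -> cLfun 2%:E f ->
  0 <= ip f f - ip (fourierL1 f) (fourierL1 f).
Proof. by move=> f1 f2; rewrite subr_ge0; exact: (fourierL1_contraction f1 f2).2. Qed.

Lemma planchDB f g : planch f -> planch g ->
  planch (fun x => f x + g x) /\ planch (fun x => f x - g x).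
Proof.
move=> [f1 f2 ef] [g1 g2 eg].
have := fourierL1_parallelogram f1 f2 g1 g2; rewrite /= ef eg !subrr mulr0 addr0 => E.
have [l1 l2] : cLfun 1%:E (fun x => f x + g x) /\ cLfun 2%:E (fun x => f x + g x).
  by split; [exact: cL1D|exact: cL2D].
have [k1 k2] : cLfun 1%:E (fun x => f x - g x) /\ cLfun 2%:E (fun x => f x - g x).
  by split; [exact: cL1B|exact: cL2B].
have [e1 e2] := sum_defects0 E (planch_defect_ge0 l1 l2) (planch_defect_ge0 k1 k2).
by split; split; [exact: l1|exact: l2|exact: e1|exact: k1|exact: k2|exact: e2].
Qed.

Lemma planchZ (a : R) f : planch f -> planch (fun x => a%:C * f x).
Proof.
move=> [f1 f2 ef]; split; [exact: cL1Z|exact: cL2Z|].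
have [F2 _] := fourierL1_contraction f1 f2.
have -> : fourierL1 (fun x => a%:C * f x) = (fun xi => a%:C * fourierL1 f xi).
  by apply/funext => xi; rewrite fourierL1Z.
rewrite (ipZl a F2 (cL2Z a F2)) (ipZr a F2 F2) ef.
by rewrite (ipZl a f2 (cL2Z a f2)) (ipZr a f2 f2).
Qed.

Lemma planchi f : planch f -> planch (fun x => (0 +i* 1) * f x).
Proof.
move=> [f1 f2 ef]; have /cL1P[r1 r2] := f1.
have E (h : cfun) : ip (fun x => (0 +i* 1) * h x) (fun x => (0 +i* 1) * h x) = ip h h.
  by apply: eq_Rintegral => x _; rewrite !(complexiM _).1 !(complexiM _).2; ring.
split.
- apply/cL1P; split.
    by apply: eq_rint (rintN r2) => x; rewrite (complexiM _).1.
  by apply: eq_rint r1 => x; rewrite (complexiM _).2.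
- case: f2 => f21 f22; split.
    rewrite (_ : (fun x => _) = (fun x => -1 * complex.Im (f x))); first exact: l2Z.
    by apply/funext => x; rewrite (complexiM _).1 mulN1r.
  rewrite (_ : (fun x => _) = (fun x => complex.Re (f x)))//.
  by apply/funext => x; rewrite (complexiM _).2.
- have -> : fourierL1 (fun x => (0 +i* 1) * f x) = (fun xi => (0 +i* 1) * fourierL1 f xi).
    by apply/funext => xi; rewrite fourierL1i.
  by rewrite !E.
Qed.

Lemma planch0 : planch (fun=> 0).
Proof.
split; [exact: cL1_0|exact: cL2_0|].
have [_] := fourierL1_contraction (@cL1_0 R) (@cL2_0 R).
rewrite (ae_ip0 cL2_0); last by apply: aeW.
by move=> h; apply/eqP; rewrite eq_le h ip_ge0.
Qed.

Lemma planch_sum (I : Type) (s : seq I) (F : I -> cfun) :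
  (forall i, planch (F i)) -> planch (fun x => \sum_(i <- s) F i x).
Proof.
move=> pF; elim: s => [|i s IH].
  by under eq_fun do rewrite big_nil; exact: planch0.
under eq_fun do rewrite big_cons.
exact: (planchDB (pF i) IH).1.
Qed.

(** For g of defect 0 the parallelogram law applied to f - g and g gives q(f) <= 2 q(f - g) <= 2 |f
    - g|^2, where q is the defect. *)
Lemma planch_closed f : cLfun 1%:E f -> cLfun 2%:E f ->
  (forall e : R, 0 < e -> exists2 g, planch g &
     ip (fun x => f x - g x) (fun x => f x - g x) <= e) -> planch f.
Proof.
move=> f1 f2 fg; split => //.
pose q (h : cfun) := ip h h - ip (fourierL1 h) (fourierL1 h).
have q0 : 0 <= q f := planch_defect_ge0 f1 f2.
suff : q f <= 0.
  move=> q1; apply/esym/eqP; rewrite -subr_eq0 eq_le; apply/andP; split; first exact: q1.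
  exact: q0.
apply/ler_addgt0Pl => e e0; rewrite addr0.
have [|g [g1 g2 eg] ge] := fg (e / 2); first exact: divr_gt0.
have [d1 d2] : cLfun 1%:E (fun x => f x - g x) /\ cLfun 2%:E (fun x => f x - g x).
  by split; [exact: cL1B|exact: cL2B].
have := fourierL1_parallelogram d1 d2 g1 g2.
rewrite /= eg subrr mulr0 addr0.
have -> : (fun x => f x - g x + g x) = f by apply/funext => x; rewrite subrK.
move=> /defect_half; apply.
  by apply: planch_defect_ge0; [exact: cL1B|exact: cL2B].
by rewrite lerBlDr (le_trans ge)// lerDl ip_ge0.
Qed.

Definition realfun (u : R * R -> R) : cfun := fun x => (u x)%:C.

Lemma realfun_cL1 u : rint mu u -> cLfun 1%:E (realfun u).
Proof. by move=> ru; apply/cL1P; split => //=; exact: rint0. Qed.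

Lemma realfun_cL2 u : measurable_fun setT (u : T -> R) -> rint mu (fun x => u x ^+ 2) ->
  cLfun 2%:E (realfun u).
Proof.
move=> mu' ru; split; apply/l2P; split => //=.
by apply: eq_rint (rint0 mu) => x; rewrite expr0n.
Qed.

Lemma ip_realfun u v : ip (realfun u) (realfun v) = \int[mu]_x (u x * v x).
Proof. by apply: eq_Rintegral => x _ /=; rewrite mulr0 addr0. Qed.

Lemma planch_realfun_limit u (v : nat -> R * R -> R) (h : R * R -> R) :
  rint mu u -> rint mu (fun x => u x ^+ 2) ->
  (forall n, planch (realfun (v n))) ->
  (forall x, v n x @[n --> \oo] --> u x) ->
  rint mu h -> (forall n x, (u x - v n x) ^+ 2 <= h x) ->
  planch (realfun u).
Proof.
move=> ru ru2 pv vu rh vh.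
have mru := rint_measurable ru.
have mv n : measurable_fun setT (v n : T -> R).
  by have [/cL1P[/rint_measurable r _] _ _] := pv n.
apply: planch_closed; [exact: realfun_cL1|exact: realfun_cL2|].
have h1 x : (u x - v n x) ^+ 2 @[n --> \oo] --> (0 : R).
  have -> : (0 : R) = (u x - u x) * (u x - u x) by rewrite subrr mulr0.
  by apply: cvgM; apply: cvgB => //; exact: cvg_cst.
have h2 n x : `|(u x - v n x) ^+ 2| <= h x by rewrite ger0_norm ?sqr_ge0.
have [_] := @rint_dominated _ T R mu (fun n x => (u x - v n x) ^+ 2) (fun=> 0) h
  (fun n => measurable_funX 2 (measurable_funB mru (mv n))) rh h1 h2.
rewrite Rintegral_cst// mul0r => /cvgrPdist_le cv e /cv[N _ /(_ N (leqnn N))].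
rewrite sub0r normrN => H; exists (realfun (v N)) => //.
apply: le_trans (le_trans (ler_norm _) H).
rewrite le_eqVlt; apply/orP; left; apply/eqP; apply: eq_Rintegral => x _ /=.
by rewrite subrr mulr0 addr0 expr2.
Qed.

End plancherel_class.

Section plancherel.
Local Open Scope complex_scope.
Context {R : realType}.
Local Notation cfun := (R * R -> R[i]).
Local Notation T := (measurableTypeR R * measurableTypeR R)%type.
Local Notation leb := (@lebesgue_measure R).
Local Notation mu := (@leb2 R).

Lemma indic_sqr (X : Type) (A : set X) (x : X) : (\1_A x : R) ^+ 2 = \1_A x.
Proof. by rewrite indicE; case: (_ \in _); rewrite ?expr1n ?expr0n. Qed.

Lemma indic_le1 (X : Type) (A : set X) (x : X) : `|\1_A x : R| <= 1.
Proof. by rewrite indicE; case: (_ \in _); rewrite ?normr1 ?normr0. Qed.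

Lemma rint_itv (a b : R) (s1 s2 : bool) :
  rint leb (\1_[set` Interval (BSide s1 a) (BSide s2 b)] : R -> R).
Proof.
apply: rint_indic; first exact: measurable_itv.
by rewrite /= lebesgue_measure_itv/=; case: ifP => _; rewrite ?ltry// -EFinB ltry.
Qed.

Lemma rintegral_itv (a b : R) (s1 s2 : bool) : a <= b ->
  \int[leb]_x (\1_[set` Interval (BSide s1 a) (BSide s2 b)] x : R) = b - a.
Proof.
move=> ab; rewrite rintegral_indic; last exact: measurable_itv.
rewrite /= lebesgue_measure_itv/= lte_fin; case: ltgtP ab => // -> _.
by rewrite subrr.
Qed.

Lemma rintegral_poisson_center (t s : R) : 0 < t -> 0 < s ->
  rint leb (fun y => \1_`[(- s), s] y * poisson t y) /\
  \int[leb]_y (\1_`[(- s), s] y * poisson t y) = 2 * (pi^-1 * atan (s / t)).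
Proof.
move=> t0 s0; have rp := rint_poisson t0; split.
  by apply: (rintM_bounded _ _ rp (M := 1)) => [|x]; [|exact: indic_le1].
transitivity (\int[leb]_(y in `[(- s), s]) poisson t y).
  rewrite [RHS]Rintegral_mkcond; apply: eq_Rintegral => y _.
  by rewrite /patch indicE; case: ifP => _; rewrite ?mul1r ?mul0r.
rewrite /Rintegral (integral_ftc (@is_derive_atan_scaled R t) (@continuous_poisson R t)) ?gtrN//=.
by rewrite mulNr atanN; ring.
Qed.

Lemma conv_poisson_lower (t s a b x : R) : 0 < t -> 0 < s ->
  a + s < x -> x <= b - s ->
  rint leb (fun y => \1_`]a, b] y * poisson t (x - y)) /\
  2 * (pi^-1 * atan (s / t)) <= \int[leb]_y (\1_`]a, b] y * poisson t (x - y)).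
Proof.
move=> t0 s0 ax xb.
have [rp _] := rintegral_poissonB t0 x.
have [rc ec] := rintegral_poisson_center t0 s0.
have [ro eo] := rintegral_opp rc.
have [rs es] := rintegral_shift (- x) ro.
have r1 : rint leb (fun y => \1_`]a, b] y * poisson t (x - y)).
  by apply: (rintM_bounded _ _ rp (M := 1)) => [|y]; [|exact: indic_le1].
split => //; rewrite -ec -eo -es; apply: rintegral_le => // y.
rewrite opprB ler_wpM2r ?poisson_ge0// !indicE.
case: (boolP (x - y \in _)) => //; rewrite inE/= in_itv/= => /andP[h1 h2].
rewrite mem_set//= in_itv/=; apply/andP; split; lra.
Qed.

Definition box (a b c d : R) : set (R * R) := `]a, b]%classic `*` `]c, d]%classic.

Lemma indic_box a b c d (x : R * R) :
  \1_(box a b c d) x = \1_`]a, b]%classic x.1 * \1_`]c, d]%classic x.2 :> R.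
Proof. by rewrite /box indicE in_setX !indicE -natrM mulnb. Qed.

Lemma measurable_box a b c d : measurable (box a b c d : set T).
Proof. by apply: measurableX; exact: measurable_itv. Qed.

Lemma rint_box a b c d : rint mu (\1_(box a b c d) : T -> R).
Proof.
have [r _] := rint_prod (rint_itv a b false false) (rint_itv c d false false).
by apply: eq_rint r => x; rewrite indic_box.
Qed.

(** At points at depth s inside the box, each factor of the smoothed indicator is at least the
    Poisson mass of [-s, s], which is 2 / pi atan (s / t). The bound integrates its square over the
    box shrunk by s on every side. *)
Lemma abel_form_box_lower a b c d (t s : R) : 0 < t -> 0 < s ->
  s *+ 2 < b - a -> s *+ 2 < d - c ->
  (2 * (pi^-1 * atan (s / t))) ^+ 2 * ((b - a - s *+ 2) * (d - c - s *+ 2)) <=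
  abel_form t (\1_(box a b c d)).
Proof.
move=> t0 s0 sab scd.
set k := 2 * _.
have k0 : 0 <= k.
  rewrite mulr_ge0// mulr_ge0 ?invr_ge0 ?pi_ge0// -(atan0 R) le_atan//.
  by rewrite divr_ge0// ltW.
pose v x : R := \1_`]a + s, b - s]%classic x.1 * \1_`]c + s, d - s]%classic x.2.
have [rv ev] := rint_prod (rint_itv (a + s) (b - s) false false) (rint_itv (c + s) (d - s) false false).
have -> : k ^+ 2 * ((b - a - s *+ 2) * (d - c - s *+ 2)) = \int[mu]_x (k ^+ 2 * v x).
  rewrite rintegralZ//; congr (_ * _); rewrite [RHS]ev !rintegral_itv; [ring|lra|lra].
have rb := rint_box a b c d.
apply: rintegral_le; [exact: rintZ|exact: rint_abel_form|].
move=> x.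
have B0 : 0 <= \int[mu]_y (\1_(box a b c d) y * poisson2 t (x - y)).
  by apply: rintegral_ge0 => y; rewrite mulr_ge0// poisson2_ge0.
have b0 : 0 <= \1_(box a b c d) x :> R by rewrite indicE.
have [x1|/negbTE x1] := boolP (x.1 \in `]a + s, b - s]%classic); last first.
  by rewrite (_ : v x = 0) ?mulr0 ?mulr_ge0// /v indicE x1 mul0r.
have [x2|/negbTE x2] := boolP (x.2 \in `]c + s, d - s]%classic); last first.
  by rewrite (_ : v x = 0) ?mulr0 ?mulr_ge0// /v mulrC indicE x2 mul0r.
have -> : v x = 1 by rewrite /v !indicE x1 x2 mulr1.
move: x1 x2; rewrite !inE/= !in_itv/= => /andP[ax xb] /andP[cx xd].
have -> : \1_(box a b c d) x = 1 :> R.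
  by rewrite indic_box !indicE !mem_set ?mulr1//= in_itv/=; apply/andP; split; lra.
rewrite mulr1 mul1r.
have [r1 e1] := conv_poisson_lower t0 s0 ax xb.
have [r2 e2] := conv_poisson_lower t0 s0 cx xd.
have [_ e] := rint_prod r1 r2.
apply: (@le_trans _ _ (\int[leb]_y (\1_`]a, b] y * poisson t (x.1 - y)) *
   \int[leb]_y (\1_`]c, d] y * poisson t (x.2 - y)))).
  by rewrite expr2 ler_pM.
rewrite -e le_eqVlt; apply/orP; left; apply/eqP; apply: eq_Rintegral => y _.
by rewrite indic_box /poisson2 /=; ring.
Qed.

Lemma planch_box a b c d : planch (realfun (\1_(box a b c d))).
Proof.
have rb := rint_box a b c d.
have rb2 : rint mu (fun x => (\1_(box a b c d) x : R) ^+ 2).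
  by apply: eq_rint rb => x; rewrite indic_sqr.
have l1 := realfun_cL1 rb; have l2 := realfun_cL2 (rint_measurable rb) rb2.
have [F2 Fle] := fourierL1_contraction l1 l2.
have eb : ip (realfun (\1_(box a b c d))) (realfun (\1_(box a b c d))) =
    \int[leb]_x (\1_`]a, b] x : R) * \int[leb]_x (\1_`]c, d] x : R).
  rewrite ip_realfun -(rint_prod (rint_itv a b false false) (rint_itv c d false false)).2.
  by apply: eq_Rintegral => x _; rewrite -expr2 indic_sqr indic_box.
have [ba|ab] := leP b a.
  split => //; apply/eqP; rewrite eq_le Fle eb.
  rewrite [X in X * _](_ : _ = 0) ?mul0r ?ip_ge0//.
  under eq_Rintegral do rewrite set_itv_ge ?indic0 ?bnd_simp -?leNgt//.
  by rewrite Rintegral_cst// mul0r.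
have [dc|cd] := leP d c.
  split => //; apply/eqP; rewrite eq_le Fle eb.
  rewrite [X in _ * X](_ : _ = 0) ?mulr0 ?ip_ge0//.
  under eq_Rintegral do rewrite set_itv_ge ?indic0 ?bnd_simp -?leNgt//.
  by rewrite Rintegral_cst// mul0r.
split => //; apply/eqP; rewrite eq_le Fle eb !rintegral_itv; [|exact: ltW|exact: ltW].
have lower (t : R) : 0 < t -> abel_form t (\1_(box a b c d)) <=
    ip (fourierL1 (realfun (\1_(box a b c d)))) (fourierL1 (realfun (\1_(box a b c d)))).
  move=> t0; have [ra ea] := ip_abel2 t0 l1.
  have -> : abel_form t (\1_(box a b c d)) =
      abel_form t (fun x => complex.Re (realfun (\1_(box a b c d)) x)) +
      abel_form t (fun x => complex.Im (realfun (\1_(box a b c d)) x)).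
    rewrite -[LHS]addr0; congr (_ + _); apply/esym.
    rewrite /abel_form; under eq_Rintegral do rewrite /= mul0r.
    by rewrite Rintegral_cst// mul0r.
  rewrite -ea; apply: rintegral_le => //; first exact: rint_ip.
  move=> xi; rewrite -!expr2 ler_piMl// ?addr_ge0 ?sqr_ge0//.
  by rewrite /abel2 mulr_ile1 ?abel_ge0 ?abel_le1.
(* With margin s and Poisson scale t = s^2 the ratio s / t = n + 1 tends to infinity: the mass kept
   within the margin tends to 1 while the margin itself vanishes. *)
pose s (n : nat) : R := n.+1%:R^-1.
have s0 n : 0 < s n by rewrite invr_gt0 ltr0n.
have cs : s n @[n --> \oo] --> (0 : R) by exact: cvg_harmonic.
have catan : 2 * (pi^-1 * atan (s n / (s n ^+ 2))) @[n --> \oo] --> (1 : R).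
  have pe : 2 * (pi^-1 * (pi / 2)) = 1 :> R.
    by rewrite (mulrA _ pi) mulVf ?mul1r ?divff// gt_eqF// pi_gt0.
  rewrite -[X in _ --> X]pe.
  apply: cvgM; first exact: cvg_cst.
  apply: cvgM; first exact: cvg_cst.
  have -> : (fun n => atan (s n / s n ^+ 2)) = (fun n => atan (n.+1%:R : R)).
    apply/funext => n; congr atan; rewrite /s.
    have : (n.+1%:R : R) != 0 by rewrite pnatr_eq0.
    by move: (n.+1%:R : R) => y y0; field.
  apply: (@cvg_comp _ _ _ (fun n : nat => n.+1%:R : R) atan _ (pinfty_nbhs R)); last exact: cvgy_atan.
  by have := @cvgr_idn R; rewrite -cvg_shiftS.
have cv : (2 * (pi^-1 * atan (s n / (s n ^+ 2)))) ^+ 2 *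
    ((b - a - s n *+ 2) * (d - c - s n *+ 2)) @[n --> \oo] --> ((b - a) * (d - c) : R).
  have -> : (b - a) * (d - c) = (1 * 1) * ((b - a - (0 + 0)) * (d - c - (0 + 0))).
    by rewrite addr0 !subr0 !mul1r.
  apply: cvgM; first exact: cvgM.
  by apply: cvgM; (apply: cvgB; [exact: cvg_cst|exact: cvgD]).
apply: (cvgr_to_le cv); near=> n.
apply: le_trans (lower (s n ^+ 2) _); last by rewrite exprn_gt0.
apply: abel_form_box_lower; rewrite ?exprn_gt0//.
- by rewrite -mulr_natr -ltr_pdivlMr//; near: n; apply: (cvgr_lt _ cs); rewrite divr_gt0// subr_gt0.
- by rewrite -mulr_natr -ltr_pdivlMr//; near: n; apply: (cvgr_lt _ cs); rewrite divr_gt0// subr_gt0.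
Unshelve. all: by end_near. Qed.

End plancherel.

(** * Plancherel's identity for indicators of Borel sets *)

Section plancherel_theorem.
Local Open Scope complex_scope.
Context {R : realType}.
Local Notation cfun := (R * R -> R[i]).
Local Notation T := (measurableTypeR R * measurableTypeR R)%type.
Local Notation leb := (@lebesgue_measure R).
Local Notation mu := (@leb2 R).

Lemma rint_indic_sub (A K : set T) : measurable A -> measurable K ->
  A `<=` K -> rint mu (\1_K : T -> R) -> rint mu (\1_A : T -> R).
Proof.
move=> mA mK AK; apply: rint_le => // x.
rewrite ger0_norm ?indicE//; case: (boolP (x \in A)) => //.
by move=> /set_mem/AK xK; rewrite mem_set.
Qed.

(** One Dynkin argument for three passages: with h the first projection, then the second, then the
    identity, it leads from boxes to Borel subsets of a box by way of rectangles with Borel sides.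
    Intersecting with [K], whose indicator is integrable, keeps complements within L^1. *)
Lemma planch_dynkin d' (U : measurableType d') (h : T -> U) (G : set (set U))
    (K : set T) : measurable_fun setT h -> measurable K -> rint mu (\1_K : T -> R) ->
  @measurable _ U = <<s G >> -> setI_closed G ->
  planch (realfun (\1_K)) ->
  (forall A, G A -> planch (realfun (\1_(h @^-1` A `&` K)))) ->
  forall A, measurable A -> planch (realfun (\1_(h @^-1` A `&` K))).
Proof.
move=> mh mK rK UG GI pK pG A; rewrite UG.
have mpre B : measurable B -> measurable (h @^-1` B `&` K).
  by move=> mB; apply: measurableI => //; rewrite -[_ @^-1` _]setTI; exact: mh.
apply: (dynkin_induction (P := fun A => planch (realfun (\1_(h @^-1` A `&` K)))) UG GI) => //.
- by rewrite preimage_setT setTI.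
- move=> B mB pB.
  have := (planchDB pK pB).2; congr planch; apply/funext => x.
  rewrite /realfun -rmorphB !indicE !in_setI preimage_setC in_setC.
  by case: (x \in K); case: (x \in h @^-1` B) => /=; rewrite ?subrr ?subr0.
- move=> F mF tF pF.
  (* By disjointness the partial sums take only the values 0 and 1. At each point they are
     eventually constant, and the indicator of [K] dominates the error. *)
  pose v n x : R := \sum_(i < n) \1_(h @^-1` (F i) `&` K) x.
  have mU : measurable (\bigcup_k F k) by exact: bigcup_measurable.
  have vE n x : v n x = if [exists i : 'I_n, x \in (h @^-1` (F i) `&` K)] then 1 else 0.
    rewrite /v; case: ifPn => [/existsP[i xi]|].
      rewrite (bigD1 i)//= indicE xi big1 ?addr0// => j ji.
      rewrite indicE; case: (boolP (_ \in _)) => // xj; exfalso.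
      move: xi xj; rewrite !inE/= => -[xi _] [xj _].
      have /val_inj ij := tF i j Logic.I Logic.I (ex_intro _ (h x) (conj xi xj)).
      by rewrite ij eqxx in ji.
    rewrite negb_exists => /forallP H; apply: big1 => i _.
    by rewrite indicE (negbTE (H i)).
  have uE x : \1_(h @^-1` (\bigcup_k F k) `&` K) x =
      if `[< exists i, x \in (h @^-1` (F i) `&` K) >] then 1 else 0 :> R.
    rewrite indicE; case: asboolP => [ [i Hi] |H].
      by move: Hi; rewrite inE => -[Fi Kx]; rewrite mem_set//; split => //; exists i.
    rewrite memNset// => -[[i _ Fi] Kx]; apply: H.
    by exists i; rewrite inE; split.
  apply: (@planch_realfun_limit R _ v (\1_K)).
  + exact: (rint_indic_sub (mpre _ mU) mK _ rK).
  + apply: eq_rint (rint_indic_sub (mpre _ mU) mK _ rK) => // x.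
    by rewrite indic_sqr.
  + move=> n; have := planch_sum (index_enum 'I_n) (fun i : 'I_n => pF i).
    congr planch; apply/funext => x.
    by rewrite /realfun /v rmorph_sum.
  + move=> x; rewrite uE; case: asboolP => [[i xi]|H].
      apply: cvg_near_cst; exists i.+1 => //= n ni; rewrite vE.
      by case: existsP => // -[]; exists (Ordinal ni).
    apply: cvg_near_cst; apply: nearW => n; rewrite vE; case: existsP => // -[i xi].
    by exfalso; apply: H; exists i.
  + exact: rK.
  + move=> n x; rewrite uE vE; case: asboolP => [ [i Hi] |H].
      move: Hi; rewrite inE => -[_ Kx]; rewrite indicE mem_set//.
      by case: ifP => _; rewrite ?subrr ?expr0n ?subr0 ?expr1n.
    rewrite ifF; first by rewrite subrr expr0n indicE.
    by apply/negbTE/existsP => -[i xi]; apply: H; exists i.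
Qed.

Lemma planch_indic_box (A : set T) a b c d : measurable A ->
  planch (realfun (\1_(A `&` box a b c d))).
Proof.
have itvE (u v : R) : `]u, v]%classic = `]u, v]%classic `&` `]u, v]%classic.
  by rewrite setIid.
have mfst : measurable_fun setT (fst : T -> measurableTypeR R) by exact: measurable_fst.
have msnd : measurable_fun setT (snd : T -> measurableTypeR R) by exact: measurable_snd.
have H1 (B : set (measurableTypeR R)) a' b' c' d' : measurable B ->
    planch (realfun (\1_(fst @^-1` B `&` box a' b' c' d'))).
  apply: (@planch_dynkin _ (measurableTypeR R) fst (@ocitv R)) => //.
  - exact: measurable_box.
  - exact: rint_box.
  - exact: ocitvI.
  - exact: planch_box.
  move=> _ [[u v] _ <-].
  have -> : fst @^-1` `]u, v]%classic `&` box a' b' c' d' = box (Num.max u a') (Num.min v b') c' d'.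
    apply/seteqP; split => -[x y]; rewrite /box/= !in_itv/= !gt_max !le_min.
      by move=> [/andP[-> ->] [/andP[-> ->] ->]].
    by move=> [/andP[/andP[-> ->] /andP[-> ->]] ->].
  exact: planch_box.
have H2 (B C : set (measurableTypeR R)) : measurable B -> measurable C ->
    planch (realfun (\1_(snd @^-1` C `&` (fst @^-1` B `&` box a b c d)))).
  move=> mB; move: C.
  have mK : measurable (fst @^-1` B `&` box a b c d : set T).
    apply: measurableI; last exact: measurable_box.
    by rewrite -[_ @^-1` _]setTI; exact: mfst.
  apply: (@planch_dynkin _ (measurableTypeR R) snd (@ocitv R)) => //.
  - by apply: (rint_indic_sub mK (measurable_box a b c d)) => //; exact: rint_box.
  - exact: ocitvI.
  - exact: H1.
  move=> _ [[u v] _ <-].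
  have -> : snd @^-1` `]u, v]%classic `&` (fst @^-1` B `&` box a b c d) =
      fst @^-1` B `&` box a b (Num.max u c) (Num.min v d).
    apply/seteqP; split => -[x y]; rewrite /box/= !in_itv/= !gt_max !le_min.
      by move=> [/andP[-> ->] [? [-> /andP[-> ->]]]].
    by move=> [? [-> /andP[/andP[-> ->] /andP[-> ->]]]].
  exact: H1.
move: A.
apply: (@planch_dynkin _ T id
  [set A `*` B | A in measurable & B in measurable]) => //.
- exact: measurable_box.
- exact: rint_box.
- exact: (measurable_prod_measurableType (measurableTypeR R) (measurableTypeR R)).
- move=> _ _ [A mA [B mB <-]] [A' mA' [B' mB' <-]]; rewrite -setXI.
  exists (A `&` A'); first exact: measurableI.
  by exists (B `&` B') => //; exact: measurableI.
- exact: planch_box.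
move=> _ [A mA [B mB <-]].
have -> : id @^-1` (A `*` B) `&` box a b c d =
    snd @^-1` B `&` (fst @^-1` A `&` box a b c d).
  by apply/seteqP; split => -[x y] /=; tauto.
exact: H2.
Qed.

Lemma planch_indic (A : set T) : measurable A -> rint mu (\1_A : T -> R) ->
  planch (realfun (\1_A)).
Proof.
move=> mA rA.
pose K n := box (- n%:R) n%:R (- n%:R) (n%:R : R).
apply: (@planch_realfun_limit R _ (fun n => \1_(A `&` K n)) (\1_A)) => //.
- by apply: eq_rint rA => x; rewrite indic_sqr.
- by move=> n; exact: planch_indic_box.
- move=> x; apply: cvg_near_cst.
  pose N := maxn (Num.truncn `|x.1|).+1 (Num.truncn `|x.2|).+1.
  exists N => //= n Nn; rewrite !indicE in_setI; congr ((_ : bool)%:R).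
  have -> : x \in K n = true.
    have P (y : R) : ((Num.truncn `|y|).+1 <= n)%N -> - n%:R < y <= n%:R.
      move=> yn; have : `|y| < n%:R.
        by rewrite (lt_le_trans (truncnS_gt _))// ler_nat.
      by rewrite ltr_norml => /andP[-> /ltW].
    rewrite mem_set//; split; rewrite /= in_itv/=; apply: P; apply: leq_trans Nn.
      exact: leq_maxl.
    exact: leq_maxr.
  by rewrite andbT.
- move=> n x; rewrite !indicE in_setI.
  by case: (x \in A); case: (x \in K n); rewrite ?subrr ?subr0 ?expr0n ?expr1n.
Qed.

End plancherel_theorem.

Section plancherel_all.
Local Open Scope complex_scope.
Context {R : realType}.
Local Notation cfun := (R * R -> R[i]).
Local Notation T := (measurableTypeR R * measurableTypeR R)%type.
Local Notation mu := (@leb2 R).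

Import HBNNSimple.

Lemma planch_nonneg (u : T -> R) : (forall x, 0 <= u x) -> rint mu u ->
  rint mu (fun x => u x ^+ 2) -> planch (realfun u).
Proof.
move=> u0 ru ru2.
have mu' : measurable_fun setT (EFin \o u) by apply/measurable_EFinP; exact: rint_measurable ru.
pose v := nnsfun_approx measurableT mu'.
have vu x : v n x @[n --> \oo] --> u x.
  have := @cvg_nnsfun_approx _ _ _ _ measurableT _ mu' (fun x _ => u0 x) x I.
  by move/fine_cvg.
have v_le n x : v n x <= u x.
  rewrite -(cvg_lim _ (vu x))//; apply: nondecreasing_cvgn_le.
    by move=> i j ij; exact: (lefP _ _ (nd_nnsfun_approx measurableT mu' ij)).
  by apply/cvg_ex; exists (u x); exact: vu.
apply: (@planch_realfun_limit R u (fun n => v n) (fun x => u x ^+ 2)) => //; last first.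
  move=> n x; rewrite lerXn2r ?nnegrE ?subr_ge0// lerBlDr lerDl.
  exact: fun_ge0.
move=> n.
have fin : finite_set (range (v n)) by exact: fimfunP.
have FP (y : R) : planch (fun x => y%:C * realfun (\1_(v n @^-1` [set y])) x).
  have my : measurable (v n @^-1` [set y]) by exact: measurable_sfunP.
  have [->|y0] := eqVneq y 0.
    have := @planch0 R; congr planch; apply/funext => x.
    by rewrite rmorph0 mul0r.
  apply: planchZ; apply: planch_indic => //.
  (* Chebyshev: on this level set y = v n <= u, so its indicator is at most u / y. *)
  apply: (@rint_le _ _ _ mu _ (fun x => `|y|^-1 * u x)).
  - exact: measurable_indic.
  - move=> x; rewrite indicE; case: (boolP (_ \in _)) => [|_]; last first.
      by rewrite normr0 mulr_ge0// invr_ge0.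
    rewrite inE/= => vy; rewrite normr1 mulrC ler_pdivlMr ?normr_gt0// mul1r.
    by rewrite -vy ger0_norm ?v_le//; exact: fun_ge0.
  - exact: rintZ.
have := planch_sum (fset_set (range (v n))) FP.
congr planch; apply/funext => x.
rewrite /realfun [in RHS](fimfunE (v n)) fsbig_finite//.
rewrite rmorph_sum; apply: eq_bigr => y _; exact/esym/rmorphM.
Qed.

Lemma planch_real (u : T -> R) : rint mu u -> rint mu (fun x => u x ^+ 2) ->
  planch (realfun u).
Proof.
move=> ru ru2.
have mu' := rint_measurable ru.
pose up x := Num.max (u x) 0; pose um x := Num.max (- u x) 0.
have mp : measurable_fun setT up by exact: measurable_maxr.
have mm : measurable_fun setT um.
  by apply: measurable_maxr => //; exact: measurableT_comp.
have P (w : T -> R) : measurable_fun setT w -> (forall x, 0 <= w x) -> (forall x, `|w x| <= `|u x|) ->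
    planch (realfun w).
  move=> mw w0 wu; apply: planch_nonneg => //.
    exact: rint_le mw wu (rint_norm ru).
  apply: (rint_le (g := fun x => u x ^+ 2)) => //; first exact: measurable_funX.
  by move=> x; rewrite normrX -(real_normK (num_real (u x))) lerXn2r// nnegrE.
have pp : planch (realfun up).
  apply: P => // x; first by rewrite le_max lexx orbT.
  by rewrite /up maxEle; case: ifP => _; rewrite ?normr0.
have pm : planch (realfun um).
  apply: P => // x; first by rewrite le_max lexx orbT.
  by rewrite /um maxEle; case: ifP => _; rewrite ?normr0 ?normrN.
have := (planchDB pp pm).2; congr planch; apply/funext => x.
rewrite /realfun -rmorphB; congr (_%:C); rewrite /up /um !maxEle oppr_le0.
case: (leP (u x) 0) => [ux|/ltW ->]; last by rewrite subr0.
case: (leP 0 (u x)) => [ux'|_]; last by rewrite sub0r opprK.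
by rewrite subrr; apply/eqP; rewrite eq_le ux ux'.
Qed.

Theorem plancherel (f : cfun) : cLfun 1%:E f -> cLfun 2%:E f ->
  cLfun 2%:E (fourierL1 f) /\ ip (fourierL1 f) (fourierL1 f) = ip f f.
Proof.
move=> lf lf2; have [F2 _] := fourierL1_contraction lf lf2.
split; first exact: F2.
have /cL1P[r1 r2] := lf; have [/l2P[_ s1] /l2P[_ s2]] := lf2.
suff [] : planch f by [].
have := (planchDB (planch_real r1 s1) (planchi (planch_real r2 s2))).1.
congr planch; apply/funext => x; rewrite /realfun.
by apply: complex_ext; case: (f x) => a b /=; ring.
Qed.

End plancherel_all.

(** * The L^2 Fourier transform as an isometry *)

Section fourier_isometry.
Local Open Scope complex_scope.
Context {R : realType}.
Local Notation cfun := (R * R -> R[i]).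
Local Notation mu := (@leb2 R).
Implicit Types f g : cfun.

Lemma plancherel_ip f g : cLfun 1%:E f -> cLfun 2%:E f -> cLfun 1%:E g -> cLfun 2%:E g ->
  ip (fourierL1 f) (fourierL1 g) = ip f g.
Proof.
move=> f1 f2 g1 g2.
have [F2 ef] := plancherel f1 f2; have [G2 eg] := plancherel g1 g2.
have [_ e] := plancherel (cL1D f1 g1) (cL2D f2 g2).
have E (a b : cfun) : cLfun 2%:E a -> cLfun 2%:E b ->
    ip (fun x => a x + b x) (fun x => a x + b x) = ip a a + ip b b + 2 * ip a b.
  move=> la lb; rewrite (ipDl la lb (cL2D la lb)).
  by rewrite (ipDr la lb la) (ipDr la lb lb) (ipC b a); ring.
have := e.
have -> : fourierL1 (fun x => f x + g x) = (fun xi => fourierL1 f xi + fourierL1 g xi).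
  by apply/funext => xi; rewrite fourierL1D.
rewrite (E _ _ F2 G2) (E _ _ f2 g2) ef eg => /addrI.
by apply: mulfI; rewrite pnatr_eq0.
Qed.

Lemma L2normE f : cLfun 2%:E f -> L2norm f = (Num.sqrt (ip f f))%:E.
Proof.
move=> lf; rewrite /L2norm unlock.
have -> : (\int[lebesgue2 R]_x (`|(Normc.normc (f x))%:E| `^ 2) = (ip f f)%:E)%E.
  rewrite EFin_rintegral; last exact: rint_ip.
  apply: eq_integral => x _ /=; congr EFin.
  case: (f x) => a b /=; rewrite powR_mulrn// real_normK ?num_real//.
  by rewrite sqr_sqrtr ?addr_ge0 ?sqr_ge0// !expr2.
by rewrite /= powR12_sqrt// ip_ge0.
Qed.

Lemma ip_cvg (f_ g_ : nat -> cfun) f g : cLfun 2%:E f -> cLfun 2%:E g ->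
  (forall n, cLfun 2%:E (f_ n)) -> (forall n, cLfun 2%:E (g_ n)) ->
  L2norm (fun x => f_ n x - f x) @[n --> \oo] --> 0%E ->
  L2norm (fun x => g_ n x - g x) @[n --> \oo] --> 0%E ->
  ip (f_ n) (g_ n) @[n --> \oo] --> ip f g.
Proof.
move=> lf lg lf_ lg_ cf cg.
pose df n := Num.sqrt (ip (fun x => f_ n x - f x) (fun x => f_ n x - f x)).
pose dg n := Num.sqrt (ip (fun x => g_ n x - g x) (fun x => g_ n x - g x)).
have ldf n : cLfun 2%:E (fun x => f_ n x - f x) := cL2B (lf_ n) lf.
have ldg n : cLfun 2%:E (fun x => g_ n x - g x) := cL2B (lg_ n) lg.
have {}cf : df n @[n --> \oo] --> (0 : R).
  have E : (fun n => L2norm (fun x => f_ n x - f x)) = (fun n => (df n)%:E).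
    by apply/funext => n; exact: L2normE (ldf n).
  by move: cf; rewrite E => /fine_cvg.
have {}cg : dg n @[n --> \oo] --> (0 : R).
  have E : (fun n => L2norm (fun x => g_ n x - g x)) = (fun n => (dg n)%:E).
    by apply/funext => n; exact: L2normE (ldg n).
  by move: cg; rewrite E => /fine_cvg.
pose Nf := Num.sqrt (ip f f); pose Ng := Num.sqrt (ip g g).
pose B n := df n * dg n + df n * Ng + Nf * dg n.
have cB : B n @[n --> \oo] --> (0 : R).
  have -> : (0 : R) = 0 * 0 + 0 * Ng + Nf * 0 by rewrite !mul0r mulr0 !addr0.
  apply: cvgD; first apply: cvgD; apply: cvgM => //; exact: cvg_cst.
have dB n : `|ip (f_ n) (g_ n) - ip f g| <= B n.
  have -> : ip (f_ n) (g_ n) - ip f g = ip (fun x => f_ n x - f x) (fun x => g_ n x - g x) +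
      ip (fun x => f_ n x - f x) g + ip f (fun x => g_ n x - g x).
    rewrite (ipBr (lg_ n) lg (ldf n)) (ipBl (lf_ n) lf (lg_ n)) (ipBr (lg_ n) lg lf).
    by move: (ip _ _) (ip _ _) (ip _ _) (ip _ _) => *; ring.
  rewrite (le_trans (ler_normD _ _))// lerD//; last exact: ip_cauchy_sqrt lf (ldg n).
  rewrite (le_trans (ler_normD _ _))// lerD//.
    exact: ip_cauchy_sqrt (ldf n) (ldg n).
  exact: ip_cauchy_sqrt (ldf n) lg.
apply/cvgrPdist_le => e e0.
move/cvgrPdist_le : cB => /(_ _ e0); apply: filterS => n.
rewrite sub0r normrN distrC => /(le_trans (ler_norm _)).
exact: le_trans.
Qed.

(** Polarised Plancherel along the two approximating sequences, then the limit. From it follow the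
    uniqueness of the transform up to null sets and the evaluation of pairings with functions whose
    transform is not given by an integral. *)
Theorem is_fourier_ip f g f' g' : is_fourier f g -> is_fourier f' g' ->
  ip f f' = ip g g'.
Proof.
move=> [lf lg [f_ [lf_ cf cg]]] [lf' lg' [f_' [lf_' cf' cg']]].
have c1 := ip_cvg lf lf' (fun n => (lf_ n).2) (fun n => (lf_' n).2) cf cf'.
have c2 := ip_cvg lg lg' (fun n => (plancherel (lf_ n).1 (lf_ n).2).1)
  (fun n => (plancherel (lf_' n).1 (lf_' n).2).1) cg cg'.
have E : (fun n => ip (fourierL1 (f_ n)) (fourierL1 (f_' n))) = (fun n => ip (f_ n) (f_' n)).
  by apply/funext => n; exact: plancherel_ip (lf_ n).1 (lf_ n).2 (lf_' n).1 (lf_' n).2.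
rewrite E in c2.
exact: cvg_unique c1 c2.
Qed.

Lemma L2norm0 : L2norm (fun=> 0 : R[i]) = 0%E.
Proof.
rewrite (L2normE cL2_0) (ae_ip0 cL2_0) ?sqrtr0//.
exact: aeW.
Qed.

Lemma is_fourier_L1 f : cLfun 1%:E f -> cLfun 2%:E f -> is_fourier f (fourierL1 f).
Proof.
move=> f1 f2; split; [exact: f2|exact: (plancherel f1 f2).1|].
exists (fun=> f); split => //.
- under eq_fun do under eq_fun do rewrite subrr.
  by rewrite L2norm0; exact: cvg_cst.
- under eq_fun do under eq_fun do rewrite subrr.
  by rewrite L2norm0; exact: cvg_cst.
Qed.

Lemma ip_diff0 f g : cLfun 2%:E f -> cLfun 2%:E g ->
  ip f g = ip f f -> ip g g = ip f f -> ae_equal f g.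
Proof.
move=> lf lg e1 e2.
have ld := cL2B lf lg.
have d0 : ip (fun x => f x - g x) (fun x => f x - g x) = 0.
  by rewrite (ipBl lf lg ld) (ipBr lf lg lf) (ipBr lf lg lg) (ipC g f) e1 e2 !subrr.
apply: aeS (ip0_ae ld d0) => x /eqP; rewrite subr_eq0.
by move/eqP.
Qed.

Lemma is_fourier_unique f g g' : is_fourier f g -> is_fourier f g' -> ae_equal g g'.
Proof.
move=> h h'; have [_ lg _] := h; have [_ lg' _] := h'.
apply: (ip_diff0 lg lg').
  by rewrite -(is_fourier_ip h h') (is_fourier_ip h h).
by rewrite -(is_fourier_ip h' h') (is_fourier_ip h h).
Qed.

Lemma is_fourier_ae f g g' : is_fourier f g -> cLfun 2%:E g' -> ae_equal g g' ->
  is_fourier f g'.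
Proof.
move=> [lf lg [f_ [lf_ cf cg]]] lg' gg'; split => //.
exists f_; split => //; rewrite [X in X @ _](_ : _ =
  (fun n => L2norm (fun x => fourierL1 (f_ n) x - g x))); first exact: cg.
apply/funext => n.
have lF := (plancherel (lf_ n).1 (lf_ n).2).1.
rewrite (L2normE (cL2B lF lg)) (L2normE (cL2B lF lg')); congr (Num.sqrt _)%:E.
have E : ae_equal (fun x => fourierL1 (f_ n) x - g' x) (fun x => fourierL1 (f_ n) x - g x).
  by apply: aeS gg' => x ->.
exact: (ip_eq_ae (cL2B lF lg') (cL2B lF lg') (cL2B lF lg) (cL2B lF lg) E E).
Qed.

End fourier_isometry.

(** * Eigenfunctions *)

Section space_band_operator.
Local Open Scope complex_scope.
Context {R : realType}.
Local Notation cfun := (R * R -> R[i]).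
Local Notation T := (measurableTypeR R * measurableTypeR R)%type.
Local Notation mu := (@leb2 R).
Implicit Types f g h u v : cfun.

Lemma fourierL1_0 (xi : R * R) : fourierL1 (fun=> 0 : R[i]) xi = 0.
Proof.
transitivity (fourierL1 (fun x : R * R => 0 - 0 : R[i]) xi).
  by congr (fourierL1 _ xi); apply/funext => x; rewrite subrr.
by rewrite (fourierL1B xi (@cL1_0 R) (@cL1_0 R)) subrr.
Qed.

Lemma space_limit_cL2 (A : set T) f : measurable A -> cLfun 2%:E f ->
  cLfun 2%:E (space_limit A f).
Proof. by move=> mA; apply: (@cL2M _ (\1_A) 1) => // x; exact: indic_le1. Qed.

Lemma space_limit_cL1 (A : set T) f : measurable A -> rint mu (\1_A : T -> R) ->
  cLfun 2%:E f -> cLfun 1%:E (space_limit A f).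
Proof.
move=> mA rA [f1 f2].
have lA : (\1_A : T -> R) \in Lfun mu 2%:E.
  by apply/l2P; split => //; apply: eq_rint rA => x; rewrite indic_sqr.
apply/cL1P; split.
- by apply: eq_rint (l2M lA f1) => x; rewrite /space_limit ReZ.
- by apply: eq_rint (l2M lA f2) => x; rewrite /space_limit ImZ.
Qed.

Lemma ip_space_limit (A : set T) f g : ip (space_limit A f) g = ip f (space_limit A g).
Proof. by apply: eq_Rintegral => x _; rewrite /space_limit !ReImE; ring. Qed.

Lemma space_limitK (A : set T) f : space_limit A (space_limit A f) = space_limit A f.
Proof. by apply/funext => x; rewrite /space_limit mulrA -rmorphM -expr2 indic_sqr. Qed.

Lemma space_limit_ae (A : set T) f g : ae_equal f g ->
  ae_equal (space_limit A f) (space_limit A g).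
Proof. by apply: aeS => x; rewrite /space_limit => ->. Qed.

Lemma ip_space_limit_le (A : set T) f : measurable A -> cLfun 2%:E f ->
  ip (space_limit A f) f <= ip f f.
Proof.
move=> mA lf; apply: rintegral_le.
- exact: (rint_ip (space_limit_cL2 mA lf) lf).
- exact: (rint_ip lf lf).
move=> x; rewrite /space_limit ReZ ImZ -!mulrA -mulrDr ler_piMl//.
by rewrite addr_ge0// -expr2 sqr_ge0.
Qed.

(** Extracts from the operator, which is built on chosen values of [fourier] and [fourier_inv], a
    relation that can be computed with. As m is nonzero, f vanishes off [E] up to a null set, and
    its truncation h lies in L^1, where the transform is an integral. *)
Lemma eigenfunction_fourier (E S : set T) (m : R) f :
  measurable E -> rint mu (\1_E : T -> R) -> measurable S -> m != 0 ->
  eigenfunction (space_band_limit E S) m f ->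
  let h := space_limit E f in
  exists u, [/\ is_fourier u (space_limit S (fourierL1 h)),
    ae_equal (space_limit E u) (fun x => m%:C * h x) & ae_equal f h].
Proof.
move=> mE rE mS m0 [lf ef] h.
have h1 : cLfun 1%:E h by exact: space_limit_cL1.
have h2 : cLfun 2%:E h by exact: space_limit_cL2.
have [H2 eH] := plancherel h1 h2.
have S2 := space_limit_cL2 mS H2.
have hF : is_fourier h (fourier h).
  apply: (@xgetPex _ _ (is_fourier h)); exists (fourierL1 h); exact: is_fourier_L1.
have FH := is_fourier_unique hF (is_fourier_L1 h1 h2).
have SFH := space_limit_ae S FH.
have [_ lF _] := hF.
pose u := band_limit S h.
have fh : ae_equal f h.
  apply: aeS ef => x; rewrite /space_band_limit /h /space_limit => ex.
  rewrite indicE in ex *; move: ex; case: (x \in E) => [_|].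
    by rewrite rmorph1 mul1r.
  rewrite rmorph0 !mul0r => /esym/eqP; rewrite mulf_eq0 fmorph_eq0 (negbTE m0).
  by move/eqP.
have [[u0 Hu0]|nu] := pselect (exists u0, is_fourier u0 (space_limit S (fourier h))).
  exists u; split => //.
    apply: (is_fourier_ae _ S2 SFH).
    apply: (@xgetPex _ _ [set f | is_fourier f (space_limit S (fourier h))]).
    by exists u0.
  by apply: aeS2 fh ef => x hx; rewrite /space_band_limit -/h -hx.
(* Without a preimage [fourier_inv] takes its default value 0. The eigenvalue equation then forces f
   = 0 almost everywhere, so the cut transform vanishes almost everywhere and 0 is a preimage after
   all. *)
exfalso; apply: (nu); exists (fun=> 0).
have u0 : u = (fun=> 0) by apply: xgetPN => u0 Hu0; apply: nu; exists u0.
have f0 : ae_equal f (fun=> 0).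
  apply: aeS ef => x; rewrite /space_band_limit -/h -/u u0 /space_limit mulr0.
  by move/esym/eqP; rewrite mulf_eq0 => /orP[|/eqP//]; rewrite fmorph_eq0 (negbTE m0).
have h0 : ae_equal h (fun=> 0).
  by apply: aeS f0 => x fx; rewrite /h /space_limit fx mulr0.
have H0 : ae_equal (fourierL1 h) (fun=> 0).
  by apply: (ip0_ae H2); rewrite eH; exact: ae_ip0.
have z0 : ip (fourierL1 (fun=> 0 : R[i])) (fourierL1 (fun=> 0 : R[i])) = 0.
  rewrite (plancherel cL1_0 cL2_0).2; apply: (ae_ip0 cL2_0); exact: aeW.
apply: (is_fourier_ae (is_fourier_L1 cL1_0 cL2_0)).
  exact: (space_limit_cL2 mS lF).
have SF0 : ae_equal (space_limit S (fourier h)) (fun=> 0).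
  by apply: aeS2 SFH H0 => x -> e; rewrite /space_limit e mulr0.
by apply: aeS2 (ip0_ae (plancherel cL1_0 cL2_0).1 z0) SF0 => x -> ->.
Qed.

Let sqr_le_of_self_bound (eta a b : R) : 0 <= eta -> 0 <= a -> 0 <= b ->
  b ^+ 2 <= eta * a * b -> b ^+ 2 <= eta ^+ 2 * a ^+ 2.
Proof.
move=> eta0 a0; rewrite le_eqVlt => /predU1P[<- _|b0 ab].
  by rewrite expr0n -exprMn sqr_ge0.
rewrite -exprMn lerXn2r ?nnegrE ?mulr_ge0 ?(ltW b0)//.
by rewrite -(ler_pM2r b0) -expr2.
Qed.

Section eigenfamily.
Context (E S : set T) (mE : measurable E) (rE : rint mu (\1_E : T -> R))
  (mS : measurable S) (n : nat) (m : 'I_n -> R) (h u : 'I_n -> cfun)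
  (h1 : forall i, cLfun 1%:E (h i)) (h2 : forall i, cLfun 2%:E (h i))
  (hE : forall i, space_limit E (h i) = h i)
  (hu : forall i, is_fourier (u i) (space_limit S (fourierL1 (h i))))
  (hm : forall i, ae_equal (space_limit E (u i)) (fun x => (m i)%:C * h i x)).

Let lu i : cLfun 2%:E (u i). Proof. by case: (hu i). Qed.

Lemma ip_band_test i v : cLfun 1%:E v -> cLfun 2%:E v ->
  ip (u i) v = ip (space_limit S (fourierL1 (h i))) (fourierL1 v).
Proof. by move=> v1 v2; exact: (is_fourier_ip (hu i) (is_fourier_L1 v1 v2)). Qed.

Lemma ip_band_eigen i j : ip (u i) (h j) = m i * ip (h i) (h j).
Proof.
rewrite -[in LHS](hE j) -ip_space_limit.
rewrite (ip_eq_ae (space_limit_cL2 mE (lu i)) (h2 j) (cL2Z (m i) (h2 i)) (h2 j)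
  (hm i) (aeW _ (fun=> erefl))).
exact: ipZl.
Qed.

(** On the Fourier side both functions are cut to [S], and one cut suffices; this reduces the
    pairing to [ip_band_eigen]. *)
Lemma ip_band_band i j : ip (u i) (u j) = m i * ip (h i) (h j).
Proof.
rewrite (is_fourier_ip (hu i) (hu j)) ipC ip_space_limit space_limitK ipC.
by rewrite -ip_band_test// ip_band_eigen.
Qed.

Lemma eigen_orthogonal i j : m i != m j -> ip (h i) (h j) = 0.
Proof.
move=> mij; apply/eqP; have : m i * ip (h i) (h j) = m j * ip (h i) (h j).
  rewrite -ip_band_eigen ip_band_test// ip_space_limit ipC -ip_band_test//.
  by rewrite ip_band_eigen ipC.
by move/eqP; rewrite -subr_eq0 -mulrBl mulf_eq0 subr_eq0 (negbTE mij).
Qed.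

Lemma eigenvalue_01 i : ip (h i) (h i) != 0 -> 0 <= m i <= 1.
Proof.
move=> hi0; have hi : 0 < ip (h i) (h i) by rewrite lt_neqAle eq_sym hi0 ip_ge0.
apply/andP; split.
  by rewrite -(pmulr_lge0 _ hi) -ip_band_band ip_ge0.
rewrite -(ler_pM2r hi) mul1r -ip_band_eigen ip_band_test//.
have [H2 <-] := plancherel (h1 i) (h2 i).
exact: ip_space_limit_le.
Qed.

Let comb (c : 'I_n -> R) (F : 'I_n -> cfun) : cfun := fun x => \sum_i (c i)%:C * F i x.

Let comb_cL2 c F : (forall i, cLfun 2%:E (F i)) -> cLfun 2%:E (comb c F).
Proof. by move=> lF; apply: cL2_sum => i; exact: cL2Z. Qed.

Let ip_comb c c' F F' : (forall i, cLfun 2%:E (F i)) -> (forall i, cLfun 2%:E (F' i)) ->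
  ip (comb c F) (comb c' F') = \sum_i \sum_j c i * c' j * ip (F i) (F' j).
Proof.
move=> lF lF'; rewrite ip_suml; last 2 first.
- by move=> i; exact: cL2Z.
- exact: comb_cL2.
apply: eq_bigr => i _; rewrite ip_sumr; last 2 first.
- by move=> j; exact: cL2Z.
- exact: cL2Z.
apply: eq_bigr => j _; rewrite ipZl//; last exact: cL2Z.
by rewrite ipZr// mulrA.
Qed.

(** The coefficient of c_i c_j <h_i, h_j> on the right is m_i (1 - m_j), and only pairs with m_i =
    m_j contribute. Eigenfunctions of one eigenvalue are not assumed orthogonal, so the difference
    of the two sides is not a sum of squares term by term; it is |sum k_i c_i h_i|^2 with k_i^2 =
    m_i (1 - m_i) - eps (1 - eps). *)
Lemma eigen_energy (c : 'I_n -> R) (eps : R) :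
  (forall i, eps * (1 - eps) <= m i * (1 - m i)) ->
  eps * (1 - eps) * ip (comb c h) (comb c h) <=
  ip (comb c u) (comb c u) - ip (space_limit E (comb c u)) (space_limit E (comb c u)).
Proof.
move=> em.
have sE i : cLfun 2%:E (space_limit E (u i)) by exact: space_limit_cL2.
have -> : space_limit E (comb c u) = comb c (fun i => space_limit E (u i)).
  apply/funext => x; rewrite /space_limit /comb mulr_sumr.
  by apply: eq_bigr => i _; rewrite mulrCA.
rewrite !ip_comb// -sumrB mulr_sumr -subr_ge0 -sumrB.
pose k i := Num.sqrt (m i * (1 - m i) - eps * (1 - eps)).
have -> : \sum_(i < n) (\sum_j c i * c j * ip (u i) (u j) -
      \sum_j c i * c j * ip (space_limit E (u i)) (space_limit E (u j)) -
      eps * (1 - eps) * (\sum_j c i * c j * ip (h i) (h j))) =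
    ip (comb (fun i => k i * c i) h) (comb (fun i => k i * c i) h).
  rewrite ip_comb//; apply: eq_bigr => i _.
  rewrite mulr_sumr -!sumrB; apply: eq_bigr => j _.
  have -> : ip (space_limit E (u i)) (space_limit E (u j)) = m i * m j * ip (h i) (h j).
    rewrite (ip_eq_ae (sE i) (sE j) (cL2Z (m i) (h2 i)) (cL2Z (m j) (h2 j)) (hm i) (hm j)).
    rewrite (ipZl (m i) (h2 i) (cL2Z (m j) (h2 j))) (ipZr (m j) (h2 j) (h2 i)).
    exact: mulrA.
  rewrite ip_band_band.
  have [mij|mij] := eqVneq (m i) (m j); last by rewrite (eigen_orthogonal mij); ring.
  have -> : k j = k i by rewrite /k mij.
  have : k i * k i = m i * (1 - m i) - eps * (1 - eps).
    by rewrite -expr2 sqr_sqrtr// subr_ge0.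
  rewrite -mij; move: (k i) (ip (h i) (h j)) => a b ab.
  transitivity (c i * c j * b * (m i * (1 - m i) - eps * (1 - eps))); first by ring.
  by rewrite -ab; ring.
exact: ip_ge0.
Qed.

(* The truncation to [box] makes [fourierL1] applicable to the test function. *)
Lemma eigen_complement_bound (c : 'I_n -> R) (eta : R) : 0 <= eta ->
  (forall v, cLfun 1%:E v -> cLfun 2%:E v -> (forall x, E x -> v x = 0) ->
    `|ip (space_limit S (fourierL1 (comb c h))) (fourierL1 v)| <=
    eta * Num.sqrt (ip (comb c h) (comb c h)) * Num.sqrt (ip v v)) ->
  ip (comb c u) (comb c u) - ip (space_limit E (comb c u)) (space_limit E (comb c u)) <=
  eta ^+ 2 * ip (comb c h) (comb c h).
Proof.
move=> eta0 H.
set U := comb c u; set f := comb c h.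
have lU : cLfun 2%:E U by exact: comb_cL2.
have mEc : measurable (~` E) by exact: measurableC.
pose W := space_limit (~` E) U.
have lW : cLfun 2%:E W by exact: space_limit_cL2.
pose e x := complex.Re (W x) * complex.Re (W x) + complex.Im (W x) * complex.Im (W x).
have e0 x : 0 <= e x by rewrite addr_ge0// -expr2 sqr_ge0.
have split_ip : ip U U - ip (space_limit E U) (space_limit E U) = ip W W.
  rewrite /ip -rintegralB; last 2 first.
  - exact: rint_ip.
  - by apply: rint_ip; exact: space_limit_cL2.
  apply: eq_Rintegral => x _; rewrite /W /space_limit !ReImE !indicE in_setC.
  by case: (x \in E) => /=; ring.
rewrite split_ip.
pose K k := box (- k%:R) k%:R (- k%:R) (k%:R : R).
have mK k : measurable (K k : set T) by exact: measurable_box.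
pose v k := space_limit (K k) W.
have v2 k : cLfun 2%:E (v k) by exact: space_limit_cL2.
have v1 k : cLfun 1%:E (v k) by apply: space_limit_cL1 => //; exact: rint_box.
have vv k : ip (v k) (v k) = ip U (v k).
  apply: eq_Rintegral => x _; rewrite /v /W /space_limit !ReImE !indicE.
  by case: (x \in K k); case: (x \in ~` E) => /=; ring.
have Phi_comb : fourierL1 f = (fun xi => \sum_i (c i)%:C * fourierL1 (h i) xi).
  apply/funext => xi; rewrite /f /comb.
  elim: (index_enum _) => [|i s IH].
    by rewrite big_nil; under eq_fun do rewrite big_nil; exact: fourierL1_0.
  under eq_fun do rewrite big_cons.
  rewrite fourierL1D ?big_cons ?IH ?fourierL1Z//; first exact: cL1Z.
  by apply: cL1_sum => j; exact: cL1Z.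
have Uv k : ip U (v k) = ip (space_limit S (fourierL1 f)) (fourierL1 (v k)).
  have [V2 _] := plancherel (v1 k) (v2 k).
  have H2 i : cLfun 2%:E (fourierL1 (h i)) := (plancherel (h1 i) (h2 i)).1.
  have -> : space_limit S (fourierL1 f) =
      comb c (fun i => space_limit S (fourierL1 (h i))).
    rewrite Phi_comb; apply/funext => x; rewrite /space_limit /comb mulr_sumr.
    by apply: eq_bigr => i _; rewrite mulrCA.
  rewrite /U /comb ip_suml//; last by move=> i; exact: cL2Z.
  rewrite ip_suml//; last by move=> i; apply: cL2Z; exact: space_limit_cL2.
  apply: eq_bigr => i _; rewrite (ipZl (c i) (lu i) (v2 k)).
  rewrite (ipZl (c i) (space_limit_cL2 mS (H2 i)) V2).
  by rewrite (ip_band_test i (v1 k) (v2 k)).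
have bound k : ip (v k) (v k) <= eta ^+ 2 * ip f f.
  have vE x : E x -> v k x = 0.
    by move=> Ex; rewrite /v /W /space_limit [\1_(~` E) x]indicE in_setC mem_set//= mul0r mulr0.
  have := H _ (v1 k) (v2 k) vE; rewrite -/f -Uv -vv ger0_norm ?ip_ge0//.
  rewrite -(sqr_sqrtr (ip_ge0 (v k))) -{2}(sqr_sqrtr (ip_ge0 f)).
  rewrite sqrtr_sqr (ger0_norm (sqrtr_ge0 _)).
  exact: (sqr_le_of_self_bound eta0 (sqrtr_ge0 _) (sqrtr_ge0 _)).
suff [_ H2] : rint mu e /\ \int[mu]_x e x <= eta ^+ 2 * ip f f by exact: H2.
apply: (@rint_monotone _ T R mu (fun k x => \1_(K k) x * e x)).
- move=> k; apply: (rintM_bounded (M := 1)) => // [x|]; [exact: indic_le1|exact: rint_ip].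
- by move=> k x; rewrite mulr_ge0// indicE.
- move=> x i j ij; rewrite ler_wpM2r// !indicE; case: (boolP (x \in K i)) => // /set_mem[].
  rewrite /= !in_itv/= => /andP[p1 p2] /andP[p3 p4].
  have ijR : i%:R <= j%:R :> R by rewrite ler_nat.
  by rewrite mem_set//; split; rewrite /= in_itv/=; apply/andP; split; lra.
- move=> x; apply: cvg_near_cst.
  pose N := maxn (Num.truncn `|x.1|).+1 (Num.truncn `|x.2|).+1.
  exists N => //= k Nk; rewrite indicE mem_set ?mul1r//.
  have P (y : R) : ((Num.truncn `|y|).+1 <= k)%N -> - k%:R < y <= k%:R.
    move=> yn; have : `|y| < k%:R by rewrite (lt_le_trans (truncnS_gt _))// ler_nat.
    by rewrite ltr_norml => /andP[-> /ltW].
  split; rewrite /= in_itv/=; apply: P; apply: leq_trans Nk; first exact: leq_maxl.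
  exact: leq_maxr.
- move=> k; apply: le_trans (bound k); rewrite le_eqVlt; apply/orP; left; apply/eqP.
  apply: eq_Rintegral => x _; rewrite /v /e /space_limit !ReZ !ImZ indicE.
  by case: (x \in K k) => /=; ring.
Qed.

End eigenfamily.
End space_band_operator.

(** * From eigenvalue sequences to families of eigenfunctions *)

Section eigenvalue_counting.
Local Open Scope complex_scope.
Context {R : realType}.
Local Notation cfun := (R * R -> R[i]).
Local Notation T := (measurableTypeR R * measurableTypeR R)%type.
Local Notation mu := (@leb2 R).

Lemma Re_sum (I : Type) (s : seq I) (F : I -> R[i]) :
  complex.Re (\sum_(i <- s) F i) = \sum_(i <- s) complex.Re (F i).
Proof. exact: (big_morph _ (@ReD R) (@Re0 R)). Qed.

Lemma Im_sum (I : Type) (s : seq I) (F : I -> R[i]) :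
  complex.Im (\sum_(i <- s) F i) = \sum_(i <- s) complex.Im (F i).
Proof. exact: (big_morph _ (@ImD R) (@Im0 R)). Qed.

(** For each nonzero m, a bijection between the indices k with lambda k = m and a basis of the
    eigenspace distributes the basis among those indices. Independence is stated for one eigenvalue
    at a time, as [multiplicity] gives it; c is supported on its indices. *)
Lemma eigenvalue_sequence_basis (A : cfun -> cfun) (lambda : nat -> R) :
  eigenvalue_sequence A lambda -> exists e : nat -> cfun,
  (forall k, lambda k != 0 -> eigenfunction A (lambda k) (e k)) /\
  (forall (m : R) N (k : 'I_N -> nat) (c : 'I_N -> R[i]), m != 0 -> injective k ->
    (forall i, c i != 0 -> lambda (k i) = m) ->
    ae_equal (fun x => \sum_i c i * e (k i) x) (fun=> 0) -> forall i, c i = 0).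
Proof.
move=> [_ Hmult].
have Hm (m : R) : exists g : nat -> cfun, m != 0 ->
    (forall k, lambda k = m -> eigenfunction A m (g k)) /\
    (forall N (k : 'I_N -> nat) (c : 'I_N -> R[i]), injective k ->
      (forall i, c i != 0 -> lambda (k i) = m) ->
      ae_equal (fun x => \sum_i c i * g (k i) x) (fun=> 0) -> forall i, c i = 0).
  have [->|m0] := eqVneq m 0; first by exists (fun _ _ => 0).
  have [n [b [be bfree _]] /card_set_bijP[f [fimg finj _]]] := Hmult m m0.
  exists (fun k => oapp b (fun=> 0) (insub (f k))) => _; split.
    move=> k km; have fk : (f k < n)%N by exact: (fimg k km).
    rewrite insubT /=; exact: be.
  move=> N k c kinj ck.
  (* The same combination in the basis b. Since f and k are injective, each of these sums has at
     most one nonzero term, so c' = 0 gives c = 0. *)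
  pose c' (j : 'I_n) := \sum_(i < N | f (k i) == j :> nat) c i.
  have E : (fun x => \sum_i c i * oapp b (fun=> 0) (insub (f (k i))) x) =
      (fun x => \sum_j c' j * b j x).
    apply/funext => x; rewrite /c'.
    under [RHS]eq_bigr do rewrite mulr_suml.
    rewrite (exchange_big_dep xpredT)//=; apply: eq_bigr => i _.
    have [->|ci] := eqVneq (c i) 0.
      by rewrite mul0r big1// => j _; rewrite mul0r.
    have fk : (f (k i) < n)%N by exact: (fimg _ (ck i ci)).
    rewrite insubT /= (bigD1 (Ordinal fk))//= big1 ?addr0// => j /andP[/eqP fj ij].
    by case/negP: ij; apply/eqP/val_inj; rewrite /= -fj.
  rewrite E => /bfree c'0 i; apply/eqP; apply: contraT => ci.
  have fk : (f (k i) < n)%N by exact: (fimg _ (ck i ci)).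
  move: (c'0 (Ordinal fk)); rewrite /c' (bigD1 i)//= big1 ?addr0 => [h|j /andP[/eqP fj ij]].
    by rewrite h eqxx in ci.
  apply/eqP; apply: contraT => cj; case/negP: ij; apply/eqP/kinj.
  by apply: finj fj; rewrite inE; exact: ck.
have [G HG] := choice Hm.
exists (fun k => G (lambda k) k); split.
  by move=> k k0; exact: (HG _ k0).1.
move=> m N k c m0 kinj ck H; apply: ((HG m m0).2 N k c kinj ck).
rewrite (_ : (fun x => _) = (fun x => \sum_i c i * G (lambda (k i)) (k i) x))//.
apply/funext => x; apply: eq_bigr => i _.
have [->|ci] := eqVneq (c i) 0; first by rewrite !mul0r.
by rewrite (ck i ci).
Qed.

Section families.
Context (E S : set T) (mE : measurable E) (rE : rint mu (\1_E : T -> R))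
  (mS : measurable S) (lambda : nat -> R).
Hypothesis hl : eigenvalue_sequence (space_band_limit E S) lambda.

(** The last clause is linear independence across different eigenvalues, obtained from independence
    within each eigenspace and orthogonality between them. *)
Lemma eigenfamily_exists N (k : 'I_N -> nat) : injective k ->
  (forall i, lambda (k i) != 0) ->
  exists h u : 'I_N -> cfun,
  [/\ (forall i, cLfun 1%:E (h i)) /\ (forall i, cLfun 2%:E (h i)),
      forall i, space_limit E (h i) = h i,
      forall i, is_fourier (u i) (space_limit S (fourierL1 (h i))),
      forall i, ae_equal (space_limit E (u i)) (fun x => (lambda (k i))%:C * h i x) &
      forall c : 'I_N -> R, ip (fun x => \sum_i (c i)%:C * h i x)
        (fun x => \sum_i (c i)%:C * h i x) = 0 -> forall i, c i = 0].
Proof.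
move=> kinj k0.
have [e [eig efree]] := eigenvalue_sequence_basis hl.
pose h i := space_limit E (e (k i)).
have le i : cLfun 2%:E (e (k i)) := (eig _ (k0 i)).1.
have h1 i : cLfun 1%:E (h i) by exact: space_limit_cL1.
have h2 i : cLfun 2%:E (h i) by exact: space_limit_cL2.
have [u Hu] := choice (fun i => eigenfunction_fourier mE rE mS (k0 i) (eig _ (k0 i))).
have hu i : is_fourier (u i) (space_limit S (fourierL1 (h i))) by case: (Hu i).
have hm i : ae_equal (space_limit E (u i)) (fun x => (lambda (k i))%:C * h i x).
  by case: (Hu i).
have hE i : space_limit E (h i) = h i by exact: space_limitK.
exists h, u; split => // c Hc i0; apply/eqP.
pose m := lambda (k i0).
(* The part of the combination that belongs to the eigenvalue of i0. By orthogonality its square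
   norm equals its pairing with the whole combination, which has norm 0. *)
pose c0 i : R := if lambda (k i) == m then c i else 0.
pose F (c : 'I_N -> R) x := \sum_i (c i)%:C * h i x.
have lF d : cLfun 2%:E (F d) by apply: cL2_sum => i; exact: cL2Z.
have orth := eigen_orthogonal mE h1 h2 hE hu hm.
have F0 : ip (F c0) (F c0) = 0.
  have E1 : ip (F c0) (F c0) = ip (F c0) (F c).
    rewrite /F ip_suml; last 2 first.
    - by move=> i; exact: cL2Z.
    - exact: lF.
    rewrite ip_suml; last 2 first.
    - by move=> i; exact: cL2Z.
    - exact: lF.
    apply: eq_bigr => i _; rewrite (ipZl (c0 i) (h2 i) (lF c0)) (ipZl (c0 i) (h2 i) (lF c)).
    rewrite /F ip_sumr; last 2 first.
    - by move=> j; exact: cL2Z.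
    - exact: h2.
    rewrite ip_sumr; last 2 first.
    - by move=> j; exact: cL2Z.
    - exact: h2.
    rewrite !mulr_sumr; apply: eq_bigr => j _.
    rewrite (ipZr (c0 j) (h2 j) (h2 i)) (ipZr (c j) (h2 j) (h2 i)).
    rewrite /c0; have [mi|_] := eqVneq (lambda (k i)) m; last by rewrite !mul0r.
    have [//|mj] := eqVneq (lambda (k j)) m.
    by rewrite (orth i j) ?mulr0// mi eq_sym.
  have := ip_cauchy (lF c0) (lF c).
  rewrite {2}/F [ip (F c) (F c)]Hc mulr0 -E1 => e0.
  by apply/eqP; rewrite -sqrf_eq0 eq_le e0 sqr_ge0.
have := efree m N k (fun i => (c0 i)%:C) (k0 i0) kinj.
have c0P i : (c0 i)%:C != 0 -> lambda (k i) = m.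
  rewrite fmorph_eq0 /c0; have [//|_] := eqVneq (lambda (k i)) m.
  by rewrite eqxx.
move=> /(_ c0P); have eh : ae_equal (fun x => \sum_i (c0 i)%:C * e (k i) x) (fun=> 0).
  have H (s : seq 'I_N) : ae_equal (fun x => \sum_(i <- s) (c0 i)%:C * e (k i) x)
      (fun x => \sum_(i <- s) (c0 i)%:C * h i x).
    elim: s => [|i s IH]; first by apply: aeW => x; rewrite !big_nil.
    have ei : ae_equal (e (k i)) (h i) by case: (Hu i).
    by apply: aeS2 IH ei => x e1 e2; rewrite !big_cons e1 e2.
  by apply: aeS2 (H (index_enum _)) (ip0_ae (lF c0) F0) => x ->.
move=> /(_ eh i0) /eqP; rewrite fmorph_eq0.
by rewrite /c0 eqxx.
Qed.

Lemma eigenvalue_sequence_01 k : 0 <= lambda k <= 1.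
Proof.
have [->|lk] := eqVneq (lambda k) 0; first by rewrite lexx ler01.
have inj : injective (fun _ : 'I_1 => k) by move=> i j _; rewrite !ord1.
have [h [u [[h1 h2] hE hu hm free]]] := eigenfamily_exists inj (fun=> lk).
apply: (eigenvalue_01 mE mS h1 h2 hE hu hm (i := ord0)).
apply/eqP => h0.
have := free (fun=> 1); rewrite (_ : (fun x => _) = h ord0) => [/(_ h0 ord0)/eqP|].
  by rewrite oner_eq0.
by apply/funext => x; rewrite big_ord1 rmorph1 mul1r.
Qed.

(** With more than 2 M eigenfunctions some nontrivial real combination f satisfies all moment
    conditions. Its energy outside [E] is then at least eps (1 - eps) |f|^2 and at most eta^2 |f|^2,
    hence f = 0, against independence. *)
Lemma eigenfamily_size (eps eta : R) M (L : 'I_M -> T -> R) N (k : 'I_N -> nat) :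
  0 < eps < 1 / 2 -> 0 <= eta -> eta ^+ 2 < eps * (1 - eps) ->
  (forall j, measurable_fun setT (L j) /\ exists B, forall x, `|L j x| <= B) ->
  (forall f, cLfun 1%:E f -> cLfun 2%:E f -> space_limit E f = f ->
    (forall j, \int[mu]_x (complex.Re (f x) * L j x) = 0 /\
               \int[mu]_x (complex.Im (f x) * L j x) = 0) ->
    forall v, cLfun 1%:E v -> cLfun 2%:E v -> (forall x, E x -> v x = 0) ->
    `|ip (space_limit S (fourierL1 f)) (fourierL1 v)| <=
      eta * Num.sqrt (ip f f) * Num.sqrt (ip v v)) ->
  injective k -> (forall i, eps < lambda (k i) < 1 - eps) -> (N <= M + M)%N.
Proof.
move=> /andP[e0 e2] eta0 eta_lt mL HL kinj kA.
have k0 i : lambda (k i) != 0.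
  by case/andP: (kA i) => h _; rewrite gt_eqF// (lt_trans e0).
have [h [u [[h1 h2] hE hu hm free]]] := eigenfamily_exists kinj k0.
rewrite leqNgt; apply/negP => NM.
pose J (p : (R[i] -> R)) j i := \int[mu]_x (p (h i x) * L j x).
(* Real and imaginary parts of the moments are separate real conditions, whence M + M columns; a
   nonzero row of [kermx A] gives the coefficients. *)
pose A : 'M[R]_(N, M + M) := row_mx (\matrix_(i, j) J (@complex.Re R) j i) (\matrix_(i, j) J (@complex.Im R) j i).
have kA0 : kermx A != 0.
  rewrite kermx_eq0 /row_free; apply/eqP => rA.
  by have := rank_leq_col A; rewrite rA leqNgt NM.
have [i0 ci0] : exists i0, row i0 (kermx A) != 0.
  apply/existsP; apply: contraNT kA0; rewrite negb_exists => /forallP H.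
  apply/eqP/row_matrixP => i; rewrite row0; apply/eqP.
  by move: (H i); rewrite negbK.
pose c i := row i0 (kermx A) 0 i.
have cA : row i0 (kermx A) *m A = 0 by rewrite -row_mul mulmx_ker row0.
have c_n0 : exists i, c i != 0.
  apply/existsP; apply: contraNT ci0; rewrite negb_exists => /forallP H.
  by apply/eqP/rowP => i; rewrite [RHS]mxE; apply/eqP; move: (H i); rewrite negbK.
pose f x := \sum_i (c i)%:C * h i x.
have f1 : cLfun 1%:E f by apply: cL1_sum => i; exact: cL1Z.
have f2 : cLfun 2%:E f by apply: cL2_sum => i; exact: cL2Z.
have fE : space_limit E f = f.
  apply/funext => x; rewrite /space_limit /f mulr_sumr; apply: eq_bigr => i _.
  by rewrite mulrCA -[in RHS](hE i).
have cB : forall j, \sum_i c i * J (@complex.Re R) j i = 0 /\ \sum_i c i * J (@complex.Im R) j i = 0.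
  move=> j; split.
  - have := congr1 (fun B : 'rV_(M + M) => B 0 (lshift M j)) cA.
    rewrite mxE [RHS]mxE => E0; rewrite -[RHS]E0; apply: eq_bigr => i _.
    by congr (_ * _); rewrite /A row_mxEl mxE.
  - have := congr1 (fun B : 'rV_(M + M) => B 0 (rshift M j)) cA.
    rewrite mxE [RHS]mxE => E0; rewrite -[RHS]E0; apply: eq_bigr => i _.
    by congr (_ * _); rewrite /A row_mxEr mxE.
have fL j : \int[mu]_x (complex.Re (f x) * L j x) = 0 /\
    \int[mu]_x (complex.Im (f x) * L j x) = 0.
  have [mLj BLj] := mL j; have [c1 c2] := cB j; split.
  - rewrite -[RHS]c1; have r i : rint mu (fun x => complex.Re (h i x) * L j x).
      by have /cL1P[r1 _] := h1 i; exact: (@rint_l2 _ _ _ mu (L j) _ r1 mLj BLj).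
    transitivity (\int[mu]_x \sum_i (c i * (complex.Re (h i x) * L j x))).
      apply: eq_Rintegral => x _; rewrite Re_sum mulr_suml.
      by apply: eq_bigr => i _; rewrite ReZ mulrA.
    rewrite rintegral_sum; last by move=> i; exact: rintZ.
    by apply: eq_bigr => i _; rewrite rintegralZ.
  - rewrite -[RHS]c2; have r i : rint mu (fun x => complex.Im (h i x) * L j x).
      by have /cL1P[_ r1] := h1 i; exact: (@rint_l2 _ _ _ mu (L j) _ r1 mLj BLj).
    transitivity (\int[mu]_x \sum_i (c i * (complex.Im (h i x) * L j x))).
      apply: eq_Rintegral => x _; rewrite Im_sum mulr_suml.
      by apply: eq_bigr => i _; rewrite ImZ mulrA.
    rewrite rintegral_sum; last by move=> i; exact: rintZ.
    by apply: eq_bigr => i _; rewrite rintegralZ.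
have HU := eigen_complement_bound mE mS h1 h2 hu eta0 (HL f f1 f2 fE fL).
have em i : eps * (1 - eps) <= lambda (k i) * (1 - lambda (k i)).
  by case/andP: (kA i) => a b; nra.
have LU := eigen_energy mE h1 h2 hE hu hm c em.
have f0 : ip f f = 0.
  apply/eqP; rewrite eq_le ip_ge0 andbT leNgt; apply/negP => fp.
  have := le_trans LU HU; rewrite leNgt => /negP; apply.
  by rewrite ltr_pM2r.
by case: c_n0 => i; rewrite (free c f0 i) eqxx.
Qed.

End families.
End eigenvalue_counting.

(** * Smoothed cutoffs *)

Section plane_measurability.
Context {R : realType}.
Local Notation T := (measurableTypeR R * measurableTypeR R)%type.
Local Notation leb := (@lebesgue_measure R).
Local Notation mu := (@leb2 R).

(** The sigma-algebra on T is the product one, so an open set is written as a countable union of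
    boxes with rational corners. *)
Lemma open_measurable2 (U : set (R * R)) : open U -> measurable (U : set T).
Proof.
move=> oU.
pose B (q : rat * rat * (rat * rat)) : set T :=
  box (ratr q.1.1) (ratr q.1.2) (ratr q.2.1) (ratr q.2.2).
pose D := [set q | B q `<=` U].
have -> : U = \bigcup_(q in D) B q.
  apply/seteqP; split => [[x y] Uxy|x [q Dq Bq]]; last exact: Dq.
  have [ [V1 V2] [/= n1 n2] V12] : nbhs (x, y) U by exact: open_nbhs_nbhs.
  have H (z : R) (V : set R) : nbhs z V -> exists p : rat * rat,
      `]ratr p.1, ratr p.2]%classic z /\ `]ratr p.1, ratr p.2]%classic `<=` V.
    move=> /nbhs_ballP[e /= e0 eV].
    have z1 : z - e < z by lra.
    have z2 : z < z + e by lra.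
    have [p] := rat_in_itvoo z1; rewrite in_itv/= => /andP[p1 p2].
    have [q] := rat_in_itvoo z2; rewrite in_itv/= => /andP[q1 q2].
    exists (p, q); split => [|t]; rewrite /= in_itv/=.
      by rewrite p2 (ltW q1).
    move=> /andP[t1 t2]; apply: eV; rewrite /ball/= ltr_norml.
    by apply/andP; split; lra.
  have [p [p1 p2]] := H _ _ n1; have [q [q1 q2]] := H _ _ n2.
  exists (p, q); last by split.
  by move=> [t u] [/= h1 h2]; apply: V12; split; [exact: p2|exact: q2].
rewrite bigcup_mkcond; apply: countable_bigcupT_measurable => [|q]; first exact: countableP.
by case: ifP => _; [exact: measurable_box|exact: measurable0].
Qed.

Lemma leb2_shift (a : R * R) (A : set T) : measurable A ->
  mu ((fun x => x + a) @^-1` A) = mu A.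
Proof.
move=> mA; apply/esym.
have ms : measurable_fun setT ((fun x => x + a) : T -> T).
  apply: measurable_fun_pair => /=.
    by apply: measurable_funD => //; exact: measurable_fst.
  by apply: measurable_funD => //; exact: measurable_snd.
pose nu := pushforward mu ((fun x => x + a) : T -> T).
change (mu A = nu A).
apply: (@product_measure_unique _ _ _ _ R leb leb nu) => // B C mB mC.
rewrite /nu /pushforward.
have mp (b : R) (D : set R) : measurable D -> measurable ((fun x => x + b) @^-1` D).
  move=> mD; rewrite -[_ @^-1` _]setTI.
  have : measurable_fun setT (fun x : R => x + b) by exact: measurable_funD.
  exact.
change (mu (((fun x : R => x + a.1) @^-1` B) `*` ((fun x : R => x + a.2) @^-1` C)) =
  (leb B * leb C)%E).
rewrite /leb2 product_measure1E; [|exact: mp|exact: mp].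
exact: (congr2 (fun x y : \bar R => x * y)%E
  (lebesgue_measure_shift a.1 mB) (lebesgue_measure_shift a.2 mC)).
Qed.

Lemma rintegral_shift2 (a : R * R) (g : R * R -> R) : rint mu g ->
  rint mu (fun x => g (x + a)) /\ \int[mu]_x g (x + a) = \int[mu]_x g x.
Proof.
move=> rg.
have mg := rint_measurable rg.
have ms (b : R * R) : measurable_fun setT ((fun x => x + b) : T -> T).
  apply: measurable_fun_pair => /=.
    by apply: measurable_funD => //; exact: measurable_fst.
  by apply: measurable_funD => //; exact: measurable_snd.
have [] := @rintegral_invariant _ T R mu (fun x => x - a) (fun x => g (x + a)).
- exact: ms.
- by move=> A mA; exact: (leb2_shift (- a)).
- exact: (measurableT_comp mg (ms a)).
- by apply: eq_rint rg => x /=; rewrite subrK.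
move=> r e; split => //; rewrite e; apply: eq_Rintegral => x _.
by rewrite subrK.
Qed.

End plane_measurability.

Section averaging.
Context {R : realType}.
Local Notation T := (measurableTypeR R * measurableTypeR R)%type.
Local Notation leb := (@lebesgue_measure R).
Local Notation mu := (@leb2 R).
Variables (h : R) (h0 : 0 < h).

Lemma rint_bounded_support (g : R * R -> R) (M b : R) :
  measurable_fun setT (g : T -> R) -> (forall x, `|g x| <= M) ->
  (forall x, g x != 0 -> `|x.1| <= b /\ `|x.2| <= b) -> rint mu g.
Proof.
move=> mg gM gb.
have rb := rintZ M (rint_box (- b - 1) b (- b - 1) b).
apply: (rint_le mg _ rb) => x.
have [->|/gb[x1 x2]] := eqVneq (g x) 0.
  by rewrite normr0 mulr_ge0// ?indicE// (le_trans _ (gM x)).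
rewrite indicE mem_set ?mulr1//.
move: x1 x2; rewrite !ler_norml => /andP[a1 a2] /andP[b1 b2].
by split; rewrite /= in_itv/= ?a2 ?b2 andbT; lra.
Qed.

Let u (t : R) : R := (2 * h)^-1 * \1_`[- h, h] t.

Let ru : rint leb u. Proof. exact: (rintZ _ (rint_itv (- h) h true false)). Qed.

Let u0 t : 0 <= u t.
Proof. by rewrite mulr_ge0// ?indicE// invr_ge0 mulr_ge0// ltW. Qed.

Let int_u : \int[leb]_t u t = 1.
Proof.
rewrite rintegralZ; last exact: (rint_itv (- h) h true false).
rewrite (rintegral_itv true false); last by rewrite ge0_cp ?ltW.
by field; rewrite gt_eqF.
Qed.

Let uN t : u (- t) = u t.
Proof.
rewrite /u !indicE; congr (_ * (nat_of_bool _)%:R).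
by apply/idP/idP; rewrite !inE/= !in_itv/= => /andP[? ?]; apply/andP; split; lra.
Qed.

Let u_out t (a b : R) : (`|t| <= h -> a = b) -> u t * a = u t * b.
Proof.
move=> ab; rewrite /u indicE; case: (boolP (t \in _)) => tI; last by rewrite !mulr0 !mul0r.
by congr (_ * _); apply: ab; rewrite ler_norml; move: tI; rewrite inE/= in_itv.
Qed.

Definition average (e : R * R) (m : R * R -> R) (xi : R * R) : R :=
  \int[leb]_t (u t * m (xi.1 + t * e.1, xi.2 + t * e.2)).

(** The transform of the uniform density on [-h, h]: sin (h d) / (h d) with d = [dot e z], and 1 at
    d = 0. It is at most 1 / 2 in absolute value once h |d| >= 2. *)
Definition average_factor (e z : R * R) : R := \int[leb]_t (u t * cos (t * dot e z)).

Let rk (k : R -> R) (M : R) : measurable_fun setT k -> (forall t, `|k t| <= M) ->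
  rint leb (fun t => u t * k t).
Proof. by move=> mk kM; apply: rint_l2 => //; exists M. Qed.

Let mtrl (tr : R -> R) (c : R) : trig tr -> measurable_fun setT (fun t : R => tr (t * c) : R).
Proof.
move=> [mt _]; apply: (measurableT_comp mt).
by apply: measurable_funM => //; exact: measurable_cst.
Qed.

Lemma average_factor_le1 e z : `|average_factor e z| <= 1.
Proof.
have tc := @trig_cos R.
rewrite (le_trans (rintegral_norm _))//; first exact: rk (mtrl _ tc) (fun t => tc.2 _).
rewrite -int_u; apply: rintegral_le => //.
  by apply: rint_norm; exact: rk (mtrl _ tc) (fun t => tc.2 _).
by move=> t; rewrite normrM (ger0_norm (u0 t)) ler_piMr// tc.2.
Qed.

Lemma average_factor_half e z : 2 <= h * `|dot e z| -> `|average_factor e z| <= 1 / 2.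
Proof.
set d := dot e z => hd.
have d0 : d != 0 by apply/eqP => d0; move: hd; rewrite d0 normr0 mulr0; lra.
have dF (t : R) : is_derive t 1 (fun t => d^-1 * sin (t * d)) (cos (t * d)).
  have -> : (fun t => d^-1 * sin (t * d)) = d^-1 \*: (sin \o (fun t : R => d *: t)).
    by apply/funext => v; rewrite /= /GRing.scale /= (mulrC v).
  apply: is_derive_eq.
  by rewrite /GRing.scale /= mulr1 mulrCA mulVf// mulr1 mulrC.
have cf : continuous (fun t : R => cos (t * d)).
  move=> t; apply: (@continuous_comp _ _ _ (fun t : R => t * d) cos).
    exact: mulrr_continuous.
  exact: continuous_cos.
have -> : average_factor e z = (h * d)^-1 * sin (h * d).
  rewrite /average_factor -/d.
  transitivity ((2 * h)^-1 * \int[leb]_(t in `[- h, h]) cos (t * d)).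
    rewrite [in RHS]Rintegral_mkcond -rintegralZ.
      apply: eq_Rintegral => t _.
      by rewrite /patch /u indicE; case: ifP => _; rewrite ?mulr1 ?mulr0 ?mul0r.
    have rp : rint leb (fun t => \1_`[- h, h] t * cos (t * d)).
      apply: (rint_l2 (rint_itv (- h) h true false) (mtrl d (@trig_cos R))).
      by exists 1 => t; exact: cos_max.
    by apply: eq_rint rp => t; rewrite /patch indicE; case: ifP => _; rewrite ?mul1r ?mul0r.
  rewrite /Rintegral (integral_ftc dF cf) ?gtrN//= mulNr sinN.
  by field; rewrite d0 gt_eqF.
rewrite normrM normfV normrM (gtr0_norm h0).
rewrite -[leRHS]mulr1 ler_pM//; first by rewrite invr_ge0; lra.
  by rewrite div1r lef_pV2// posrE; lra.
exact: sin_max.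
Qed.

Lemma measurable_average_factor e : measurable_fun setT (average_factor e : T -> R).
Proof.
have tc := @trig_cos R.
apply: (@measurable_kernel_integral _ _ (measurableTypeR R) T R leb u
  (fun p => cos (p.1 * dot e p.2)) 1) => //; last by move=> z; exact: tc.2.
apply: (measurableT_comp measurable_cos); apply: measurable_funM.
  exact: measurable_fst.
apply: measurable_funD; apply: measurable_funM; do ?exact: measurable_cst.
  by apply: (measurableT_comp measurable_fst); exact: measurable_snd.
by apply: (measurableT_comp measurable_snd); exact: measurable_snd.
Qed.

Section average_of.
Variables (e : R * R) (m : R * R -> R) (b : R).
Hypotheses (e1 : `|e.1| <= 1) (e2 : `|e.2| <= 1).
Hypotheses (mm : measurable_fun setT (m : T -> R)) (m01 : forall x, 0 <= m x <= 1).
Hypothesis mb : forall x, m x != 0 -> `|x.1| <= b /\ `|x.2| <= b.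

Let m1 x : `|m x| <= 1.
Proof. by have /andP[? ?] := m01 x; rewrite ger0_norm. Qed.

Let k (p : measurableTypeR R * T) : R := m (p.2.1 + p.1 * e.1, p.2.2 + p.1 * e.2).

Let mk : measurable_fun setT k.
Proof.
apply: (measurableT_comp mm); apply: measurable_fun_pair => /=;
  apply: measurable_funD.
- by apply: (measurableT_comp measurable_fst); exact: measurable_snd.
- by apply: measurable_funM; [exact: measurable_fst|exact: measurable_cst].
- by apply: (measurableT_comp measurable_snd); exact: measurable_snd.
- by apply: measurable_funM; [exact: measurable_fst|exact: measurable_cst].
Qed.

Let mk1 xi : measurable_fun setT (fun t : measurableTypeR R => k (t, xi)).
Proof. by apply: (measurableT_comp mk); exact: measurable_fun_pair. Qed.

Lemma measurable_average : measurable_fun setT (average e m : T -> R).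
Proof.
apply: (@measurable_kernel_integral _ _ (measurableTypeR R) T R leb u k 1) => //.
by move=> z; exact: m1.
Qed.

Lemma average_constant xi a :
  (forall t, `|t| <= h -> m (xi.1 + t * e.1, xi.2 + t * e.2) = a) ->
  average e m xi = a.
Proof.
move=> ma; transitivity (\int[leb]_t (a * u t)).
  by apply: eq_Rintegral => t _; rewrite [a * _]mulrC; apply: u_out; exact: ma.
by rewrite rintegralZ// int_u mulr1.
Qed.

Lemma average01 xi : 0 <= average e m xi <= 1.
Proof.
have H : rint leb (fun t => u t * k (t, xi)) by apply: (rk (mk1 xi)) => t; exact: m1.
apply/andP; split.
  by apply: rintegral_ge0 => t; rewrite mulr_ge0//; have /andP[] := m01 (xi.1 + t * e.1, xi.2 + t * e.2).
rewrite -int_u; apply: rintegral_le => // t.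
by rewrite ler_piMr//; have /andP[] := m01 (xi.1 + t * e.1, xi.2 + t * e.2).
Qed.

Let rm : rint mu m. Proof. exact: rint_bounded_support mm m1 mb. Qed.

Let average_swap tr z : trig tr ->
  trigt tr (average e m) z =
  \int[leb]_t (u t * \int[mu]_xi (m xi * tr (dot xi z - t * dot e z))).
Proof.
move=> ttr; rewrite /trigt.
(* Fubini needs an integrable weight in xi besides the bounded kernel. The indicator of a box that
   contains every translate of the support of m by at most h is inserted for this and changes
   nothing. *)
pose c := b + h.
pose w xi := \1_(box (- c - 1) c (- c - 1) c) xi * tr (dot xi z).
have wE xi t : `|t| <= h -> k (t, xi) * tr (dot xi z) = w xi * k (t, xi).
  move=> th; have [->|/mb/= [x1 x2]] := eqVneq (k (t, xi)) 0; first by rewrite mul0r mulr0.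
  rewrite /w indicE mem_set; first by rewrite mul1r mulrC.
  have t1 : `|t * e.1| <= h by rewrite normrM (le_trans _ th)// ler_piMr.
  have t2 : `|t * e.2| <= h by rewrite normrM (le_trans _ th)// ler_piMr.
  move: x1 x2 t1 t2; rewrite !ler_norml => /andP[? ?] /andP[? ?] /andP[? ?] /andP[? ?].
  by split; rewrite /= in_itv/= /c; apply/andP; split; lra.
have rw : rint mu w.
  by apply: (@rint_trig R tr _ z ttr); exact: rint_box.
transitivity (\int[mu]_xi (w xi * \int[leb]_t (u t * k (t, xi)))).
  apply: eq_Rintegral => xi _; rewrite /average mulrC -rintegralZ; last first.
    by apply: (rk (mk1 xi)) => t; exact: m1.
  rewrite -rintegralZ; last by apply: (rk (mk1 xi)) => t; exact: m1.
  apply: eq_Rintegral => t _; rewrite !(mulrCA _ (u t)); apply: u_out => th.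
  by rewrite mulrC wE.
rewrite -(@rintegral_swap _ _ (measurableTypeR R) T R leb mu u w k 1 ru rw mk); last first.
  by move=> ?; exact: m1.
apply: eq_Rintegral => t _; apply: u_out => th.
have rmt : rint mu (fun xi => m xi * tr (dot xi z - t * dot e z)).
  apply: (@rint_l2 _ _ _ mu) => //; last by exists 1 => x; exact: ttr.2.
  apply: (measurableT_comp ttr.1); apply: measurable_funB => //.
  apply: measurable_funD; apply: measurable_funM => //.
have [_ <-] := rintegral_shift2 (t * e.1, t * e.2) rmt.
apply: eq_Rintegral => xi _; rewrite -wE//; congr (m _ * tr _).
by rewrite /dot /=; ring.
Qed.

Let average_parity z (A B : R) :
  \int[leb]_t (u t * (cos (t * dot e z) * A + sin (t * dot e z) * B)) =
  average_factor e z * A.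
Proof.
set d := dot e z.
have rc : rint leb (fun t => u t * cos (t * d)).
  by apply: (rk (mtrl d (@trig_cos R))) => t; exact: cos_max.
have rs : rint leb (fun t => u t * sin (t * d)).
  by apply: (rk (mtrl d (@trig_sin R))) => t; exact: sin_max.
transitivity (\int[leb]_t (A * (u t * cos (t * d)) + B * (u t * sin (t * d)))).
  by apply: eq_Rintegral => t _; ring.
rewrite rintegralD; [|exact: rintZ|exact: rintZ].
rewrite !rintegralZ// (rintegral_odd rs) ?mulr0 ?addr0 1?mulrC// => t.
by rewrite uN mulNr sinN mulrN.
Qed.

Let rtrig tr z : trig tr -> rint mu (fun xi => m xi * tr (dot xi z)).
Proof. by move=> ttr; exact: rint_trig. Qed.

(** Averaging over translates of the symbol multiplies the kernel by the mean of the modulations exp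
    (i t d) over t in [-h, h]. The density is even, so the sine terms cancel and cosine and sine
    transforms pick up the same real factor. *)
Lemma trigt_average_cos z :
  trigt cos (average e m) z = average_factor e z * trigt cos m z.
Proof.
rewrite average_swap; last exact: trig_cos.
rewrite -(average_parity z _ (trigt sin m z)); apply: eq_Rintegral => t _.
rewrite /trigt -(rintegralZ _ (rtrig z (@trig_sin R))) -(rintegralZ _ (rtrig z (@trig_cos R))).
rewrite -rintegralD; first by congr (_ * _); apply: eq_Rintegral => x _; rewrite cosB/=; ring.
  exact: (rintZ _ (rtrig z (@trig_cos R))).
exact: (rintZ _ (rtrig z (@trig_sin R))).
Qed.

Lemma trigt_average_sin z :
  trigt sin (average e m) z = average_factor e z * trigt sin m z.
Proof.
rewrite average_swap; last exact: trig_sin.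
rewrite -(average_parity z _ (- trigt cos m z)); apply: eq_Rintegral => t _.
rewrite mulrN -mulNr.
rewrite /trigt -(rintegralZ _ (rtrig z (@trig_cos R))) -(rintegralZ _ (rtrig z (@trig_sin R))).
rewrite -rintegralD; first by congr (_ * _); apply: eq_Rintegral => x _; rewrite sinB; ring.
  exact: (rintZ _ (rtrig z (@trig_sin R))).
exact: (rintZ _ (rtrig z (@trig_cos R))).
Qed.

End average_of.
End averaging.

Section cutoff.
Context {R : realType}.
Local Notation T := (measurableTypeR R * measurableTypeR R)%type.
Local Notation leb := (@lebesgue_measure R).
Local Notation mu := (@leb2 R).
Variables (S : set (R * R)) (b : R).
Hypotheses (mS : measurable (S : set T)).
Hypothesis Sb : forall x, S x -> `|x.1| <= b /\ `|x.2| <= b.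
Variables (h : R) (h0 : 0 < h).

(** All that later steps use about the indicator of [S] averaged k1 times horizontally and k2 times
    vertically. Averaging does not alter m at the centre of a rectangle on which the indicator is
    constant, and psi is the product of the average factors. *)
Definition cutoff (k1 k2 : nat) (m psi : R * R -> R) : Prop :=
  [/\ measurable_fun setT (m : T -> R), forall x, 0 <= m x <= 1,
    forall x a, (forall y, `|y.1 - x.1| <= k1%:R * h -> `|y.2 - x.2| <= k2%:R * h ->
      \1_S y = a) -> m x = a &
    [/\ measurable_fun setT (psi : T -> R), forall z, `|psi z| <= 1,
      forall z, 2 <= h * `|z.1| -> `|psi z| <= (1 / 2) ^+ k1,
      forall z, 2 <= h * `|z.2| -> `|psi z| <= (1 / 2) ^+ k2 &
      forall z, trigt cos m z = psi z * trigt cos (\1_S) z /\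
                trigt sin m z = psi z * trigt sin (\1_S) z]].

Lemma cutoff_support k1 k2 m psi x : cutoff k1 k2 m psi -> m x != 0 ->
  `|x.1| <= b + (k1 + k2)%:R * h /\ `|x.2| <= b + (k1 + k2)%:R * h.
Proof.
have H (c1 c2 : R) (i j : nat) : `|c1 - c2| <= i%:R * h -> `|c1| <= b ->
    (i <= j)%N -> `|c2| <= b + j%:R * h.
  move=> c12 c1b; rewrite -(ler_nat R) => ij.
  have : i%:R * h <= j%:R * h by rewrite ler_pM2r.
  have := ler_normD c1 (c2 - c1); rewrite subrKC distrC; lra.
move=> [_ _ mc _]; apply: contraNP => nx; apply/eqP; apply: mc => y y1 y2.
rewrite indicE memNset// => /Sb[s1 s2]; apply: nx; split.
  by apply: H y1 s1 _; rewrite leq_addr.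
by apply: H y2 s2 _; rewrite leq_addl.
Qed.

Lemma cutoff0 : cutoff 0 0 (\1_S) (fun=> 1).
Proof.
split => [||x a|].
- exact: measurable_indic.
- by move=> x; rewrite indicE; case: (_ \in _); rewrite ?lexx ?ler01.
- by apply; rewrite subrr normr0 mul0r.
by split => [||||z]; rewrite ?mul1r ?normr1.
Qed.

Lemma cutoff_step (i : bool) k1 k2 m psi : cutoff k1 k2 m psi ->
  let e := (i%:R, (~~ i)%:R) in
  cutoff (k1 + i) (k2 + ~~ i) (average h e m) (fun z => average_factor h e z * psi z).
Proof.
move=> c e; have ms := fun x => cutoff_support (x := x) c.
have e1 : `|e.1| <= 1 by rewrite /e; case: (i); rewrite ?normr1 ?normr0.
have e2 : `|e.2| <= 1 by rewrite /e; case: (i); rewrite ?normr1 ?normr0.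
have [mm m01 mc [mp p1 pk1 pk2 pm]] := c.
split => [||x a xa|].
- exact: measurable_average.
- by move=> x; exact: average01.
- apply: average_constant => // t th; apply: mc => y /= y1 y2.
  have H (c1 c2 : R) (j : bool) k : `|c1 - (c2 + t * j%:R)| <= k%:R * h ->
      `|c1 - c2| <= (k + j)%:R * h.
    rewrite natrD => H1; have := ler_normD (c1 - (c2 + t * j%:R)) (t * j%:R).
    have : `|t * j%:R| <= j%:R * h.
      by rewrite normrM normr_nat mulrC ler_wpM2l.
    rewrite (_ : _ + t * j%:R = c1 - c2) ; [lra|ring].
  by apply: xa; [exact: H y1|exact: H y2].
have f1 := average_factor_le1 h0 e.
have mf : measurable_fun setT (average_factor h e : T -> R) := measurable_average_factor h e.
have fh z : 2 <= h * `|z.1| -> i -> `|average_factor h e z| <= 1 / 2.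
  move=> z1 i1; apply: average_factor_half => //.
  by rewrite /dot /e i1/= mul1r mul0r addr0.
have gh z : 2 <= h * `|z.2| -> ~~ i -> `|average_factor h e z| <= 1 / 2.
  move=> z1 i1; apply: average_factor_half => //.
  by rewrite /dot /e i1/= (negbTE i1) mul1r mul0r add0r.
split.
- exact: measurable_funM.
- by move=> z; rewrite normrM mulr_ile1//; exact: f1.
- move=> z hz; rewrite normrM exprD mulrC ler_pM// ?pk1//.
  by case: (i) (fh z hz) => [->|_]; rewrite ?expr1 ?expr0.
- move=> z hz; rewrite normrM exprD mulrC ler_pM// ?pk2//.
  by case: (i) (gh z hz) => [_|->]; rewrite ?expr1 ?expr0.
- move=> z; have [pc ps] := pm z.
  by rewrite -!mulrA -pc -ps; split; [exact: (trigt_average_cos h e1 e2 mm m01 ms)|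
    exact: (trigt_average_sin h e1 e2 mm m01 ms)].
Qed.

Lemma cutoff_exists (n : nat) : exists m psi, cutoff n n m psi.
Proof.
elim: n => [|n [m [psi c]]]; first by exists (\1_S), (fun=> 1); exact: cutoff0.
have := cutoff_step true c; rewrite /= addn1 addn0 => c1.
have := cutoff_step false c1; rewrite /= addn1 addn0 => c2.
by eexists; eexists; exact: c2.
Qed.

End cutoff.

(** * Smallness of the smoothed multiplier away from the diagonal *)

Section cutoff_pairing.
Local Open Scope complex_scope.
Context {R : realType}.
Local Notation cfun := (R * R -> R[i]).
Local Notation T := (measurableTypeR R * measurableTypeR R)%type.
Local Notation leb := (@lebesgue_measure R).
Local Notation mu := (@leb2 R).
Local Notation c0 := ((2 * pi)^-1 : R).
Local Notation re f := (fun x : R * R => complex.Re (f x)).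
Local Notation im f := (fun x : R * R => complex.Im (f x)).

Definition norm1 (f : cfun) : R := \int[mu]_x (`|complex.Re (f x)| + `|complex.Im (f x)|).

Lemma norm1_ge0 f : 0 <= norm1 f.
Proof. by apply: rintegral_ge0 => x; rewrite addr_ge0. Qed.

Lemma rint_norm1 f : cLfun 1%:E f ->
  rint mu (fun x => `|complex.Re (f x)| + `|complex.Im (f x)|).
Proof. by move=> /cL1P[f1 f2]; apply: rintD; exact: rint_norm. Qed.

Lemma ip_le_norm1 f g (B : R) : cLfun 1%:E f ->
  measurable_fun setT (re g : T -> R) -> measurable_fun setT (im g : T -> R) ->
  (forall x, f x != 0 -> `|complex.Re (g x)| <= B /\ `|complex.Im (g x)| <= B) ->
  `|ip f g| <= norm1 f * B.
Proof.
move=> lf mg1 mg2 gB; have /cL1P[f1 f2] := lf.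
have H x : `|complex.Re (f x) * complex.Re (g x) + complex.Im (f x) * complex.Im (g x)| <=
    B * (`|complex.Re (f x)| + `|complex.Im (f x)|).
  have [->|/gB[B1 B2]] := eqVneq (f x) 0; first by rewrite /= !mul0r !addr0 !normr0 addr0 mulr0.
  rewrite (le_trans (ler_normD _ _))// mulrDr !normrM.
  by rewrite lerD// mulrC ler_wpM2r.
have rB : rint mu (fun x => B * (`|complex.Re (f x)| + `|complex.Im (f x)|)).
  exact: (rintZ _ (rint_norm1 lf)).
have r : rint mu (fun x => complex.Re (f x) * complex.Re (g x) + complex.Im (f x) * complex.Im (g x)).
  apply: (@rint_le _ T R mu _ _ _ H rB); apply: measurable_funD; apply: measurable_funM => //.
    exact: rint_measurable f1.
  exact: rint_measurable f2.
rewrite /ip (le_trans (rintegral_norm r))// mulrC -rintegralZ; last exact: rint_norm1.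
by apply: rintegral_le => //; exact: rint_norm.
Qed.

Lemma measurable_fourierL1_adj g : cLfun 1%:E g ->
  measurable_fun setT (re (fourierL1_adj g) : T -> R) /\
  measurable_fun setT (im (fourierL1_adj g) : T -> R).
Proof.
move=> /cL1P[g1 g2]; have [tc ts] := (@trig_cos R, @trig_sin R).
split; apply: measurable_funM => //.
- by apply: measurable_funB; [exact: (measurable_trigt tc g1)|exact: (measurable_trigt ts g2)].
- by apply: measurable_funD; [exact: (measurable_trigt tc g2)|exact: (measurable_trigt ts g1)].
Qed.

Lemma cL1_mul_fourierL1 (m : R * R -> R) f : rint mu m -> cLfun 1%:E f ->
  cLfun 1%:E (fun xi => (m xi)%:C * fourierL1 f xi).
Proof.
move=> rm lf; have [m1 m2] := measurable_fourierL1 lf.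
pose B := c0 * \int[mu]_x (`|complex.Re (f x)| + `|complex.Im (f x)|).
apply/cL1P; split.
- have H : rint mu (fun xi => m xi * complex.Re (fourierL1 f xi)).
    by apply: rint_l2 => //; exists B => x; have [] := fourierL1_bound x lf.
  by apply: eq_rint H => x; rewrite (ReZ (m x)).
- have H : rint mu (fun xi => m xi * complex.Im (fourierL1 f xi)).
    by apply: rint_l2 => //; exists B => x; have [] := fourierL1_bound x lf.
  by apply: eq_rint H => x; rewrite (ImZ (m x)).
Qed.

Variables (S : set (R * R)).
Hypotheses (mS : measurable (S : set T)) (rS : rint mu (\1_S : T -> R)).

Local Notation area := (\int[mu]_x (\1_S x : R)).

(** The function 1_S(xi) (a - i b) exp (- i xi.x). Pairing with it evaluates a Re - b Im of an
    inverse transform at the point x, and for a^2 + b^2 = 1 its square norm is the area of [S]; so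
    Cauchy-Schwarz gives pointwise bounds. *)
Let wave (a b : R) (x xi : R * R) : R[i] :=
  (\1_S xi * (a * cos (dot xi x) - b * sin (dot xi x))) +i*
  (\1_S xi * (- (b * cos (dot xi x)) - a * sin (dot xi x))).

Let wave_cL2 a b x : a ^+ 2 + b ^+ 2 = 1 ->
  cLfun 2%:E (wave a b x) /\ ip (wave a b x) (wave a b x) = area.
Proof.
move=> ab; have [tc ts] := (@trig_cos R, @trig_sin R).
have mc : measurable_fun setT (fun xi : T => cos (dot xi x)) by exact: (@measurable_trig_dotl R _ x).
have ms : measurable_fun setT (fun xi : T => sin (dot xi x)) by exact: (@measurable_trig_dotl R _ x).
have mI := rint_measurable rS.
have L2 c d : c ^+ 2 + d ^+ 2 = 1 ->
    (fun xi : T => \1_S xi * (c * cos (dot xi x) - d * sin (dot xi x))) \in Lfun mu 2%:E.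
  move=> cd; have mcd : measurable_fun setT
      (fun xi : T => \1_S xi * (c * cos (dot xi x) - d * sin (dot xi x))).
    apply: measurable_funM => //; apply: measurable_funB; apply: measurable_funM => //.
  apply/l2P; split => //; apply: (@rint_le _ T R mu _ _ _ _ rS) => [|xi]; first exact: measurable_funX.
  rewrite exprMn indic_sqr normrM ger0_norm ?indicE// ler_piMr//.
  rewrite ger0_norm ?sqr_ge0//.
  have := cos2Dsin2 (dot xi x).
  set C := cos _; set D := sin _ => CD.
  have := sqr_ge0 (c * D + d * C).
  have : (c ^+ 2 + d ^+ 2) * (C ^+ 2 + D ^+ 2) = 1 by rewrite cd CD mulr1.
  nra.
split.
  split; first exact: L2.
  rewrite (_ : (fun _ => _) = fun xi => \1_S xi * ((- b) * cos (dot xi x) - a * sin (dot xi x))).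
    by apply: L2; rewrite sqrrN addrC.
  by apply/funext => xi /=; rewrite mulNr.
apply: eq_Rintegral => xi _ /=.
have CD := cos2Dsin2 (dot xi x); have I2 := indic_sqr S xi.
transitivity ((\1_S xi) ^+ 2 * ((a ^+ 2 + b ^+ 2) * (cos (dot xi x) ^+ 2 + sin (dot xi x) ^+ 2))); first ring.
by rewrite ab CD !mulr1 I2.
Qed.

Let ip_wave a b x f : cLfun 1%:E (fun xi => (\1_S xi)%:C * f xi) ->
  c0 * ip f (wave a b x) =
  a * complex.Re (fourierL1_adj (fun xi => (\1_S xi)%:C * f xi) x) -
  b * complex.Im (fourierL1_adj (fun xi => (\1_S xi)%:C * f xi) x).
Proof.
move=> /cL1P[f1 f2]; have [tc ts] := (@trig_cos R, @trig_sin R).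
have r1 : rint mu (fun xi => \1_S xi * complex.Re (f xi)).
  by apply: eq_rint f1 => y; rewrite ReZ.
have r2 : rint mu (fun xi => \1_S xi * complex.Im (f xi)).
  by apply: eq_rint f2 => y; rewrite ImZ.
have E1 tr : trigt tr (re (fun xi => (\1_S xi)%:C * f xi)) x =
    trigt tr (fun xi => \1_S xi * complex.Re (f xi)) x.
  by apply: eq_Rintegral => xi _; rewrite ReZ.
have E2 tr : trigt tr (im (fun xi => (\1_S xi)%:C * f xi)) x =
    trigt tr (fun xi => \1_S xi * complex.Im (f xi)) x.
  by apply: eq_Rintegral => xi _; rewrite ImZ.
rewrite /= !E1 !E2.
have [k1 k2] := (rint_trig x tc r1, rint_trig x ts r1).
have [k3 k4] := (rint_trig x tc r2, rint_trig x ts r2).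
rewrite mulrCA (mulrCA b) -mulrBr; congr (_ * _).
rewrite /trigt -rintegralB// -rintegralD// -!rintegralZ; [|exact: rintD|exact: rintB].
rewrite -rintegralB; [|exact: (rintZ _ (rintB k1 k4))|exact: (rintZ _ (rintD k3 k2))].
by apply: eq_Rintegral => xi _ /=; ring.
Qed.

Variables (n : nat) (h : R) (m psi : R * R -> R).
Hypotheses (cm : cutoff S h n n m psi) (rm : rint mu m).

(** The range where one of the two coordinates makes [psi (x - y)] at most 2^-n. *)
Definition far (x y : R * R) : Prop :=
  2 <= h * `|x.1 - y.1| \/ 2 <= h * `|x.2 - y.2|.

(** With x fixed, the factor psi (x - y) of the smoothed kernel is moved into the function: at x,
    the multiplier m acting on v agrees with the indicator of [S] acting on w, where |w| <= 2^-n
    |v|. The rough kernel of [S] then enters only through Plancherel and the area of [S]. *)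
Lemma cutoff_kernel_bound v x : cLfun 1%:E v -> cLfun 2%:E v ->
  (forall y, v y != 0 -> far x y) ->
  let g := fourierL1_adj (fun xi => (m xi)%:C * fourierL1 v xi) x in
  let B := c0 * Num.sqrt area * (1 / 2) ^+ n * Num.sqrt (ip v v) in
  `|complex.Re g| <= B /\ `|complex.Im g| <= B.
Proof.
move=> v1 v2 vfar; have [_ _ _ [mpsi psi1 p1 p2 pt]] := cm.
have mpx : measurable_fun setT (fun y : T => psi (x - y)).
  apply: (measurableT_comp mpsi); apply: measurable_fun_pair => /=;
  exact: measurable_funB.
pose w : cfun := fun y => (psi (x - y))%:C * v y.
have w1 : cLfun 1%:E w by apply: (@cL1M _ _ 1) => // y; exact: psi1.
have w2 : cLfun 2%:E w by apply: (@cL2M _ _ 1) => // y; exact: psi1.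
have -> : fourierL1_adj (fun xi => (m xi)%:C * fourierL1 v xi) x =
    fourierL1_adj (fun xi => (\1_S xi)%:C * fourierL1 w xi) x.
  rewrite (fourierL1_adjM x rm v1) (fourierL1_adjM x rS w1).
  have E1 : \int[mu]_y (complex.Re (v y) * trigt cos m (x - y) -
                         complex.Im (v y) * trigt sin m (x - y)) =
      \int[mu]_y (complex.Re (w y) * trigt cos (\1_S) (x - y) -
                   complex.Im (w y) * trigt sin (\1_S) (x - y)).
    by apply: eq_Rintegral => y _; rewrite (ReZ (psi (x - y))) (ImZ (psi (x - y)))
      (pt _).1 (pt _).2; ring.
  have E2 : \int[mu]_y (complex.Im (v y) * trigt cos m (x - y) +
                         complex.Re (v y) * trigt sin m (x - y)) =
      \int[mu]_y (complex.Im (w y) * trigt cos (\1_S) (x - y) +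
                   complex.Re (w y) * trigt sin (\1_S) (x - y)).
    by apply: eq_Rintegral => y _; rewrite (ReZ (psi (x - y))) (ImZ (psi (x - y)))
      (pt _).1 (pt _).2; ring.
  by rewrite E1 E2.
have [W2 We] := plancherel w1 w2.
have wv : Num.sqrt (ip w w) <= (1 / 2) ^+ n * Num.sqrt (ip v v).
  have q0 : 0 <= (1 / 2 : R) ^+ n by rewrite exprn_ge0// divr_ge0.
  rewrite -[leRHS]ger0_norm ?mulr_ge0 ?sqrtr_ge0// -sqrtr_sqr ler_wsqrtr//.
  rewrite exprMn sqr_sqrtr ?ip_ge0// /ip -rintegralZ; last exact: rint_ip.
  apply: rintegral_le => [||y]; [exact: rint_ip|exact: (rintZ _ (rint_ip v2 v2))|].
  rewrite /w ReZ ImZ.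
  have [->|/vfar yf] := eqVneq (v y) 0; first by rewrite /= !mulr0 !addr0 mulr0.
  have pn : psi (x - y) ^+ 2 <= ((1 / 2) ^+ n) ^+ 2.
    rewrite -[leLHS]real_normK ?num_real// lerXn2r// ?nnegrE//.
    by case: yf => [/(p1 (x - y))|/(p2 (x - y))].
  rewrite [leLHS](_ : _ = psi (x - y) ^+ 2 * (complex.Re (v y) ^+ 2 + complex.Im (v y) ^+ 2)).
    by rewrite -!expr2 ler_wpM2r// addr_ge0 ?sqr_ge0.
  by ring.
have lW := cL1_mul_fourierL1 rS w1.
have H a b : a ^+ 2 + b ^+ 2 = 1 ->
    `|a * complex.Re (fourierL1_adj (fun xi => (\1_S xi)%:C * fourierL1 w xi) x) -
      b * complex.Im (fourierL1_adj (fun xi => (\1_S xi)%:C * fourierL1 w xi) x)| <=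
    c0 * Num.sqrt area * (1 / 2) ^+ n * Num.sqrt (ip v v).
  move=> ab; have [l2 e2] := wave_cL2 x ab.
  rewrite -ip_wave// normrM (ger0_norm c0_ge0) -!mulrA ler_wpM2l ?c0_ge0//.
  have := ip_cauchy_sqrt W2 l2; rewrite e2 We => /le_trans; apply.
  by rewrite mulrC ler_wpM2l// sqrtr_ge0.
split.
  (* (a, b) = (1, 0) selects the real part and (0, -1) the imaginary part. *)
  by have := H 1 0; rewrite mul1r mul0r subr0; apply; rewrite expr1n expr0n addr0.
by have := H 0 (-1); rewrite mulN1r mul0r sub0r opprK; apply; rewrite sqrrN expr1n expr0n add0r.
Qed.

Lemma cutoff_pairing f v : cLfun 1%:E f -> cLfun 2%:E f -> cLfun 1%:E v -> cLfun 2%:E v ->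
  (forall x y, f x != 0 -> v y != 0 -> far x y) ->
  `|ip (fun xi => (m xi)%:C * fourierL1 f xi) (fourierL1 v)| <=
  norm1 f * (c0 * Num.sqrt area * (1 / 2) ^+ n * Num.sqrt (ip v v)).
Proof.
move=> f1 f2 v1 v2 fv; have lv := cL1_mul_fourierL1 rm v1.
have -> : ip (fun xi => (m xi)%:C * fourierL1 f xi) (fourierL1 v) =
    ip (fourierL1 f) (fun xi => (m xi)%:C * fourierL1 v xi).
  by apply: eq_Rintegral => xi _; rewrite !ReZ !ImZ; ring.
rewrite fourierL1_adjP//; have [g1 g2] := measurable_fourierL1_adj lv.
apply: ip_le_norm1 => // x fx; apply: cutoff_kernel_bound => // y; exact: fv.
Qed.

End cutoff_pairing.

(** * Vanishing moments *)

Section taylor.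
Context {R : realType}.

Lemma is_derive_exp_sum (a : nat -> R) (w t : R) (K : nat) :
  is_derive t 1 (fun t => \sum_(k < K.+1) a k * ((t * w) ^+ k / k`!%:R))
    (w * \sum_(k < K) a k.+1 * ((t * w) ^+ k / k`!%:R)).
Proof.
elim: K => [|K IH].
  rewrite (_ : (fun t => _) = cst (a 0%N)); last first.
    by apply/funext => s; rewrite big_ord1 expr0 fact0 divr1 mulr1.
  by rewrite big_ord0 mulr0; exact: is_derive_cst.
have -> : (fun t => \sum_(k < K.+2) a k * ((t * w) ^+ k / k`!%:R)) =
    (fun t => \sum_(k < K.+1) a k * ((t * w) ^+ k / k`!%:R)) +
    (a K.+1 / (K.+1)`!%:R) \*: ((fun t : R => w *: t) ^+ K.+1).
  apply/funext => s; rewrite big_ord_recr/=; congr (_ + _).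
  by rewrite /= /GRing.scale /= fctE (mulrC w) mulrA mulrAC.
apply: is_derive_eq; rewrite big_ord_recr /= mulrDr; congr (_ + _).
rewrite /GRing.scale /= mulr1 (mulrC w t) factS natrM.
have f0 : (K`!)%:R != 0 :> R by rewrite pnatr_eq0 -lt0n fact_gt0.
have K0 : (K.+1)%:R != 0 :> R by rewrite pnatr_eq0.
move: (K`!%:R : R) (K.+1%:R : R) f0 K0 => p q p0 q0.
by field; rewrite p0 q0.
Qed.

(** Integration of the bound on the derivative, by monotonicity of A t^(K+1) / (K+1)! minus f, and
    likewise for -f. *)
Lemma derive_bound_power (f df : R -> R) (A : R) (K : nat) :
  (forall t : R, is_derive t 1 f (df t)) -> f 0 = 0 ->
  (forall t, 0 <= t -> `|df t| <= A * (t ^+ K / K`!%:R)) ->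
  forall t, 0 <= t -> `|f t| <= A * (t ^+ K.+1 / (K.+1)`!%:R).
Proof.
have H (g dg : R -> R) (t : R) : (forall t : R, is_derive t 1 g (dg t)) -> g 0 = 0 ->
    (forall t, 0 <= t -> dg t <= A * (t ^+ K / K`!%:R)) -> 0 <= t ->
    g t <= A * (t ^+ K.+1 / (K.+1)`!%:R).
  move=> dG g0 gA t0.
  pose G := (A / (K.+1)`!%:R) \*: ((fun t : R => t) ^+ K.+1) - g.
  have dG1 (s : R) : is_derive s 1 G (A * (s ^+ K / K`!%:R) - dg s).
    apply: is_derive_eq; congr (_ - _); rewrite /GRing.scale /= mulr1 factS natrM.
    have f0 : (K`!)%:R != 0 :> R by rewrite pnatr_eq0 -lt0n fact_gt0.
    have K0 : (K.+1)%:R != 0 :> R by rewrite pnatr_eq0.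
    move: (K`!%:R : R) (K.+1%:R : R) f0 K0 => p q p0 q0.
    by field; rewrite p0 q0.
  have : G 0 <= G t.
    apply: (@ger0_derive1_ndecr R G 0 t _ _ _ 0 t (lexx 0) t0 (lexx t)) => [s _|s|].
    - by have [] := dG1 s.
    - rewrite in_itv/= => /andP[s0 _]; rewrite derive1E.
      by have [_ ->] := dG1 s; rewrite subr_ge0 gA// ltW.
    - by apply: continuous_subspaceT; exact: is_derive_continuous dG1.
  rewrite /G !fctE /= /GRing.scale /= g0 expr0n/= mulr0 subr0 subr_ge0.
  by rewrite mulrAC mulrA.
move=> df' f0 dfA t t0; rewrite ler_norml lerNl; apply/andP; split.
  have d1 (s : R) : is_derive s 1 (- f) ((- df) s) by exact: is_deriveN.
  have d2 : (- f) 0 = 0 by change (- f 0 = 0); rewrite f0 oppr0.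
  apply: (H (- f) (- df) t d1 d2 _ t0) => s s0.
  by change (- df s <= A * (s ^+ K / K`!%:R)); rewrite (le_trans _ (dfA s s0))// -normrN ler_norm.
by apply: (H f df t _ f0 _ t0) => // s s0; rewrite (le_trans (ler_norm _))// dfA.
Qed.

Let cos_coef (c : R) (k : nat) := cos (c + k%:R * (pi / 2)).

Lemma cos_taylor_scaled (K : nat) (c w t : R) : 0 <= t ->
  `|cos (c + t * w) - \sum_(k < K) cos_coef c k * ((t * w) ^+ k / k`!%:R)| <=
  `|w| ^+ K * (t ^+ K / K`!%:R).
Proof.
elim: K c t => [|K IH] c t t0.
  by rewrite big_ord0 subr0 fact0 !expr0 divr1 mulr1 cos_max.
pose f t := cos (c + t * w) - \sum_(k < K.+1) cos_coef c k * ((t * w) ^+ k / k`!%:R).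
pose df t := w * (cos (c + pi / 2 + t * w) -
  \sum_(k < K) cos_coef (c + pi / 2) k * ((t * w) ^+ k / k`!%:R)).
apply: (@derive_bound_power f df) => // [s||s s0].
- have H := is_derive_exp_sum (cos_coef c) w s K.
  have dg : is_derive s 1 (fun t : R => c + t * w) w.
    rewrite (_ : (fun t => _) = cst c + w \*: (fun t : R => t)).
      by apply: is_derive_eq; rewrite add0r /GRing.scale /= mulr1.
    by apply/funext => v; rewrite fctE /= /GRing.scale /= (mulrC w).
  have dc : is_derive s 1 (fun t => cos (c + t * w)) (- sin (c + s * w) * w).
    exact: (is_derive1_comp (is_derive_cos _) dg).
  have -> : df s = - sin (c + s * w) * w -
      w * \sum_(k < K) cos_coef c k.+1 * ((s * w) ^+ k / k`!%:R).
    rewrite /df mulrBr; congr (_ - w * _).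
      by rewrite mulrC addrAC cosD cos_pihalf sin_pihalf mulr0 mulr1 sub0r.
    apply: eq_bigr => k _; rewrite /cos_coef; congr (cos _ * _).
    by rewrite -natr1; ring.
  exact: (is_deriveB dc H).
- rewrite /f mul0r addr0 big_ord_recl big1 ?addr0.
    by rewrite /cos_coef /= mul0r addr0 expr0 fact0 divr1 mulr1 subrr.
  by move=> i _; rewrite expr0n mul0r mulr0.
- rewrite /df normrM exprS -mulrA ler_wpM2l//; exact: IH.
Qed.

Lemma cos_taylor (K : nat) (c w : R) :
  `|cos (c + w) - \sum_(k < K) cos (c + k%:R * (pi / 2)) * (w ^+ k / k`!%:R)| <=
  `|w| ^+ K / K`!%:R.
Proof.
have := cos_taylor_scaled K c w ler01.
by rewrite mul1r expr1n mul1r.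
Qed.

(** With exp 2 <= 2^c and K = n + c N + 1: (2 x)^K / K! <= exp (2 x) <= 2^(c N), and the factor 2^-K
    freed by the doubling leaves at most 2^-n. The degree K stays linear in n as long as N is. *)
Lemma factorial_decay : exists c : nat, forall (n N : nat) (x : R),
  0 <= x -> x <= N%:R ->
  x ^+ (n + c * N).+1 / ((n + c * N).+1)`!%:R <= (1 / 2) ^+ n.
Proof.
pose c := (Num.truncn (expR 2 : R)).+1.
have c2 : expR 2 <= 2 ^+ c :> R.
  rewrite (le_trans (ltW (truncnS_gt _)))//.
  by rewrite -natrX ler_nat ltnW// ltn_expl.
exists c => n N x x0 xN; set K := (n + c * N).+1.
have H : (2 * x) ^+ K / K`!%:R <= 2 ^+ (c * N).
  have := @expR_ge1Dxn R (2 * x) (n + c * N) (mulr_ge0 (ler0n _ 2) x0).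
  have : expR (2 * x) <= 2 ^+ (c * N).
    apply: (@le_trans _ _ (expR (2 * N%:R))); first by rewrite ler_expR ler_wpM2l.
    by rewrite expRM_natr exprM lerXn2r// nnegrE ?expR_ge0 ?exprn_ge0.
  move=> h1 h2; lra.
have -> : x ^+ K / K`!%:R = (1 / 2) ^+ K * ((2 * x) ^+ K / K`!%:R).
  by rewrite mulrA -exprMn; congr (_ ^+ _ / _); field.
apply: (@le_trans _ _ ((1 / 2) ^+ K * 2 ^+ (c * N))).
  by rewrite ler_wpM2l// exprn_ge0// divr_ge0.
have e : (1 / 2 : R) ^+ (c * N) * 2 ^+ (c * N) = 1.
  by rewrite -exprMn (_ : 1 / 2 * 2 = 1 :> R) ?expr1n//; field.
have q0 : 0 <= (1 / 2 : R) ^+ n by rewrite exprn_ge0// divr_ge0.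
rewrite /K exprS exprD -!mulrA e mulr1; lra.
Qed.

End taylor.

Section moments.
Context {R : realType}.
Local Notation T := (measurableTypeR R * measurableTypeR R)%type.
Local Notation mu := (@leb2 R).

Definition monomial (x0 : R * R) (i j : nat) (x : R * R) : R :=
  (x.1 - x0.1) ^+ i * (x.2 - x0.2) ^+ j.

(** Relative to the frequency q and the centre x0 the phase varies only by w x, the dot product of x
    - x0 and xi - q, which is at most 2 rho delta. The Taylor polynomial of the cosine in w is a
    combination of modulated monomials, all of which g annihilates, and the remainder is the stated
    bound. The extra phase phi makes one statement serve both cosine and sine transforms. *)
Lemma moments_bound (g : R * R -> R) (x0 q xi : R * R) (K : nat) (rho delta : R)
    (phi : R) : rint mu g ->
  (forall x, g x != 0 -> `|x.1 - x0.1| <= rho /\ `|x.2 - x0.2| <= rho) ->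
  `|xi.1 - q.1| <= delta -> `|xi.2 - q.2| <= delta ->
  (forall i j : nat, (i < K)%N -> (j < K)%N ->
     \int[mu]_x (g x * (cos (dot x q) * monomial x0 i j x)) = 0 /\
     \int[mu]_x (g x * (sin (dot x q) * monomial x0 i j x)) = 0) ->
  `|\int[mu]_x (g x * cos (dot x xi + phi))| <=
    (\int[mu]_x `|g x|) * ((2 * rho * delta) ^+ K / K`!%:R).
Proof.
move=> rg gs d1 d2 g0.
have [tc ts] := (@trig_cos R, @trig_sin R).
pose Z (P : R * R -> R) := rint mu (fun x => g x * P x) /\ \int[mu]_x (g x * P x) = 0.
have rintegral0_eq (P : R * R -> R) : (forall x, P x = 0) -> \int[mu]_x P x = 0.
  by move=> P0; rewrite /Rintegral integral0_eq// => x _; rewrite P0.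
have ZZ a P : Z P -> Z (fun x => a * P x).
  move=> [r e]; have E x : a * (g x * P x) = g x * (a * P x) by rewrite mulrCA.
  split; first by apply: eq_rint (rintZ a r).
  rewrite -[RHS](mulr0 a) -e -rintegralZ//; apply: eq_Rintegral => x _; exact/esym/E.
have ZD P Q : Z P -> Z Q -> Z (fun x => P x + Q x).
  move=> [r e] [r' e']; have E x : g x * P x + g x * Q x = g x * (P x + Q x) by rewrite mulrDr.
  split; first by apply: eq_rint (rintD r r').
  rewrite -[RHS]addr0 -{1}e -e' -rintegralD//; apply: eq_Rintegral => x _; exact/esym/E.
have Zsum n (P : 'I_n -> R * R -> R) : (forall i, Z (P i)) -> Z (fun x => \sum_(i < n) P i x).
  elim: n P => [|n IH] P ZP.
    split; first by apply: eq_rint (rint0 mu) => x; rewrite big_ord0 mulr0.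
    by apply: rintegral0_eq => x; rewrite big_ord0 mulr0.
  have -> : (fun x => \sum_(i < n.+1) P i x) =
      fun x => \sum_(i < n) P (widen_ord (leqnSn n) i) x + P ord_max x.
    by apply/funext => x; rewrite big_ord_recr.
  by apply: ZD; [exact: IH|exact: ZP].
(* The part of the phase that does not depend on x. *)
pose th := dot x0 (xi - q) + phi.
pose w x := (x.1 - x0.1) * (xi.1 - q.1) + (x.2 - x0.2) * (xi.2 - q.2).
have arg x : dot x xi + phi = dot x q + th + w x by rewrite /th /w /dot /=; ring.
pose Ta x := \sum_(k < K) cos (dot x q + th + k%:R * (pi / 2)) * (w x ^+ k / k`!%:R).
have Zm i j : (i < K)%N -> (j < K)%N -> forall c, Z (fun x => cos (dot x q + c) * monomial x0 i j x).
  move=> iK jK c; have [C0 S0] := g0 i j iK jK.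
  have rM tr : trig tr -> rint mu (fun x => g x * (tr (dot x q) * monomial x0 i j x)).
    move=> ttr; apply: (@rint_le _ T R mu _ (fun x => rho ^+ i * rho ^+ j * `|g x|)).
    - apply: measurable_funM; first exact: rint_measurable rg.
      apply: measurable_funM; first exact: measurable_trig_dotl.
      by apply: measurable_funM; apply: measurable_funX; exact: measurable_funB.
    - move=> x; have [->|/gs[x1 x2]] := eqVneq (g x) 0; first by rewrite mul0r normr0 mulr0.
      rewrite normrM mulrC ler_wpM2r// normrM -[leRHS]mul1r ler_pM//; first exact: ttr.2.
      by rewrite normrM !normrX ler_pM// lerXn2r// nnegrE (le_trans _ x1).
    - exact: (rintZ _ (rint_norm rg)).
  have Zc : Z (fun x => cos (dot x q) * monomial x0 i j x) by split; [exact: rM|].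
  have Zs : Z (fun x => sin (dot x q) * monomial x0 i j x) by split; [exact: rM|].
  have := ZD _ _ (ZZ (cos c) _ Zc) (ZZ (- sin c) _ Zs).
  by congr (Z _); apply/funext => x; rewrite cosD; ring.
have ZT : Z Ta.
  apply: (Zsum _) => k.
  have -> : (fun x => cos (dot x q + th + k%:R * (pi / 2)) * (w x ^+ k / k`!%:R)) =
      fun x => \sum_(i < k.+1) ((xi.1 - q.1) ^+ (k - i) * (xi.2 - q.2) ^+ i *
        ('C(k, i)%:R / k`!%:R)) *
        (cos (dot x q + (th + k%:R * (pi / 2))) * monomial x0 (k - i) i x).
    apply/funext => x; rewrite /w exprDn mulr_suml mulr_sumr; apply: eq_bigr => i _.
    rewrite -addrA /monomial !exprMn -mulr_natr; ring.
  apply: (Zsum _) => i; apply: (ZZ _ _); apply: (Zm _ _).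
    by rewrite (leq_ltn_trans (leq_subr _ _)).
  by rewrite (leq_ltn_trans _ (ltn_ord k))// -ltnS.
have [rT eT] := ZT.
have mw : measurable_fun setT (fun x : T => cos (dot x xi + phi)).
  apply: (measurableT_comp tc.1); apply: measurable_funD => //.
  apply: measurable_funD; apply: measurable_funM => //.
have rc : rint mu (fun x => g x * cos (dot x xi + phi)).
  by apply: rint_l2 => //; exists 1 => x; exact: tc.2.
rewrite -[X in `|X|]subr0 -eT -rintegralB//.
rewrite (le_trans (rintegral_norm _))//; first exact: rintB.
set B := _ / _; rewrite mulrC -rintegralZ; last exact: rint_norm.
apply: rintegral_le => [||x]; [by apply: rint_norm; exact: rintB|by apply: rintZ; exact: rint_norm|].
rewrite -mulrBr normrM mulrC.
have [->|/gs[x1 x2]] := eqVneq (g x) 0; first by rewrite normr0 !mulr0.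
rewrite ler_wpM2r// arg (le_trans (cos_taylor K _ _))// ler_wpM2r ?invr_ge0//.
rewrite lerXn2r ?nnegrE//.
  have r0 : 0 <= rho by rewrite (le_trans _ x1).
  by rewrite !mulr_ge0// (le_trans _ d1).
rewrite /w (le_trans (ler_normD _ _))// !normrM.
have := ler_pM (normr_ge0 _) (normr_ge0 _) x1 d1.
have := ler_pM (normr_ge0 _) (normr_ge0 _) x2 d2.
by move=> h1 h2; lra.
Qed.

End moments.

(** * Bounds that hold up to finite codimension *)

Section codimension.
Context {R : realType}.
Local Notation cfun := (R * R -> R[i]).
Local Notation T := (measurableTypeR R * measurableTypeR R)%type.
Local Notation mu := (@leb2 R).

(* Q holds on the common kernel of M bounded test functions, a space of real
   codimension at most 2 M *)
Definition codim_le (M : nat) (Q : cfun -> Prop) : Prop :=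
  exists L : 'I_M -> R * R -> R,
    (forall j, measurable_fun setT (L j : T -> R) /\
       exists B, forall x, `|L j x| <= B) /\
    forall f, (forall j, \int[mu]_x (complex.Re (f x) * L j x) = 0 /\
                         \int[mu]_x (complex.Im (f x) * L j x) = 0) -> Q f.

Lemma codim_le_sub M (Q Q' : cfun -> Prop) : (forall f, Q f -> Q' f) ->
  codim_le M Q -> codim_le M Q'.
Proof. by move=> QQ [L [mL LQ]]; exists L; split => // f /LQ /QQ. Qed.

Lemma codim_leD M M' (Q Q' : cfun -> Prop) : codim_le M Q -> codim_le M' Q' ->
  codim_le (M + M') (fun f => Q f /\ Q' f).
Proof.
move=> [L [mL LQ]] [L' [mL' LQ']].
exists (fun j => match fintype.split j with inl a => L a | inr a => L' a end); split.
  by move=> j; case: fintype.split => a; [exact: mL|exact: mL'].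
move=> f H; split; [apply: LQ => j|apply: LQ' => j].
  by have := H (lshift M' j); rewrite (unsplitK (inl j)).
by have := H (rshift M j); rewrite (unsplitK (inr j)).
Qed.

Lemma codim_le_seq (I : eqType) (s : seq I) (M : I -> nat) (Q : I -> cfun -> Prop) :
  (forall i, i \in s -> codim_le (M i) (Q i)) ->
  codim_le (\sum_(i <- s) M i) (fun f => forall i, i \in s -> Q i f).
Proof.
elim: s => [|a s IH] H.
  by rewrite big_nil; exists (fun _ _ => 0); split => [[]|].
rewrite big_cons; have Ha := H a (mem_head _ _).
have := codim_leD Ha (IH (fun i si => H i (mem_behead (s := a :: s) si))).
apply: codim_le_sub => f [Qa Qs] i; rewrite in_cons => /predU1P[->//|]; exact: Qs.
Qed.

Lemma codim_le_test (L : R * R -> R) (B : R) :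
  measurable_fun setT (L : T -> R) -> (forall x, `|L x| <= B) ->
  codim_le 1 (fun f => \int[mu]_x (complex.Re (f x) * L x) = 0 /\
                       \int[mu]_x (complex.Im (f x) * L x) = 0).
Proof.
move=> mL LB; exists (fun=> L); split; first by move=> _; split => //; exists B.
by move=> f; apply; exact: ord0.
Qed.

End codimension.

Section pieces.
Local Open Scope complex_scope.
Context {R : realType}.
Local Notation cfun := (R * R -> R[i]).
Local Notation T := (measurableTypeR R * measurableTypeR R)%type.
Local Notation leb := (@lebesgue_measure R).
Local Notation mu := (@leb2 R).
Local Notation c0 := ((2 * pi)^-1 : R).
Local Notation re f := (fun x : R * R => complex.Re (f x)).
Local Notation im f := (fun x : R * R => complex.Im (f x)).

Definition in_square (x0 : R * R) (rho : R) (x : R * R) : Prop :=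
  `|x.1 - x0.1| <= rho /\ `|x.2 - x0.2| <= rho.

Lemma norm1_space_limit (A : set T) f : measurable A -> cLfun 1%:E f ->
  cLfun 1%:E (space_limit A f) /\ norm1 (space_limit A f) <= norm1 f.
Proof.
move=> mA lf.
have lA : cLfun 1%:E (space_limit A f).
  by apply: (@cL1M _ (\1_A) 1) => // x; exact: indic_le1.
split => //; apply: rintegral_le; [exact: rint_norm1|exact: rint_norm1|].
move=> x; rewrite (ReZ (\1_A x)) (ImZ (\1_A x)) !normrM -mulrDr ler_piMl ?indic_le1// addr_ge0.
Qed.

(** For each frequency in qs there are K^2 monomials, each modulated by a cosine and a sine. The cut
    to [A] is built into the test functions, which makes them bounded and lets the conditions be put
    on f itself. The 2 in the bound comes from real and imaginary part of f. *)
Lemma codim_piece (A : set T) (x0 : R * R) (rho delta : R) (qs : seq (R * R)) (K : nat) :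
  measurable A -> 0 <= rho -> (forall x, A x -> in_square x0 rho x) ->
  codim_le (size qs * (K * (K * 2))) (fun f => cLfun 1%:E f ->
    forall xi q, q \in qs -> in_square q delta xi ->
    let B := c0 * (2 * norm1 f * ((2 * rho * delta) ^+ K / K`!%:R)) in
    `|complex.Re (fourierL1 (space_limit A f) xi)| <= B /\
    `|complex.Im (fourierL1 (space_limit A f) xi)| <= B).
Proof.
move=> mA r0 Ax0.
pose L (tr : R -> R) q i j (x : R * R) := \1_A x * (tr (dot x q) * monomial x0 i j x) : R.
have cL tr q i j : trig tr -> codim_le 1 (fun f =>
    \int[mu]_x (complex.Re (f x) * L tr q i j x) = 0 /\
    \int[mu]_x (complex.Im (f x) * L tr q i j x) = 0).
  move=> ttr; apply: (@codim_le_test _ _ (rho ^+ i * rho ^+ j)).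
    apply: measurable_funM; first exact: measurable_indic.
    apply: measurable_funM; first exact: measurable_trig_dotl.
    by apply: measurable_funM; apply: measurable_funX; exact: measurable_funB.
  move=> x; rewrite /L indicE; case: (boolP (x \in A)) => xA; last first.
    by rewrite mul0r normr0 mulr_ge0// exprn_ge0.
  have [x1 x2] := Ax0 x (set_mem xA).
  rewrite mul1r normrM -[leRHS]mul1r ler_pM//; first exact: ttr.2.
  by rewrite normrM !normrX ler_pM// lerXn2r.
have sumc (I : Type) (s : seq I) (c : nat) : (\sum_(i <- s) c = size s * c)%N.
  by rewrite big_const_seq count_predT iter_addn_0 mulnC.
have := codim_le_seq (s := qs) (fun q _ =>
  codim_le_seq (s := iota 0 K) (fun i _ =>
  codim_le_seq (s := iota 0 K) (fun j _ =>
    codim_leD (cL cos q i j (@trig_cos R)) (cL sin q i j (@trig_sin R))))).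
rewrite (eq_bigr (fun=> (K * (K * 2))%N)); last by move=> q _; rewrite !sumc size_iota.
rewrite sumc; apply: codim_le_sub => f Hf lf xi q qq [d1 d2] B.
have [lA NA] := norm1_space_limit mA lf.
have /cL1P[a1 a2] := lA.
have mom (u g : R * R -> R) phi : rint mu g -> (forall x, g x = \1_A x * u x) ->
    (forall i j, (i < K)%N -> (j < K)%N ->
       \int[mu]_x (u x * L cos q i j x) = 0 /\ \int[mu]_x (u x * L sin q i j x) = 0) ->
    `|\int[mu]_x (g x * cos (dot x xi + phi))| <=
      (\int[mu]_x `|g x|) * ((2 * rho * delta) ^+ K / K`!%:R).
  move=> rg gu H; apply: (moments_bound (x0 := x0) (q := q)) => //.
    move=> x; rewrite gu indicE; case: (boolP (x \in A)) => [/set_mem/Ax0//|_].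
    by rewrite mul0r eqxx.
  move=> i j iK jK; have [Hc Hs] := H i j iK jK; split.
    by rewrite -[RHS]Hc; apply: eq_Rintegral => x _; rewrite gu /L; ring.
  by rewrite -[RHS]Hs; apply: eq_Rintegral => x _; rewrite gu /L; ring.
have tr (u g : R * R -> R) : rint mu g -> (forall x, g x = \1_A x * u x) ->
    (\int[mu]_x `|g x| <= norm1 f) ->
    (forall i j, (i < K)%N -> (j < K)%N ->
       \int[mu]_x (u x * L cos q i j x) = 0 /\ \int[mu]_x (u x * L sin q i j x) = 0) ->
    `|trigt cos g xi| <= norm1 f * ((2 * rho * delta) ^+ K / K`!%:R) /\
    `|trigt sin g xi| <= norm1 f * ((2 * rho * delta) ^+ K / K`!%:R).
  move=> rg gu gN H.
  have e0 : 0 <= (2 * rho * delta) ^+ K / K`!%:R.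
    by rewrite divr_ge0// exprn_ge0// !mulr_ge0// (le_trans _ d1).
  split.
    apply: le_trans (ler_wpM2r e0 gN).
    have := mom u g 0 rg gu H; congr (`|_| <= _).
    by apply: eq_Rintegral => x _; rewrite addr0.
  apply: le_trans (ler_wpM2r e0 gN).
  (* The phase -pi / 2 turns the cosine into a sine. *)
  have := mom u g (- (pi / 2)) rg gu H; congr (`|_| <= _).
  apply: eq_Rintegral => x _; congr (_ * _).
  by rewrite cosB cos_pihalf sin_pihalf mulr0 add0r mulr1.
have mn (u : R * R -> R) : rint mu u -> (forall x, `|u x| <= `|complex.Re (space_limit A f x)| + `|complex.Im (space_limit A f x)|) ->
    \int[mu]_x `|u x| <= norm1 f.
  move=> ru uN; apply: le_trans NA; apply: rintegral_le => //; first exact: rint_norm.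
  exact: rint_norm1.
have io i : (i < K)%N -> i \in iota 0 K by rewrite mem_iota.
have [C1 S1] : `|trigt cos (re (space_limit A f)) xi| <= norm1 f * ((2 * rho * delta) ^+ K / K`!%:R) /\
    `|trigt sin (re (space_limit A f)) xi| <= norm1 f * ((2 * rho * delta) ^+ K / K`!%:R).
  apply: (tr (re f)) => //.
  - by move=> x; rewrite (ReZ (\1_A x)).
  - by apply: mn => // x; rewrite lerDl.
  - by move=> i j iK jK; have [[-> _] [-> _]] := Hf q qq i (io i iK) j (io j jK).
have [C2 S2] : `|trigt cos (im (space_limit A f)) xi| <= norm1 f * ((2 * rho * delta) ^+ K / K`!%:R) /\
    `|trigt sin (im (space_limit A f)) xi| <= norm1 f * ((2 * rho * delta) ^+ K / K`!%:R).
  apply: (tr (im f)) => //.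
  - by move=> x; rewrite (ImZ (\1_A x)).
  - by apply: mn => // x; rewrite lerDr.
  - by move=> i j iK jK; have [[_ ->] [_ ->]] := Hf q qq i (io i iK) j (io j jK).
rewrite Re_fourierL1// Im_fourierL1// !normrM (ger0_norm c0_ge0) /B.
split; rewrite ler_wpM2l ?c0_ge0//.
  by rewrite (le_trans (ler_normD _ _))//; lra.
by rewrite (le_trans (ler_normB _ _))//; lra.
Qed.

(** The indicator of [S] is m plus a function that vanishes wherever the transform of f is not known
    to be small. Since (1_S - m)^2 <= 1_S + m and m has no larger integral than 1_S, the second part
    has square norm at most (2 B2)^2 times the area. *)
Lemma pairing_split (S : set T) (m : R * R -> R) f v (B1 B2 : R) :
  measurable S -> rint mu (\1_S : T -> R) -> rint mu m -> (forall x, 0 <= m x <= 1) ->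
  \int[mu]_x m x <= \int[mu]_x \1_S x ->
  cLfun 1%:E f -> cLfun 2%:E f -> cLfun 1%:E v -> cLfun 2%:E v -> 0 <= B2 ->
  (forall xi, \1_S xi != m xi ->
     `|complex.Re (fourierL1 f xi)| <= B2 /\ `|complex.Im (fourierL1 f xi)| <= B2) ->
  `|ip (fun xi => (m xi)%:C * fourierL1 f xi) (fourierL1 v)| <=
     B1 * Num.sqrt (ip v v) ->
  `|ip (space_limit S (fourierL1 f)) (fourierL1 v)| <=
     (B1 + 2 * B2 * Num.sqrt (\int[mu]_x \1_S x)) * Num.sqrt (ip v v).
Proof.
move=> mS rS rm m01 mIS f1 f2 v1 v2 B20 fB mB.
have [F2 _] := plancherel f1 f2; have [V2 eV] := plancherel v1 v2.
have m1 x : `|m x| <= 1 by have /andP[? ?] := m01 x; rewrite ger0_norm.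
have mF2 : cLfun 2%:E (fun xi => (m xi)%:C * fourierL1 f xi).
  by apply: (@cL2M _ _ 1) => //; exact: rint_measurable rm.
have SF2 := space_limit_cL2 mS F2.
pose g := fun xi => space_limit S (fourierL1 f) xi - (m xi)%:C * fourierL1 f xi.
have g2 : cLfun 2%:E g by exact: cL2B.
have gB : ip g g <= (2 * B2) ^+ 2 * \int[mu]_x \1_S x.
  have r2 : rint mu (fun x => 2 * B2 ^+ 2 * (\1_S x + m x)).
    exact: (rintZ _ (rintD rS rm)).
  apply: (@le_trans _ _ (\int[mu]_x (2 * B2 ^+ 2 * (\1_S x + m x)))).
    apply: rintegral_le => // [|x]; first exact: rint_ip.
    have -> : complex.Re (g x) = (\1_S x - m x) * complex.Re (fourierL1 f x).
      by rewrite /g ReB (ReZ (\1_S x)) (ReZ (m x)) mulrBl.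
    have -> : complex.Im (g x) = (\1_S x - m x) * complex.Im (fourierL1 f x).
      by rewrite /g ImB (ImZ (\1_S x)) (ImZ (m x)) mulrBl.
    have /andP[h0 h1] := m01 x.
    have I01 : \1_S x = 0 :> R \/ \1_S x = 1 :> R.
      by rewrite indicE; case: (_ \in _); [right|left].
    have [<-|/fB[]] := eqVneq (\1_S x) (m x).
      by rewrite subrr !mul0r addr0 mulr_ge0// ?addr_ge0// ?mulr_ge0// ?sqr_ge0//; case: I01 => ->.
    rewrite !ler_norml; move: (complex.Re _) (complex.Im _) => p q /andP[p1 p2] /andP[q1 q2].
    have pp : p ^+ 2 <= B2 ^+ 2 by nra.
    have qq : q ^+ 2 <= B2 ^+ 2 by nra.
    have k1 : (\1_S x - m x) ^+ 2 <= \1_S x + m x by case: I01 => ->; nra.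
    have pq : p ^+ 2 + q ^+ 2 <= 2 * B2 ^+ 2 by lra.
    have pq0 : 0 <= p ^+ 2 + q ^+ 2 by rewrite addr_ge0 ?sqr_ge0.
    have := ler_pM (sqr_ge0 _) pq0 k1 pq; congr (_ <= _); ring.
  rewrite rintegralZ; last exact: rintD.
  rewrite rintegralD//; have := sqr_ge0 B2; nra.
have -> : ip (space_limit S (fourierL1 f)) (fourierL1 v) =
    ip (fun xi => (m xi)%:C * fourierL1 f xi) (fourierL1 v) + ip g (fourierL1 v).
  by rewrite (ipBl SF2 mF2 V2); ring.
rewrite (le_trans (ler_normD _ _))// mulrDl lerD//.
rewrite (le_trans (ip_cauchy_sqrt g2 V2))// eV ler_wpM2r ?sqrtr_ge0//.
have B2' : 0 <= 2 * B2 by rewrite mulr_ge0.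
by rewrite -[2 * B2]ger0_norm// -sqrtr_sqr -sqrtrM ?sqr_ge0// ler_wsqrtr.
Qed.

End pieces.

(** * Covers of the boundary and of the ellipse *)

Section plane_geometry.
Context {R : realType}.
Local Notation T := (measurableTypeR R * measurableTypeR R)%type.
Local Notation mu := (@leb2 R).

Definition norm2 (z : R * R) : R := Num.sqrt (dot z z).

Lemma dot_ge0 (z : R * R) : 0 <= dot z z.
Proof. by rewrite addr_ge0// -expr2 sqr_ge0. Qed.

Lemma norm2D (u v : R * R) : norm2 (u + v) <= norm2 u + norm2 v.
Proof.
have h : dot u v <= norm2 u * norm2 v.
  rewrite /norm2 -sqrtrM ?dot_ge0// (le_trans (ler_norm _))// -sqrtr_sqr ler_wsqrtr//.
  rewrite /dot; have := sqr_ge0 (u.1 * v.2 - u.2 * v.1); nra.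
rewrite -[leRHS]ger0_norm ?addr_ge0 ?sqrtr_ge0// -sqrtr_sqr ler_wsqrtr//.
rewrite sqrrD !sqr_sqrtr ?dot_ge0//.
have -> : dot (u + v) (u + v) = dot u u + dot u v *+ 2 + dot v v.
  by rewrite /dot /=; ring.
by rewrite lerD2r lerD2l lerMn2r orbC h.
Qed.

Lemma norm2_le (z : R * R) (a : R) : `|z.1| <= a -> `|z.2| <= a -> norm2 z <= 2 * a.
Proof.
move=> z1 z2; have a0 : 0 <= a by rewrite (le_trans _ z1).
rewrite -[leRHS]ger0_norm ?mulr_ge0// -sqrtr_sqr ler_wsqrtr//.
by move: z1 z2; rewrite /dot !ler_norml => /andP[? ?] /andP[? ?]; nra.
Qed.

Lemma norm2_ge (z : R * R) : `|z.1| <= norm2 z /\ `|z.2| <= norm2 z.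
Proof.
by split; rewrite -sqrtr_sqr ler_wsqrtr// /dot -!expr2; [rewrite lerDl|rewrite lerDr];
  rewrite sqr_ge0.
Qed.

Lemma nbhs_square (x : R * R) (e : R) (U : set (R * R)) : 0 < e ->
  (forall y, `|y.1 - x.1| < e -> `|y.2 - x.2| < e -> U y) -> nbhs x U.
Proof.
case: x => x1 x2 e0 H; exists (ball x1 e, ball x2 e) => /=.
  by split; exact: nbhsx_ballx.
by move=> [y1 y2] [/= h1 h2]; apply: H; rewrite /= distrC.
Qed.

Lemma measurable_dist_le (A : set (R * R)) (t : R) :
  measurable ([set x | (dist_set x A <= t%:E)%E] : set T).
Proof.
have -> : [set x | (dist_set x A <= t%:E)%E] = ~` [set x | (t%:E < dist_set x A)%E].
  by apply/seteqP; split => x /=; rewrite leNgt => /negP.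
apply: measurableC; apply: open_measurable2; rewrite openE => x /= tx.
have [s [ts sx]] : exists s : R, t < s /\ (s%:E <= dist_set x A)%E.
  move: tx; case: (dist_set x A) => [d| |//]; first by rewrite lte_fin; exists d.
  by exists (t + 1); rewrite ltrDl ltr01 leey.
(* In a square of half-side (s - t) / 4 the Euclidean distance to the centre is at most (s - t) / 2,
   so the distance to [A] stays above the midpoint of t and s. *)
apply: (@nbhs_square _ ((s - t) / 4)); first by rewrite divr_gt0// subr_gt0.
move=> y y1 y2 /=; apply: (@lt_le_trans _ _ ((s + t) / 2)%:E); first by rewrite lte_fin; lra.
apply: le_ereal_inf_tmp => _ [a Aa <-]; rewrite lee_fin.
have : s <= edist2 x a.
  by rewrite -lee_fin; apply: le_trans sx _; apply: ereal_inf_lbound; exists a.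
have -> : edist2 x a = norm2 ((x - y) + (y - a)) by rewrite addrA subrK.
have -> : edist2 y a = norm2 (y - a) by [].
have := norm2D (x - y) (y - a).
have := @norm2_le (x - y) ((s - t) / 4); rewrite /= distrC [ `|x.2 - _|]distrC.
by move=> /(_ (ltW y1) (ltW y2)); lra.
Qed.

(** The segment from y to z lies in the square. If it missed the boundary, its intersection with [S]
    would be open and closed in it, hence all of it. *)
Lemma boundary_between (S : set (R * R)) (x0 y z : R * R) (d : R) : open S ->
  in_square x0 d y -> in_square x0 d z -> S y -> (~ S z) ->
  exists2 p, boundary S p & in_square x0 d p.
Proof.
move=> oS [y1 y2] [z1 z2] Sy nSz; apply: contrapT => nb.
pose g (t : R) : R * R := (y.1 + t * (z.1 - y.1), y.2 + t * (z.2 - y.2)).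
have gsq t : 0 <= t <= 1 -> in_square x0 d (g t).
  move=> /andP[t0 t1]; move: y1 y2 z1 z2; rewrite !ler_norml.
  move=> /andP[? ?] /andP[? ?] /andP[? ?] /andP[? ?].
  by split; rewrite /g/= ler_norml; apply/andP; split; nra.
pose I := g @` `[0, 1].
have cI : connected I.
  apply: connected_continuous_connected; first exact: segment_connected.
  have ca (a b : R) : continuous (fun t : R => a + t * b).
    by move=> t; apply: (@cvgD R R^o); [exact: cvg_cst|exact: (@mulrr_continuous R)].
  by apply: continuous_subspaceT => t; exact: (cvg_pair (ca _ _ t) (ca _ _ t)).
have I0 : I (g 0) by exists 0 => //=; rewrite in_itv/= lexx ler01.
have I1 : I (g 1) by exists 1 => //=; rewrite in_itv/= lexx ler01.
have g0 : g 0 = y by rewrite /g !mul0r !addr0; case: (y).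
have g1 : g 1 = z by rewrite /g !mul1r !subrKC; case: (z).
have e : I `&` S = I.
  apply: cI.
  - by exists y; split => //; rewrite -g0.
  - by exists S.
  - exists (closure S); first exact: closed_closure.
    apply/seteqP; split => p [Ip Sp]; split => //; first exact: subset_closure.
    apply: contrapT => nSp; apply: nb; exists p.
      by split => // /interior_subset.
    by case: Ip => t; rewrite /= in_itv => /gsq + <-.
by apply: nSz; rewrite -g1; have [_] : (I `&` S) (g 1) by rewrite e.
Qed.

End plane_geometry.

Section boundary_cover.
Context {R : realType}.
Local Notation T := (measurableTypeR R * measurableTypeR R)%type.
Local Notation leb := (@lebesgue_measure R).
Local Notation mu := (@leb2 R).

Lemma bounded_set_square (S : set (R * R)) : bounded_set S ->
  exists2 b : R, 0 < b & forall x, S x -> in_square 0 b x.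
Proof.
move=> [M [_ HM]]; exists (Num.max 0 M + 1); first by rewrite ltr_pwDr// le_max lexx.
move=> x Sx; have : `|x| <= Num.max 0 M + 1.
  by apply: HM => //; rewrite ltr_pwDr// le_max lexx orbT.
by rewrite prod_normE /in_square /= !subr0 ge_max => /andP[].
Qed.

Lemma closure_square (S : set (R * R)) (b : R) : (forall x, S x -> in_square 0 b x) ->
  forall x, closure S x -> in_square 0 (b + 1) x.
Proof.
move=> Sb x /(_ [set y | `|y.1 - x.1| < 1 /\ `|y.2 - x.2| < 1])[].
  by apply: (@nbhs_square R x 1).
move=> y [/Sb[]] /=; rewrite !subr0 => s1 s2 [y1 y2].
have := ler_normB y.1 (y.1 - x.1); have := ler_normB y.2 (y.2 - x.2).
rewrite !subKr => h2 h1; split; rewrite /= subr0; lra.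
Qed.

Lemma grid_index (N : nat) (a d x : R) : a < x -> x <= a + N%:R * d ->
  exists2 i : 'I_N, a + i%:R * d < x & x <= a + i.+1%:R * d.
Proof.
elim: N => [|N IH] ax xN; first by move: ax; rewrite ltNge; rewrite mul0r addr0 in xN; rewrite xN.
have [xl|xg] := leP x (a + N%:R * d).
  by have [i i1 i2] := IH ax xl; exists (widen_ord (leqnSn N) i).
by exists ord_max.
Qed.

Lemma rintegral_square (a c d : R) : 0 <= d ->
  \int[mu]_x (\1_(box a (a + d) c (c + d)) x : R) = d ^+ 2.
Proof.
move=> d0.
have [_ e] := rint_prod (rint_itv a (a + d) false false) (rint_itv c (c + d) false false).
rewrite (rintegral_itv false false) ?lerDl// (rintegral_itv false false) ?lerDl// in e.
rewrite expr2 -[X in X * _](addrK a) -[X in _ * X](addrK c) (addrC d) (addrC d) -e.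
by apply: eq_Rintegral => x _; rewrite indic_box.
Qed.

Lemma maxe_linear_bound (H : \bar R) : (H < +oo)%E -> exists2 h : R, 0 <= h &
  forall t : R, 0 < t -> (maxe (t ^+ 2)%:E (t%:E * H) <= (t ^+ 2 + t * h)%:E)%E.
Proof.
case: H => [h| //|] _.
  exists `|h| => // t t0; rewrite -EFinM ge_max !lee_fin; apply/andP; split.
    by rewrite lerDl mulr_ge0// ltW.
  by rewrite ler_wpDl ?sqr_ge0//; exact: (ler_wpM2l (ltW t0) (ler_norm h)).
exists 0 => // t t0; rewrite mulr0 addr0 ge_max lexx/=.
by rewrite gt0_muleNy ?lte_fin// leNye.
Qed.

(* The cells of the grid of mesh d meeting the boundary are disjoint and lie
   within distance 2 d of it, so that their number is an area estimate. *)
Lemma boundary_cover (S : set (R * R)) : domain S -> well_shaped S ->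
  exists2 C : R, 0 < C & forall d : R, 0 < d ->
    exists qs : seq (R * R), (size qs)%:R <= C * (1 + d^-1) /\
      forall x y z, in_square x d y -> in_square x d z -> S y -> ~ S z ->
        exists2 q, q \in qs & in_square q (2 * d) x.
Proof.
move=> [Sbd oS _] [H1 [C0 C00 area]].
have [b b0 Sb] := bounded_set_square Sbd.
have [h h0 hH] := maxe_linear_bound H1.
(* The neighbourhood of width 2 d has area at most C0 (4 d^2 + 2 d h), each cell has area d^2, and
   the quotient is at most this constant times 1 + 1 / d. *)
exists (C0 * (4 + 2 * h)); first by rewrite mulr_gt0//; lra.
move=> d d0.
pose N := (Num.truncn (2 * (b + 1 + 1) / d)).+1.
pose a : R := - (b + 1 + 1).
pose cell (k : 'I_N * 'I_N) : set T :=
  box (a + k.1%:R * d) (a + k.1%:R * d + d) (a + k.2%:R * d) (a + k.2%:R * d + d).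
pose B := boundary S.
pose hit := [pred k : 'I_N * 'I_N | `[< exists2 p, B p & cell k p >] ].
pose corner (k : 'I_N * 'I_N) := (a + k.1%:R * d, a + k.2%:R * d).
pose W := [set x : T | (dist_set x B <= (2 * d)%:E)%E].
have mW : measurable W by exact: measurable_dist_le.
have d20 : 0 < 2 * d by rewrite mulr_gt0.
have Wle : (mu W <= (C0 * ((2 * d) ^+ 2 + 2 * d * h))%:E)%E.
  apply: (le_trans (area _ d20)); rewrite [leRHS]EFinM; apply: lee_wpmul2l.
    by rewrite lee_fin ltW.
  exact: hH.
have Wfin : (mu W < +oo)%E by rewrite (le_lt_trans Wle)// ltry.
have sizeE (i : nat) : a + i.+1%:R * d = a + i%:R * d + d by rewrite -natr1; ring.
have cellP k x : cell k x -> [/\ (corner k).1 < x.1, x.1 <= (corner k).1 + d,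
    (corner k).2 < x.2 & x.2 <= (corner k).2 + d].
  by move=> [/=]; rewrite !in_itv/= => /andP[? ?] /andP[? ?].
have cellW k x : hit k -> cell k x -> W x.
  move=> /asboolP[p Bp /cellP[p1 p2 p3 p4]] /cellP[x1 x2 x3 x4].
  apply: ge_ereal_inf; exists (edist2 x p)%:E; first by exists p.
  by rewrite lee_fin; apply: norm2_le => /=; rewrite ler_norml; apply/andP; split; lra.
have inj_lt (i j : nat) y : a + i%:R * d < y -> y <= a + j%:R * d + d -> (i <= j)%N.
  move=> h1 h2; rewrite -ltnS -(ltr_nat R) -(ltr_pM2r d0) -natr1.
  by rewrite mulrDl mul1r; lra.
have cell_inj k k' x : cell k x -> cell k' x -> k = k'.
  move: k k' => [i j] [i' j'] /cellP[/= p1 p2 p3 p4] /cellP[/= x1 x2 x3 x4].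
  congr pair; apply/val_inj/eqP; rewrite eqn_leq.
    by rewrite (inj_lt i i' _ p1 x2) (inj_lt i' i _ x1 p2).
  by rewrite (inj_lt j j' _ p3 x4) (inj_lt j' j _ x3 p4).
have card : #|hit|%:R * d ^+ 2 <= C0 * ((2 * d) ^+ 2 + 2 * d * h).
  have r1 k : rint mu (\1_(cell k) : T -> R) by exact: rint_box.
  have rW : rint mu (\1_W : T -> R) by exact: rint_indic.
  have -> : #|hit|%:R * d ^+ 2 = \int[mu]_x (\sum_(k <- enum hit) \1_(cell k) x : R).
    rewrite rintegral_sum// (eq_bigr (fun=> d ^+ 2)) => [|k _]; last first.
      by rewrite rintegral_square ?ltW.
    by rewrite big_const_seq count_predT -cardE iter_addr_0 mulr_natl.
  apply: (@le_trans _ _ (\int[mu]_x (\1_W x : R))).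
    apply: rintegral_le => // [|x]; first exact: rint_sum.
    rewrite big_enum/=; case: (pickP [pred k | hit k && (x \in cell k)]) => [k|no].
      move=> /andP[hk /set_mem ck]; rewrite (bigD1 k)//= big1 ?addr0 => [|k' /andP[_ kk']].
        by rewrite !indicE !mem_set//; exact: cellW hk ck.
      rewrite indicE memNset// => ck'; move/eqP: kk'; apply; exact: cell_inj ck' ck.
    rewrite big1 ?indicE// => k hk; rewrite indicE; have /= := no k.
    by move: hk; rewrite inE/= => hk; rewrite (asboolT hk)/= => ->.
  rewrite rintegral_indic// -lee_fin fineK// ge0_fin_numE//.
exists [seq corner k | k <- enum hit]; split.
  rewrite size_map -cardE.
  rewrite -(ler_pM2r (exprn_gt0 2 d0)) (le_trans card)//.
  have -> : C0 * (4 + 2 * h) * (1 + d^-1) * d ^+ 2 = C0 * (4 + 2 * h) * (d ^+ 2 + d).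
    by field; rewrite gt_eqF.
  rewrite -!mulrA ler_wpM2l ?ltW//.
  have h1 : 0 <= h * d ^+ 2 by rewrite mulr_ge0// sqr_ge0.
  have h2 : 0 <= h * d by rewrite mulr_ge0// ltW.
  by move: h1 h2; rewrite !expr2; nra.
(* The square around x contains a boundary point p. Both x and the corner of the cell of p are
   within d of p in each coordinate, which accounts for the 2 d. *)
move=> x y z xy xz Sy nSz; have [p Bp [xp1 xp2]] := boundary_between oS xy xz Sy nSz.
have [p1 p2] := closure_square Sb Bp.1.
have ap (c : R) : `|c - 0| <= b + 1 -> a < c /\ c <= a + N%:R * d.
  rewrite subr0 ler_norml => /andP[c1 c2]; split; first by rewrite /a; lra.
  have := truncnS_gt (2 * (b + 1 + 1) / d); rewrite -/N ltr_pdivrMr// /a; lra.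
have [i i1 i2] := grid_index (ap _ p1).1 (ap _ p1).2.
have [j j1 j2] := grid_index (ap _ p2).1 (ap _ p2).2.
have cp : cell (i, j) p by split; rewrite /= in_itv/= -sizeE; apply/andP.
exists (corner (i, j)).
  by apply: map_f; rewrite mem_enum; apply/asboolP; exists p.
have [/= q1 q2 q3 q4] := cellP _ _ cp.
move: xp1 xp2; rewrite !ler_norml => /andP[? ?] /andP[? ?].
by split; rewrite /corner/= ler_norml; apply/andP; split; lra.
Qed.

End boundary_cover.

(** * Leakage out of the ellipse from a single piece *)

Section leakage.
Local Open Scope complex_scope.
Context {R : realType}.
Local Notation cfun := (R * R -> R[i]).
Local Notation T := (measurableTypeR R * measurableTypeR R)%type.
Local Notation leb := (@lebesgue_measure R).
Local Notation mu := (@leb2 R).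
Local Notation c0 := ((2 * pi)^-1 : R).

(** The bound refers to [norm1 f] of the whole function and not of its piece on [A]: the constants
    eta then simply add up over disjoint pieces. *)
Definition leak (E S A : set (R * R)) (eta : R) (f : cfun) : Prop :=
  cLfun 1%:E f -> cLfun 2%:E f -> forall v, cLfun 1%:E v -> cLfun 2%:E v ->
  (forall x, E x -> v x = 0) ->
  `|ip (space_limit S (fourierL1 (space_limit A f))) (fourierL1 v)| <=
    eta * norm1 f * Num.sqrt (ip v v).

Lemma leak_le E S A (eta eta' : R) f : eta <= eta' -> leak E S A eta f -> leak E S A eta' f.
Proof.
move=> ee H l1 l2 v v1 v2 vE; apply: (le_trans (H l1 l2 v v1 v2 vE)).
by rewrite ler_wpM2r ?sqrtr_ge0// ler_wpM2r// norm1_ge0.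
Qed.

Variable S : set T.
Hypotheses (mS : measurable S) (rS : rint mu (\1_S : T -> R)).
Local Notation area := (\int[mu]_x (\1_S x : R)).

(** The error has two sources: B is what the smoothed multiplier m leaks, and the second term comes
    from the frequencies where m differs from the indicator of [S]. Squares around qs cover those
    frequencies, and vanishing moments control the transform there. *)
Lemma codim_leak (E A : set T) (m : R * R -> R) (x0 : R * R) (rho delta B : R)
    (qs : seq (R * R)) (K : nat) :
  measurable A -> 0 <= rho -> 0 <= delta -> (forall x, A x -> in_square x0 rho x) ->
  rint mu m -> (forall x, 0 <= m x <= 1) -> \int[mu]_x m x <= area ->
  (forall xi, \1_S xi != m xi -> exists2 q, q \in qs & in_square q delta xi) ->
  (forall f v, cLfun 1%:E f -> cLfun 2%:E f -> cLfun 1%:E v -> cLfun 2%:E v ->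
     (forall x, E x -> v x = 0) ->
     `|ip (fun xi => (m xi)%:C * fourierL1 (space_limit A f) xi) (fourierL1 v)| <=
       B * norm1 f * Num.sqrt (ip v v)) ->
  codim_le (size qs * (K * (K * 2)))
    (leak E S A (B + 4 * c0 * Num.sqrt area * ((2 * rho * delta) ^+ K / K`!%:R))).
Proof.
move=> mA r0 d0 Ax rm m01 mI mq HB.
apply: codim_le_sub (codim_piece delta qs K mA r0 Ax) => f Hf l1 l2 v v1 v2 vE.
have [a1 aN] := norm1_space_limit mA l1.
have a2 := space_limit_cL2 mA l2.
set e := _ ^+ K / _ in Hf *.
have e0 : 0 <= e by rewrite divr_ge0// exprn_ge0// !mulr_ge0.
have B20 : 0 <= c0 * (2 * norm1 f * e).
  by apply: mulr_ge0; [exact: c0_ge0|rewrite mulr_ge0// mulr_ge0// norm1_ge0].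
have H xi : \1_S xi != m xi ->
    `|complex.Re (fourierL1 (space_limit A f) xi)| <= c0 * (2 * norm1 f * e) /\
    `|complex.Im (fourierL1 (space_limit A f) xi)| <= c0 * (2 * norm1 f * e).
  by move=> /mq[q qq qx]; exact: (Hf l1 xi q qq qx).
have := pairing_split mS rS rm m01 mI a1 a2 v1 v2 B20 H (HB f v l1 l2 v1 v2 vE).
move=> /le_trans; apply; rewrite ler_wpM2r ?sqrtr_ge0// le_eqVlt; apply/orP; left.
by apply/eqP; move: (norm1 f) (Num.sqrt area) (c0 : R) => p q r; ring.
Qed.

Variable b : R.
Hypotheses (b0 : 0 < b) (Sb : forall x, S x -> in_square 0 b x).

Let c0area : 0 <= c0 * Num.sqrt area.
Proof. by apply: mulr_ge0; [exact: c0_ge0|exact: sqrtr_ge0]. Qed.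

Let combine (x q : R) : x <= q -> 0 <= q ->
  c0 * Num.sqrt area * q + 4 * c0 * Num.sqrt area * x <= 5 * c0 * Num.sqrt area * q.
Proof.
move=> xq q0; rewrite -(mulrA 4) -(mulrA 5).
by have := c0area; move: (c0 * Num.sqrt area) => P P0; nra.
Qed.

Let degree_bound (a c n : nat) : (0 < n)%N -> ((n + a * (c * n)).+1 <= (2 + a * c) * n)%N.
Proof. by rewrite mulnDl mulnA; move: (a * c * n)%N; lia. Qed.

(** For pieces that may touch the complement. Here m = 0, so that nothing is smoothed and all of [S]
    is error region; being bounded, [S] lies in the single square around frequency 0. The pieces
    have bounded size, hence O(n) derivatives suffice. *)
Lemma boundary_codim (rho0 : R) : 0 <= rho0 -> exists C : nat, forall (E A : set T) x0 n,
  measurable A -> (forall x, A x -> in_square x0 rho0 x) -> (0 < n)%N ->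
  exists2 M : nat, (M <= C * n ^ 2)%N &
    codim_le M (leak E S A (5 * c0 * Num.sqrt area * (1 / 2) ^+ n)).
Proof.
move=> r0; have [c decay] := @factorial_decay R.
pose c1 := (Num.truncn (2 * rho0 * b)).+1.
exists ((2 + c * c1) ^ 2 * 2)%N => E A x0 n mA Ax n0.
pose K := (n + c * (c1 * n)).+1.
exists (1 * (K * (K * 2)))%N.
  have KC := degree_bound c c1 n0 : (K <= (2 + c * c1) * n)%N.
  by rewrite mul1n; nia.
have m01 (x : R * R) : 0 <= (0 : R) <= 1 by rewrite lexx ler01.
have mI : \int[mu]_x (0 : R) <= area.
  by apply: rintegral_le => [||x]; [exact: rint0|exact: rS|rewrite indicE].
have mq xi : \1_S xi != (0 : R) -> exists2 q, q \in [:: (0 : R * R)] & in_square q b xi.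
  rewrite indicE; case: (boolP (xi \in S)) => [/set_mem/Sb xb|_]; last by rewrite eqxx.
  by exists 0 => //; rewrite mem_head.
have HB f v : cLfun 1%:E f -> cLfun 2%:E f -> cLfun 1%:E v -> cLfun 2%:E v ->
     (forall x, E x -> v x = 0) ->
     `|ip (fun xi => (0 : R)%:C * fourierL1 (space_limit A f) xi) (fourierL1 v)| <=
       0 * norm1 f * Num.sqrt (ip v v).
  move=> _ _ _ _ _; rewrite !mul0r (_ : ip _ _ = 0) ?normr0//.
  rewrite /ip /Rintegral integral0_eq// => x _; rewrite (ReZ (0 : R)) (ImZ (0 : R)).
  by rewrite !mul0r addr0.
apply: codim_le_sub (codim_leak K mA r0 (ltW b0) Ax (rint0 mu) m01 mI mq HB) => f.
apply: leak_le; rewrite add0r.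
have q0 : 0 <= (1 / 2 : R) ^+ n by rewrite exprn_ge0// divr_ge0.
have t0 : 0 <= 2 * rho0 * b by rewrite !mulr_ge0// ltW.
have tN : 2 * rho0 * b <= (c1 * n)%:R.
  by apply: (le_trans (ltW (truncnS_gt _))); rewrite -/c1 ler_nat; nia.
apply: le_trans (combine (decay n (c1 * n)%N _ t0 tN) q0).
by rewrite lerDr mulr_ge0.
Qed.

(** Averaging at half-width 2 / l makes [far] mean separation by l, and n averages reach as far as d
    = 2 n / l. The boundary cover at scale d uses O(1 + 1 / d) frequencies, hence O(1 + l), and each
    costs O(n^2) moments because size of piece times size of square is O(n), whatever l is. *)
Lemma interior_codim (c1 : R) : domain S -> well_shaped S -> 0 <= c1 ->
  exists C : R, forall (E A : set T) x0 (rho l : R) n,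
  measurable A -> (forall x, A x -> in_square x0 rho x) -> (0 < n)%N ->
  0 <= rho -> 0 < l -> rho <= c1 * l ->
  (forall x y, A x -> ~ E y -> l <= `|x.1 - y.1| \/ l <= `|x.2 - y.2|) ->
  exists2 M : nat, M%:R <= C * n%:R ^+ 2 * (1 + l) &
    codim_le M (leak E S A (5 * c0 * Num.sqrt area * (1 / 2) ^+ n)).
Proof.
move=> dS wS c10; have [c decay] := @factorial_decay R.
have [C C0 cover] := boundary_cover dS wS.
(* The Taylor variable is 2 rho (2 d) = 8 (rho / l) n, at most 8 c1 n. *)
pose c2 := (Num.truncn (8 * c1)).+1.
pose k := (2 + c * c2)%N.
exists (C * k%:R ^+ 2 * 2) => E A x0 rho l n mA Ax n0 rho0 l0 rl far_l.
have h0 : 0 < 2 / l by rewrite divr_gt0.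
have n1 : 1 <= n%:R :> R by rewrite ler1n.
pose d := n%:R * (2 / l).
have d0 : 0 < d by rewrite mulr_gt0// (lt_le_trans _ n1).
have [qs [sq qsP]] := cover d d0.
have Sb' x : S x -> `|x.1| <= b /\ `|x.2| <= b.
  by move=> /Sb[]; rewrite !subr0.
have [m [psi cm]] := cutoff_exists mS Sb' h0 n.
have [mm m01 mc [mp p1 _ _ pt]] := cm.
have m1 x : `|m x| <= 1 by have /andP[? ?] := m01 x; rewrite ger0_norm.
have rm : rint mu m.
  exact: (rint_bounded_support mm m1 (fun x => @cutoff_support _ _ _ Sb' _ h0 _ _ _ _ x cm)).
(* The multiplier relation at z = 0 compares total masses: the integral of m is psi 0 times the area
   of [S]. *)
have E0 g : trigt cos g 0 = \int[mu]_x g x.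
  by apply: eq_Rintegral => x _; rewrite /dot !mulr0 addr0 cos0 mulr1.
have mI : \int[mu]_x m x <= area.
  rewrite -!E0 (pt 0).1 ler_piMl//.
    by rewrite E0; apply: rintegral_ge0 => x; rewrite indicE.
  by rewrite (le_trans (ler_norm _)).
pose K := (n + c * (c2 * n)).+1.
exists (size qs * (K * (K * 2)))%N.
  have KC : K%:R <= k%:R * n%:R :> R by rewrite -natrM ler_nat; exact: degree_bound.
  have K0 : 0 <= K%:R :> R by [].
  have s0 : 0 <= (size qs)%:R :> R by [].
  have sl : (size qs)%:R <= C * (1 + l).
    rewrite (le_trans sq)//; apply: ler_wpM2l; [exact: ltW|rewrite lerD2l].
    rewrite /d invfM invf_div; apply: (@le_trans _ _ (l / 2)); last by lra.
    have l2 : 0 <= l / 2 by rewrite divr_ge0// ltW.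
    by rewrite ler_piMl// invf_le1// (lt_le_trans _ n1).
  rewrite !natrM; have kn0 : 0 <= k%:R * n%:R :> R by rewrite mulr_ge0.
  have K2 : K%:R * K%:R <= (k%:R * n%:R) * (k%:R * n%:R) :> R by rewrite ler_pM.
  have := ler_pM s0 (mulr_ge0 K0 K0) sl K2; lra.
have mq xi : \1_S xi != m xi -> exists2 q, q \in qs & in_square q (2 * d) xi.
  move=> Sm; apply: contrapT => nq; move/eqP: Sm; apply.
  have xx : in_square xi d xi by rewrite /in_square !subrr !normr0; split; exact: ltW.
  symmetry; apply: mc => y y1 y2.
  have yy : in_square xi d y by [].
  rewrite !indicE; case: (boolP (y \in S)) (boolP (xi \in S)).
    move=> /set_mem Sy [] // /negP nSx; exfalso; apply: nq.
    by apply: (qsP xi y xi) => // /mem_set.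
  move=> /negP nSy [/set_mem Sx|//]; exfalso; apply: nq.
  by apply: (qsP xi xi y) => // /mem_set.
have HB f v : cLfun 1%:E f -> cLfun 2%:E f -> cLfun 1%:E v -> cLfun 2%:E v ->
     (forall x, E x -> v x = 0) ->
     `|ip (fun xi => (m xi)%:C * fourierL1 (space_limit A f) xi) (fourierL1 v)| <=
       (c0 * Num.sqrt area * (1 / 2) ^+ n) * norm1 f * Num.sqrt (ip v v).
  move=> f1 f2 v1 v2 vE; have [a1 aN] := norm1_space_limit mA f1.
  have a2 := space_limit_cL2 mA f2.
  have fr x y : space_limit A f x != 0 -> v y != 0 -> far (2 / l) x y.
    move=> fx vy; have Ax' : A x.
      by apply: contrapT => nA; move/eqP: fx; apply; rewrite /space_limit indicE memNset// mul0r.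
    have nE : ~ E y by move=> /vE; exact/eqP.
    have H (z : R) : l <= z -> 2 <= 2 / l * z.
      by move=> lz; rewrite mulrAC ler_pdivlMr// ler_pM2l.
    by have [/H ?|/H ?] := far_l x y Ax' nE; [left|right].
  have P := cutoff_pairing rS cm rm a1 a2 v1 v2 fr; apply: (le_trans P).
  rewrite mulrA ler_wpM2r ?sqrtr_ge0// mulrC ler_wpM2l//.
  by apply: (mulr_ge0 c0area); rewrite exprn_ge0// divr_ge0.
apply: codim_le_sub (codim_leak K mA rho0 _ Ax rm m01 mI mq HB) => [f|]; last first.
  by rewrite mulr_ge0// ltW.
apply: leak_le.
have q0 : 0 <= (1 / 2 : R) ^+ n by rewrite exprn_ge0// divr_ge0.
have d0' := ltW d0; have t0 : 0 <= 2 * rho * (2 * d).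
  by apply: mulr_ge0; apply: mulr_ge0.
have tN : 2 * rho * (2 * d) <= (c2 * n)%:R.
  have -> : 2 * rho * (2 * d) = 8 * (rho / l) * n%:R by rewrite /d; ring.
  rewrite natrM ler_pM2r ?(lt_le_trans _ n1)// (le_trans _ (ltW (truncnS_gt _)))//.
  by rewrite ler_pM2l// ler_pdivrMr.
exact: (combine (decay n (c2 * n)%N _ t0 tN) q0).
Qed.

End leakage.

Section leak_cover.
Local Open Scope complex_scope.
Context {R : realType}.
Local Notation cfun := (R * R -> R[i]).
Local Notation T := (measurableTypeR R * measurableTypeR R)%type.
Local Notation mu := (@leb2 R).

Lemma codim_le_mono (M M' : nat) (Q : cfun -> Prop) : (M <= M')%N ->
  codim_le M Q -> codim_le M' Q.
Proof.
move=> MM cQ; have t : codim_le (M' - M) (fun _ : cfun => True).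
  by exists (fun _ _ => 0); split => // j; split; [exact: measurable_cst|exists 0 => x; rewrite normr0].
by have := codim_leD cQ t; rewrite subnKC//; apply: codim_le_sub => f [].
Qed.

Variables (E S : set T).
Hypothesis mS : measurable S.

Lemma leakU (A B : set T) (a b : R) f : measurable A -> measurable B -> A `&` B = set0 ->
  leak E S A a f -> leak E S B b f -> leak E S (A `|` B) (a + b) f.
Proof.
move=> mA mB AB lA lB l1 l2 v v1 v2 vE.
have [a1 _] := norm1_space_limit mA l1; have [b1 _] := norm1_space_limit mB l1.
have a2 := space_limit_cL2 mA l2; have b2 := space_limit_cL2 mB l2.
have [fa _] := plancherel a1 a2; have [fb _] := plancherel b1 b2.
have [V2 _] := plancherel v1 v2.
have sa := space_limit_cL2 mS fa; have sb := space_limit_cL2 mS fb.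
have e : space_limit (A `|` B) f = fun x => space_limit A f x + space_limit B f x.
  apply/funext => x; rewrite /space_limit -mulrDl; congr (_ * _).
  rewrite !indicE in_setU; case: (boolP (x \in A)) => xA; case: (boolP (x \in B)) => xB /=;
    rewrite ?addr0 ?add0r//.
  have : (A `&` B) x by split; exact: set_mem.
  by rewrite AB.
have -> : space_limit S (fourierL1 (space_limit (A `|` B) f)) =
    fun x => space_limit S (fourierL1 (space_limit A f)) x +
             space_limit S (fourierL1 (space_limit B f)) x.
  by apply/funext => x; rewrite e /space_limit (fourierL1D x a1 b1) mulrDr.
rewrite (ipDl sa sb V2) (le_trans (ler_normD _ _))// !mulrDl lerD//.
  exact: lA.
exact: lB.
Qed.

Lemma leak_set0 f : leak E S set0 0 f.
Proof.
move=> l1 l2 v v1 v2 vE; rewrite !mul0r (_ : ip _ _ = 0) ?normr0//.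
rewrite /ip /Rintegral integral0_eq// => x _.
have -> : fourierL1 (space_limit set0 f) = fun=> 0.
  apply/funext => xi; rewrite -[RHS](fourierL1_0 xi); congr (fourierL1 _ xi).
  by apply/funext => y; rewrite /space_limit indic0 mul0r.
by rewrite /space_limit mulr0 /= !mul0r addr0.
Qed.

(** The sets G i may overlap, whereas [leakU] wants disjoint pieces. Each G i is therefore cut out
    of what remains of [A], which is why the hypothesis speaks of all measurable subsets of G i. *)
Lemma codim_leak_cover (I : eqType) (s : seq I) (G : I -> set T) (M : I -> nat)
    (eta : I -> R) (A : set T) :
  measurable A -> (forall i, measurable (G i)) ->
  (forall i B, i \in s -> measurable B -> B `<=` G i -> B `<=` A ->
     codim_le (M i) (leak E S B (eta i))) ->
  (forall x, A x -> exists2 i, i \in s & G i x) ->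
  codim_le (\sum_(i <- s) M i) (leak E S A (\sum_(i <- s) eta i)).
Proof.
elim: s A => [|i s IH] A mA mG H cov.
  have -> : A = set0 by apply/seteqP; split => // x /cov[].
  rewrite !big_nil; exists (fun _ _ => 0); split; first by move=> [].
  by move=> f _; exact: leak_set0.
rewrite !big_cons.
have c1 : codim_le (M i) (leak E S (A `&` G i) (eta i)).
  by apply: H; [exact: mem_head|exact: measurableI|exact: subIsetr|exact: subIsetl].
have c2 : codim_le (\sum_(i <- s) M i) (leak E S (A `\` G i) (\sum_(i <- s) eta i)).
  apply: IH => [|//|j B js mB BG BA|x [Ax nGx]]; first exact: measurableD.
    by apply: H => //; [rewrite in_cons js orbT|exact: subset_trans BA (@subDsetl _ _ _)].
  by have [j] := cov x Ax; rewrite in_cons => /predU1P[->//|js Gj]; exists j.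
apply: codim_le_sub (codim_leD c1 c2) => f [l1 l2].
rewrite -(setUIDK A (G i)).
apply: leakU l1 l2; [exact: measurableI|exact: measurableD|].
by apply/seteqP; split => // x [[_ ?] [_]].
Qed.

End leak_cover.

Section circle_cover.
Context {R : realType}.

Lemma circle_gap (r w a b a' b' : R) : 0 < w -> w <= r ->
  (r - w) ^+ 2 <= a ^+ 2 + b ^+ 2 -> a ^+ 2 + b ^+ 2 <= r ^+ 2 ->
  (r - w) ^+ 2 <= a' ^+ 2 + b' ^+ 2 -> a' ^+ 2 + b' ^+ 2 <= r ^+ 2 ->
  a ^+ 2 <= b ^+ 2 -> a' ^+ 2 <= b' ^+ 2 -> 0 <= b -> 0 <= b' ->
  `|a - a'| <= w -> `|b - b'| <= 8 * w.
Proof.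
move=> w0 wr h1 h2 h3 h4 ab ab' b0 b0' aa.
have r0 : 0 < r by exact: lt_le_trans wr.
have bd (c d : R) : c ^+ 2 + d ^+ 2 <= r ^+ 2 -> `|c| <= r.
  move=> cd; rewrite -(@ler_pXn2r _ 2)// ?nnegrE ?(ltW r0)// real_normK ?num_real//.
  by have := sqr_ge0 d; lra.
have ar := bd _ _ h2; have ar' := bd _ _ h4.
have br : `|b| <= r by apply: (bd b a); rewrite addrC.
have br' : `|b'| <= r by apply: (bd b' a'); rewrite addrC.
have [w2|w2] := lerP w (r / 2); last first.
  by rewrite (le_trans (ler_normB _ _))//; lra.
have bl (c d : R) : (r - w) ^+ 2 <= c ^+ 2 + d ^+ 2 -> c ^+ 2 <= d ^+ 2 -> 0 <= d ->
    r / 4 <= d.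
  by move=> cd c2d d0; rewrite leNgt; apply/negP => dr; nra.
have b4 := bl _ _ h1 ab b0; have b4' := bl _ _ h3 ab' b0'.
have e : (b - b') * (b + b') = (a ^+ 2 + b ^+ 2) - (a' ^+ 2 + b' ^+ 2) - (a - a') * (a + a').
  by ring.
have h5 : `|(a - a') * (a + a')| <= w * (2 * r).
  rewrite normrM ler_pM//; rewrite (le_trans (ler_normD _ _))//; lra.
have h6 : `|(a ^+ 2 + b ^+ 2) - (a' ^+ 2 + b' ^+ 2)| <= 2 * r * w.
  rewrite ler_norml; apply/andP; split; nra.
have h7 : `|b - b'| * (b + b') <= 4 * r * w.
  rewrite -[X in _ * X <= _]ger0_norm ?addr_ge0// -normrM e.
  by rewrite (le_trans (ler_normB _ _))//; lra.
have h8 : `|b - b'| * (r / 2) <= `|b - b'| * (b + b') by rewrite ler_wpM2l//; lra.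
have r2 : 0 < r / 2 by rewrite divr_gt0.
by rewrite -(ler_pM2r r2) (le_trans h8)// (le_trans h7)//; lra.
Qed.

(** The annulus is cut by three choices: which coordinate is the smaller in absolute value, the sign
    of the other, and one of 4 2^j strips of width w for the smaller. By [circle_gap] each class has
    diameter O(w), and any member can be its centre; [xget] picks one, with 0 for an empty class. *)
Lemma circle_cover (r : R) (j : nat) : 0 < r ->
  let w := r * (1 / 2) ^+ j in
  exists2 ps : seq (R * R), size ps = (16 * 2 ^ j)%N &
    forall z, r - w <= norm2 z -> norm2 z <= r ->
      exists2 p, p \in ps & in_square p (8 * w) z.
Proof.
move=> r0 w; pose N := (4 * 2 ^ j)%N.
have p2 : (1 / 2 : R) ^+ j * 2 ^+ j = 1.
  by rewrite -exprMn (_ : 1 / 2 * 2 = 1 :> R) ?expr1n//; field.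
have w0 : 0 < w by rewrite mulr_gt0// exprn_gt0// divr_gt0.
have wr : w <= r.
  have h1 : (1 / 2 : R) ^+ j <= 1 by rewrite exprn_ile1//; lra.
  by rewrite /w ler_piMr// ltW.
pose co (s : bool) (z : R * R) := if s then z.1 else z.2.
pose rel (i : bool * bool * 'I_N) (z : R * R) :=
  [/\ r - w <= norm2 z, norm2 z <= r, co i.1.1 z ^+ 2 <= co (~~ i.1.1) z ^+ 2,
    0 <= (-1) ^+ i.1.2 * co (~~ i.1.1) z &
    - (2 * r) + i.2%:R * w < co i.1.1 z /\ co i.1.1 z <= - (2 * r) + i.2.+1%:R * w].
exists [seq xget (0 : R * R) (rel i) | i <- enum {: bool * bool * 'I_N}].
  rewrite size_map -cardE !card_prod card_bool card_ord /N; lia.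
move=> z z1 z2.
have [s zs] : exists s, co s z ^+ 2 <= co (~~ s) z ^+ 2.
  by have [h|h] := lerP (z.1 ^+ 2) (z.2 ^+ 2); [exists true|exists false; exact: ltW].
have [t zt] : exists t : bool, 0 <= (-1) ^+ t * co (~~ s) z.
  have [h|h] := lerP 0 (co (~~ s) z); first by exists false; rewrite expr0 mul1r.
  by exists true; rewrite expr1 mulN1r oppr_ge0 ltW.
have cn : `|co s z| <= norm2 z by have [n1 n2] := norm2_ge z; case: (s).
have [k k1 k2] : exists2 k : 'I_N, - (2 * r) + k%:R * w < co s z &
    co s z <= - (2 * r) + k.+1%:R * w.
  move: cn; rewrite ler_norml => /andP[c1 c2].
  apply: grid_index; first lra.
  have -> : N%:R * w = 4 * r.
    transitivity (4 * r * ((1 / 2) ^+ j * 2 ^+ j)); last by rewrite p2 mulr1.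
    by rewrite /N natrM natrX /w; ring.
  lra.
have rz : rel (s, t, k) z by [].
exists (xget 0 (rel (s, t, k))); first by apply: map_f; rewrite mem_enum.
have [p1 p2' p3 p4 [p5 p6]] := xgetI 0 rz.
move: p1 p2' p3 p4 p5 p6 rz => /=; move: (xget _ _) => p p1 q2 p3 p4 p5 p6 _.
have nn (y : R * R) : norm2 y ^+ 2 = co s y ^+ 2 + co (~~ s) y ^+ 2.
  rewrite sqr_sqrtr ?dot_ge0// /dot -!expr2; case: (s) => //=; exact: addrC.
have lo (y : R * R) : r - w <= norm2 y -> (r - w) ^+ 2 <= co s y ^+ 2 + co (~~ s) y ^+ 2.
  by move=> h; rewrite -nn lerXn2r// nnegrE ?subr_ge0// sqrtr_ge0.
have hi (y : R * R) : norm2 y <= r -> co s y ^+ 2 + co (~~ s) y ^+ 2 <= r ^+ 2.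
  by move=> h; rewrite -nn lerXn2r// nnegrE ?sqrtr_ge0// ltW.
have d1 : `|co s z - co s p| <= w.
  by move: k2 p6; rewrite -natr1 mulrDl mul1r ler_norml => ? ?; apply/andP; split; lra.
have d2 : `|co (~~ s) z - co (~~ s) p| <= 8 * w.
  have sq c : ((-1) ^+ t * c) ^+ 2 = c ^+ 2 :> R by rewrite exprMn sqrr_sign mul1r.
  have := @circle_gap r w (co s z) ((-1) ^+ t * co (~~ s) z) (co s p) ((-1) ^+ t * co (~~ s) p).
  rewrite !sq -mulrBr normrM normr_sign mul1r; apply => //; [exact: lo|exact: hi|exact: lo|exact: hi].
have d1' : `|co s z - co s p| <= 8 * w by lra.
by case: (s) d1' d2.
Qed.

End circle_cover.

(** * Dyadic shells of the ellipse *)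

Section ellipse_cover.
Local Open Scope complex_scope.
Context {R : realType}.
Local Notation cfun := (R * R -> R[i]).
Local Notation T := (measurableTypeR R * measurableTypeR R)%type.
Local Notation mu := (@leb2 R).
Local Notation c0 := ((2 * pi)^-1 : R).

(** The linear map that takes the ellipse to a disc, recorded by its two-sided bounds in the sup
    norm: covers are made in the disc and diameters and distances are carried back. *)
Definition plane_iso (u : R * R -> R * R) (a b : R) : Prop :=
  [/\ forall x y, u (x - y) = u x - u y,
    measurable_fun setT ((fun x => (u x).1) : T -> R),
    measurable_fun setT ((fun x => (u x).2) : T -> R),
    forall z c, `|z.1| <= c -> `|z.2| <= c ->
      `|(u z).1| <= a * c /\ `|(u z).2| <= a * c &
    forall z c, `|(u z).1| <= c -> `|(u z).2| <= c ->
      `|z.1| <= b * c /\ `|z.2| <= b * c].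

Variables (u : R * R -> R * R) (a b : R).
Hypotheses (ui : plane_iso u a b) (a0 : 0 < a) (b0 : 0 < b).

Definition ell (r : R) : set T := [set x | norm2 (u x) <= r].

Lemma measurable_norm2 : measurable_fun setT ((fun x => norm2 (u x)) : T -> R).
Proof.
have [_ m1 m2 _ _] := ui.
have md : measurable_fun setT ((fun x => dot (u x) (u x)) : T -> R).
  by apply: measurable_funD; exact: measurable_funM.
have ms : measurable_fun setT (@Num.sqrt R).
  by apply: continuous_measurable_fun; exact: sqrt_continuous.
exact: (measurableT_comp ms md).
Qed.

Lemma measurable_le_fun (f : T -> R) c : measurable_fun setT f ->
  measurable [set x | f x <= c].
Proof.
move=> mf; have := mf measurableT _ (measurable_itv `]-oo, c]); rewrite setTI.
by congr measurable; apply/seteqP; split => x /=; rewrite in_itv.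
Qed.

Lemma measurable_ell r : measurable (ell r).
Proof. exact: (measurable_le_fun _ measurable_norm2). Qed.

Lemma measurable_in_square_preimage (p : R * R) (c : R) :
  measurable ([set x | in_square p c (u x)] : set T).
Proof.
have [_ m1 m2 _ _] := ui.
apply: measurableI; apply: measurable_le_fun; apply: (measurableT_comp (@normr_measurable R setT));
  exact: measurable_funB.
Qed.

Lemma ell_square r x : ell r x -> in_square 0 (b * r) x.
Proof.
move=> xr; have [_ _ _ _ ub] := ui; have [n1 n2] := norm2_ge (u x).
have := ub x r (le_trans n1 xr) (le_trans n2 xr).
by rewrite /in_square /= !subr0.
Qed.

Lemma preimage_square_diameter (p : R * R) (c : R) (x y : R * R) :
  in_square p c (u x) -> in_square p c (u y) -> in_square y (b * (2 * c)) x.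
Proof.
move=> [x1 x2] [y1 y2]; have [uB _ _ _ ub] := ui.
have H (s t q : R) : `|s - q| <= c -> `|t - q| <= c -> `|s - t| <= 2 * c.
  move=> sq tq; have -> : s - t = (s - q) - (t - q) by ring.
  by rewrite (le_trans (ler_normB _ _))//; lra.
by have := ub (x - y) (2 * c); rewrite uB; apply; [exact: H x1 y1|exact: H x2 y2].
Qed.

(** Otherwise u moves x to y by at most a w / (2 a) in each coordinate, hence by at most w in
    Euclidean norm, which leaves y in the ellipse. *)
Lemma ell_far (r w : R) x y : 0 < w -> norm2 (u x) <= r - w -> ~ ell r y ->
  w / (2 * a) <= `|x.1 - y.1| \/ w / (2 * a) <= `|x.2 - y.2|.
Proof.
move=> w0 xr nyr; have [uB _ _ ua _] := ui; apply/orP; apply/negPn/negP.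
rewrite negb_or -!ltNge => /andP[d1 d2]; apply: nyr; rewrite /ell /=.
have [e1 e2] : `|(u (y - x)).1| <= a * (w / (2 * a)) /\ `|(u (y - x)).2| <= a * (w / (2 * a)).
  by apply: ua; rewrite /= distrC ltW.
have := norm2D (u x) (u y - u x); rewrite subrKC.
have := norm2_le e1 e2; rewrite uB.
have -> : 2 * (a * (w / (2 * a))) = w by field; rewrite gt_eqF.
lra.
Qed.

Lemma shell_cases (r : R) (J : nat) x : ell r x ->
  (exists2 j : nat, (j < J)%N & r - r * (1 / 2) ^+ j <= norm2 (u x) /\
     norm2 (u x) <= r - r * (1 / 2) ^+ j.+1) \/
  r - r * (1 / 2) ^+ J <= norm2 (u x).
Proof.
move=> xr; elim: J => [|J [ [j jJ hj] |IH] ].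
- by right; rewrite expr0 mulr1 subrr sqrtr_ge0.
- by left; exists j => //; exact: ltnW.
- have [h|h] := lerP (norm2 (u x)) (r - r * (1 / 2) ^+ J.+1); last by right; exact: ltW.
  by left; exists J.
Qed.

Variables (S : set T) (dS : domain S) (wS : well_shaped S).

(** Shell j has thickness of order w j = r 2^-j and 16 2^j pieces of codimension O(n^2 (1 + w j))
    each. As 2^j w j = r and 2^j <= 2 r, every shell costs O(n^2 r), thick or thin, and J + 1 of
    them give the bound. Since r <= 2^J, the last shell has w J <= 1, so its pieces have bounded
    size and [boundary_codim] applies. *)
Lemma ellipse_codim : exists2 C : R, 0 <= C & forall (r : R) (n J : nat),
  1 < r -> (0 < n)%N -> r <= 2 ^+ J -> 2 ^+ J <= 2 * r ->
  exists2 M : nat, M%:R <= C * n%:R ^+ 2 * r * J.+1%:R &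
    codim_le M (leak (ell r) S (ell r) (96 * r ^+ 2 *
      (5 * c0 * Num.sqrt (\int[mu]_x (\1_S x : R)) * (1 / 2) ^+ n))).
Proof.
have [Sbd oS _] := dS; have mS : measurable S by exact: open_measurable2.
have [bS bS0 Sb] := bounded_set_square Sbd.
have rS : rint mu (\1_S : T -> R).
  apply: (@rint_bounded_support _ _ 1 bS) => [|x|x]; [exact: measurable_indic|exact: indic_le1|].
  rewrite indicE; case: (boolP (x \in S)) => [/set_mem/Sb|_]; last by rewrite eqxx.
  by rewrite /in_square !subr0.
(* The half-side 16 b w J of a square containing a piece of the last shell, with w J <= 1. *)
have b16 : 0 <= b * (2 * (8 * 1)) by rewrite mulr_ge0// ltW.
have [C0 H0] := boundary_codim mS rS bS0 Sb b16.
(* The ratio of half-side 16 b w j to separation l = w j / (4 a). *)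
have c64 : 0 <= 64 * a * b by rewrite !mulr_ge0// ltW.
have [C1 H1] := interior_codim mS rS bS0 Sb dS wS c64.
set k := 5 * c0 * Num.sqrt _ in H0 H1 *.
have k0 : 0 <= k by rewrite !mulr_ge0 ?c0_ge0 ?sqrtr_ge0.
exists (32 * C0%:R + 16 * `|C1| * (2 + (4 * a)^-1)).
  by rewrite addr_ge0// !mulr_ge0// addr_ge0// invr_ge0 mulr_ge0// ltW.
move=> r n J r1 n0 rJ Jr; have r0 : 0 < r by exact: lt_trans r1.
set q := (1 / 2 : R) ^+ n; have q0 : 0 <= q by rewrite exprn_ge0// divr_ge0.
pose w (j : nat) := r * (1 / 2) ^+ j.
have w0 j : 0 < w j by rewrite mulr_gt0// exprn_gt0// divr_gt0.
(* One natural number for all pieces of a shell. In shell j < J the norm of u x is at most r - w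
   j.+1, so [ell_far] separates x from the complement by w j.+1 / (2 a) = w j / (4 a). *)
pose M (j : nat) : nat := if (j < J)%N then
  Num.truncn (`|C1| * n%:R ^+ 2 * (1 + w j / (4 * a))) else (C0 * n ^ 2)%N.
pose shell (j : nat) : set T := if (j < J)%N then
    [set x | r - w j <= norm2 (u x) /\ norm2 (u x) <= r - w j.+1]
  else [set x | r - w J <= norm2 (u x) /\ norm2 (u x) <= r].
have mn := measurable_norm2.
have mge c : measurable ([set x | c <= norm2 (u x)] : set T).
  rewrite (_ : [set x | _] = [set x | - norm2 (u x) <= - c]); last first.
    by apply/seteqP; split => x /=; rewrite lerN2.
  exact: (measurable_le_fun _ (measurableT_comp (@oppr_measurable R setT) mn)).
have mshell j : measurable (shell j).
  by rewrite /shell; case: ifP => _;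
    exact: (measurableI _ _ (mge _) (measurable_le_fun _ mn)).
have shell_r j x : (j <= J)%N -> shell j x -> r - w j <= norm2 (u x) /\ norm2 (u x) <= r.
  rewrite leq_eqVlt /shell => /predU1P[->|jJ]; first by rewrite ltnn.
  by rewrite jJ => -[h1 h2]; split => //; have := w0 j.+1; lra.
have cj j : (j < J.+1)%N -> forall B, measurable B -> B `<=` shell j -> B `<=` ell r ->
    codim_le (16 * 2 ^ j * M j) (leak (ell r) S B (16 * 2 ^+ j * (k * q))).
  move=> jJ B mB Bs BE.
  have [ps sps cov] := circle_cover j r0.
  pose G (p : R * R) : set T := [set x | in_square p (8 * w j) (u x)].
  have sumc (c : nat) : (\sum_(i <- ps) c = 16 * 2 ^ j * c)%N.
    by rewrite big_const_seq count_predT iter_addn_0 mulnC sps.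
  have sume (c : R) : \sum_(i <- ps) c = 16 * 2 ^+ j * c.
    by rewrite big_const_seq count_predT iter_addr_0 sps -[LHS]mulr_natl natrM natrX.
  rewrite -sumc -sume; apply: (codim_leak_cover mS (G := G)) => //.
  - by move=> p; exact: measurable_in_square_preimage.
  - move=> p B' pps mB' BG BB.
    have [x0 Bx0] : exists x0, forall x, B' x -> in_square x0 (b * (2 * (8 * w j))) x.
      have [[x0 Bx0]|nB] := pselect (B' !=set0); last first.
        by exists 0 => x Bx; exfalso; apply: nB; exists x.
      by exists x0 => x Bx; exact: preimage_square_diameter (BG _ Bx) (BG _ Bx0).
    rewrite /M; case: ifP => jJ'; last first.
      have jE : j = J by apply/eqP; rewrite eqn_leq -ltnS jJ leqNgt jJ'.
      have wJ : w j <= 1.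
        rewrite jE /w div1r exprVn ler_pdivrMr ?exprn_gt0// mul1r//.
      have Bx0' x : B' x -> in_square x0 (b * (2 * (8 * 1))) x.
        move=> /Bx0[x1 x2]; have wb : b * (2 * (8 * w j)) <= b * (2 * (8 * 1)).
          by rewrite ler_pM2l//; lra.
        by split; [exact: le_trans x1 wb|exact: le_trans x2 wb].
      have [m mC cm] := H0 (ell r) B' x0 n mB' Bx0' n0.
      exact: codim_le_mono mC cm.
    pose l := w j / (4 * a).
    have l0 : 0 < l by rewrite divr_gt0// mulr_gt0.
    have rho0 : 0 <= b * (2 * (8 * w j)) by rewrite !mulr_ge0// ltW.
    have rl : b * (2 * (8 * w j)) <= 64 * a * b * l.
      rewrite le_eqVlt; apply/orP; left; apply/eqP; rewrite /l.
      by field; rewrite gt_eqF.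
    have fl x y : B' x -> ~ ell r y -> l <= `|x.1 - y.1| \/ l <= `|x.2 - y.2|.
      move=> Bx nE; have : shell j x by apply: Bs; exact: BB.
      rewrite /shell jJ' => -[_ xs].
      have -> : l = w j.+1 / (2 * a) by rewrite /l /w exprS; field; rewrite gt_eqF.
      exact: (ell_far (w0 j.+1) xs nE).
    have [m mC cm] := H1 (ell r) B' x0 _ l n mB' Bx0 n0 rho0 l0 rl fl.
    apply: codim_le_mono cm; rewrite truncn_ge_nat.
      rewrite (le_trans mC)//.
      apply: ler_wpM2r; first by rewrite addr_ge0// ltW.
      by apply: ler_wpM2r; [exact: exprn_ge0|exact: ler_norm].
    by rewrite !mulr_ge0 ?exprn_ge0// addr_ge0// ltW.
  - move=> x Bx; have [h1 h2] := shell_r j x jJ (Bs _ Bx).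
    by have [p pps px] := cov (u x) h1 h2; exists p.
have cE : codim_le (\sum_(j <- iota 0 J.+1) (16 * 2 ^ j * M j)%N)
    (leak (ell r) S (ell r) (\sum_(j <- iota 0 J.+1) (16 * 2 ^+ j * (k * q)))).
  apply: (codim_leak_cover mS (G := shell)) => //.
  - exact: measurable_ell.
  - by move=> j B; rewrite mem_iota => /andP[_ jJ] mB Bs BE; exact: cj.
  - move=> x Ex; have [ [j jJ [h1 h2]] |h] := shell_cases J Ex.
      by exists j; [rewrite mem_iota/= ltnS ltnW|rewrite /shell jJ].
    by exists J; [rewrite mem_iota/=|rewrite /shell ltnn].
have sum_bound (F : nat -> R) (D : R) : (forall j, (j <= J)%N -> F j <= D) ->
    \sum_(j <- iota 0 J.+1) F j <= J.+1%:R * D.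
  move=> FD; rewrite big_seq.
  apply: (@le_trans _ _ (\sum_(j <- iota 0 J.+1 | j \in iota 0 J.+1) D)).
    by apply: ler_sum => j; rewrite mem_iota => /andP[_ jJ]; exact: FD.
  by rewrite -big_seq big_const_seq count_predT iter_addr_0 size_iota -[X in X <= _]mulr_natl.
have pow_le j : (j <= J)%N -> 2 ^+ j <= 2 * r.
  by move=> jJ; apply: le_trans Jr; rewrite ler_eXn2l// ltr1n.
have n20 : 0 <= n%:R ^+ 2 :> R by exact: sqr_ge0.
exists (\sum_(j <- iota 0 J.+1) (16 * 2 ^ j * M j)%N).
  rewrite natr_sum mulrC; apply: sum_bound => j jJ.
  have a40 : 0 <= (4 * a)^-1 by rewrite invr_ge0 mulr_ge0// ltW.
  have p0 : 0 <= 2 ^+ j :> R by rewrite exprn_ge0.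
  have := pow_le j jJ; rewrite !natrM natrX /M; case: ifP => jJ'.
    set X := `|C1| * _ * _ => pj.
    have X0 : 0 <= X by rewrite !mulr_ge0 ?exprn_ge0// addr_ge0// divr_ge0// ltW// mulr_gt0.
    have tX : (Num.truncn X)%:R <= X by rewrite truncn_le.
    have -> : 16%:R * 2%:R ^+ j * (Num.truncn X)%:R = 16 * (2 ^+ j * (Num.truncn X)%:R) :> R by ring.
    have h1 : 2 ^+ j * (Num.truncn X)%:R <= 2 ^+ j * X :> R by rewrite ler_wpM2l.
    have p2 : (1 / 2 : R) ^+ j * 2 ^+ j = 1.
      by rewrite -exprMn (_ : 1 / 2 * 2 = 1 :> R) ?expr1n//; field.
    have h2 : 2 ^+ j * X = `|C1| * n%:R ^+ 2 * (2 ^+ j + r * (4 * a)^-1).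
      transitivity (`|C1| * n%:R ^+ 2 * (2 ^+ j + r * ((1 / 2) ^+ j * 2 ^+ j) * (4 * a)^-1)).
        by rewrite /X /w; ring.
      by rewrite p2 mulr1.
    have h3 : `|C1| * n%:R ^+ 2 * (2 ^+ j + r * (4 * a)^-1) <=
        `|C1| * n%:R ^+ 2 * (2 * r + r * (4 * a)^-1).
      by rewrite ler_wpM2l ?mulr_ge0// lerD2r.
    have h4 : 0 <= 32 * C0%:R * (n%:R ^+ 2 * r) :> R by rewrite !mulr_ge0// ltW.
    move: h1 h2 h3 h4; move: (Num.truncn X)%:R (n%:R ^+ 2) ((4 * a)^-1) => x y z *.
    lra.
  move=> pj; rewrite natrM natrX.
  have h1 : 0 <= 16 * `|C1| * (2 + (4 * a)^-1) * (n%:R ^+ 2 * r).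
    by rewrite !mulr_ge0 ?addr_ge0// ltW.
  have h2 : 2 ^+ j * (C0%:R * n%:R ^+ 2) <= 2 * r * (C0%:R * n%:R ^+ 2).
    by rewrite ler_wpM2r// mulr_ge0.
  move: h1 h2.
  move: (n%:R ^+ 2) ((4 * a)^-1) (2 ^+ j : R) => x y z *.
  lra.
apply: codim_le_sub cE => f; apply: leak_le.
have kq0 : 0 <= k * q by rewrite mulr_ge0.
(* A shell has 16 2^j <= 32 r pieces, and the number J + 1 of shells is at most 3 r; this is the
   origin of 96 r^2. *)
apply: (@le_trans _ _ (J.+1%:R * (32 * r * (k * q)))).
  apply: sum_bound => j /pow_le pj; rewrite ler_wpM2r//; lra.
rewrite mulrA ler_wpM2r//.
have : J.+1%:R <= 3 * r.
  have : (J.+1)%:R <= 2 ^+ J :> R by rewrite -natrX ler_nat; exact: ltn_expl.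
  lra.
move=> h; have := ler_wpM2r (ltW r0) h; rewrite expr2; lra.
Qed.

End ellipse_cover.

(** * The number of eigenvalues *)

Section final_estimates.
Local Open Scope complex_scope.
Context {R : realType}.
Local Notation cfun := (R * R -> R[i]).
Local Notation T := (measurableTypeR R * measurableTypeR R)%type.
Local Notation mu := (@leb2 R).

Lemma finite_card_bound (A : set nat) (B : nat) :
  (forall N (k : 'I_N -> nat), injective k -> (forall i, A (k i)) -> (N <= B)%N) ->
  finite_set A /\ (#|` fset_set A| <= B)%N.
Proof.
move=> H; have HF (F : {fset nat}) : [set` F] `<=` A -> (#|` F| <= B)%N.
  move=> FA; apply: (H _ (fun i : 'I_(#|` F|) => nth 0%N F i)) => [i j /eqP|i].
    by rewrite nth_uniq ?fset_uniq// => /eqP/val_inj.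
  by apply: FA => /=; rewrite mem_nth.
have fA : finite_set A.
  apply: contrapT => /(infinite_set_fset B.+1)[F /HF FB]; rewrite ltnNge FB//.
by split => //; apply: HF; rewrite fset_setK.
Qed.

(** Cauchy-Schwarz between (|Re f|, |Im f|) and (1_E, 1_E), whose square norm is twice the area of
    [E]. *)
Lemma norm1_le_ip (E : set T) f : measurable E -> rint mu (\1_E : T -> R) ->
  cLfun 2%:E f -> space_limit E f = f ->
  norm1 f <= Num.sqrt (2 * \int[mu]_x (\1_E x : R)) * Num.sqrt (ip f f).
Proof.
move=> mE rE [/l2P[m1 r1] /l2P[m2 r2]] fE.
pose g : cfun := fun x => `|complex.Re (f x)| +i* `|complex.Im (f x)|.
pose h : cfun := fun x => \1_E x +i* \1_E x.
have sq (v : T -> R) : measurable_fun setT v -> rint mu (fun x => v x ^+ 2) ->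
    (fun x => `|v x|) \in Lfun mu 2%:E.
  move=> mv rv; apply/l2P; split; first exact: (measurableT_comp (@normr_measurable R setT)).
  by apply: eq_rint rv => x; rewrite real_normK ?num_real.
have lg : cLfun 2%:E g by split; exact: sq.
have lE : (\1_E : T -> R) \in Lfun mu 2%:E.
  apply/l2P; split; first exact: rint_measurable rE.
  by apply: eq_rint rE => x; rewrite indic_sqr.
have lh : cLfun 2%:E h by [].
have ->: norm1 f = ip g h.
  apply: eq_Rintegral => x _ /=; rewrite -mulrDl.
  have : space_limit E f x = f x by rewrite fE.
  rewrite /space_limit indicE; case: (_ \in _); first by rewrite mulr1.
  by rewrite mul0r => <-; rewrite /= !normr0 addr0 mul0r.
have -> : ip f f = ip g g.
  by apply: eq_Rintegral => x _ /=; rewrite -!normrM -!expr2 !ger0_norm ?sqr_ge0.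
have -> : 2 * \int[mu]_x (\1_E x : R) = ip h h.
  rewrite -rintegralZ//; apply: eq_Rintegral => x _ /=.
  by rewrite -expr2 indic_sqr mulr2n mulrDl mul1r.
by rewrite mulrC (le_trans (ler_norm _))// ip_cauchy_sqrt.
Qed.

Lemma ellipse_plane_iso (F : set (R * R)) : centered_ellipse F ->
  exists u a b, [/\ 0 < a, 0 < b, plane_iso u a b &
    forall r, 0 < r -> dilate r F = ell u r].
Proof.
move=> [p [q [t [p0 q0 FE]]]].
pose u (x : R * R) := ((x.1 * cos t + x.2 * sin t) / p, (x.2 * cos t - x.1 * sin t) / q).
have cs := cos2Dsin2 t; have c1 := cos_max t; have s1 := sin_max t.
have p0' : p != 0 by rewrite gt_eqF.
have q0' : q != 0 by rewrite gt_eqF.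
have lin (x y c d e : R) : `|x| <= e -> `|y| <= e -> `|c| <= 1 -> `|d| <= 1 ->
    `|x * c + y * d| <= 2 * e /\ `|x * c - y * d| <= 2 * e.
  move=> xe ye hc hd.
  have h1 : `|x * c| <= e by rewrite normrM (le_trans _ xe)// ler_piMr.
  have h2 : `|y * d| <= e by rewrite normrM (le_trans _ ye)// ler_piMr.
  split; first by rewrite (le_trans (ler_normD _ _))//; lra.
  by rewrite (le_trans (ler_normB _ _))//; lra.
exists u, (2 / p + 2 / q), (2 * p + 2 * q); split.
- by rewrite addr_gt0// divr_gt0.
- by rewrite addr_gt0// mulr_gt0.
- split.
  + by move=> x y; rewrite /u /=; congr pair; rewrite -mulrBl; congr (_ / _); ring.
  + by apply: measurable_funM => //; apply: measurable_funD; apply: measurable_funM.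
  + by apply: measurable_funM => //; apply: measurable_funB; apply: measurable_funM.
  + move=> z c z1 z2; have c0 : 0 <= c by rewrite (le_trans _ z1).
    have [h1 _] := lin _ _ _ _ _ z1 z2 c1 s1; have [_ h2] := lin _ _ _ _ _ z2 z1 c1 s1.
    rewrite /u /= !normrM !normfV (gtr0_norm p0) (gtr0_norm q0).
    have p1 : 0 <= 2 / p * c by rewrite mulr_ge0// divr_ge0// ltW.
    have q1 : 0 <= 2 / q * c by rewrite mulr_ge0// divr_ge0// ltW.
    split.
      apply: (@le_trans _ _ (2 / p * c)); last by rewrite mulrDl; lra.
      by rewrite ler_pdivrMr// mulrAC divfK.
    apply: (@le_trans _ _ (2 / q * c)); last by rewrite mulrDl; lra.
    by rewrite ler_pdivrMr// mulrAC divfK.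
  + move=> z c; rewrite /u /= => z1 z2; have c0 : 0 <= c by rewrite (le_trans _ z1).
    move: z1 z2; set v := _ / p; set w := _ / q => z1 z2.
    have e1 : z.1 = (p * v) * cos t - (q * w) * sin t.
      rewrite /v /w; transitivity (z.1 * (cos t ^+ 2 + sin t ^+ 2)); first by rewrite cs mulr1.
      by field; rewrite p0' q0'.
    have e2 : z.2 = (p * v) * sin t + (q * w) * cos t.
      rewrite /v /w; transitivity (z.2 * (cos t ^+ 2 + sin t ^+ 2)); first by rewrite cs mulr1.
      by field; rewrite p0' q0'.
    have pv : `|p * v| <= (p + q) * c.
      rewrite normrM (gtr0_norm p0) mulrDl (@le_trans _ _ (p * c)) ?ler_wpM2l ?(ltW p0)//.
      by rewrite lerDl mulr_ge0// ltW.
    have qw : `|q * w| <= (p + q) * c.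
      rewrite normrM (gtr0_norm q0) mulrDl (@le_trans _ _ (q * c)) ?ler_wpM2l ?(ltW q0)//.
      by rewrite lerDr mulr_ge0// ltW.
    have -> : (2 * p + 2 * q) * c = 2 * ((p + q) * c) by ring.
    have [_ h1] := lin _ _ _ _ _ pv qw c1 s1; have [h2 _] := lin _ _ _ _ _ pv qw s1 c1.
    by rewrite {1}e1 {1}e2.
- move=> r r0; have r0' : r != 0 by rewrite gt_eqF.
  have uZ (y : R * R) : dot (u (r * y.1, r * y.2)) (u (r * y.1, r * y.2)) = r ^+ 2 * dot (u y) (u y).
    by rewrite /dot /u /=; field; rewrite p0' q0'.
  have key (y : R * R) : norm2 (u (r * y.1, r * y.2)) <= r <-> F y.
    have -> : F y <-> dot (u y) (u y) <= 1 by rewrite FE /dot /u /= -!expr2.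
    rewrite /norm2 uZ -[leRHS](ger0_norm (ltW r0)) -sqrtr_sqr ler_psqrt ?nnegrE ?sqr_ge0//; last first.
      by rewrite mulr_ge0 ?sqr_ge0 ?dot_ge0.
    by rewrite ger_pMr ?exprn_gt0.
  apply/seteqP; split => [_ [y Fy <-]|x xr]; first exact/key.
  have e : (r * (x.1 / r), r * (x.2 / r)) = x.
    by rewrite !(mulrCA r) !divff// !mulr1; case: (x).
  by exists (x.1 / r, x.2 / r) => //; apply/key; rewrite /= e.
Qed.

Lemma pow2_between (x : R) : 1 <= x ->
  exists n : nat, [/\ x <= 2 ^+ n, 2 ^+ n <= 2 * x & n%:R <= 1 + log2 x].
Proof.
move=> x1; have x0 : 0 < x by exact: lt_le_trans x1.
have ex : exists n : nat, x <= 2 ^+ n.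
  exists (Num.truncn x).+1; rewrite (le_trans (ltW (truncnS_gt _)))//.
  by rewrite -natrX ler_nat ltnW// ltn_expl.
have [n xn nmin] := ex_minnP ex; exists n.
have n2 : 2 ^+ n <= 2 * x.
  case: n nmin {xn} => [|n] nmin; first by rewrite expr0; lra.
  rewrite exprS ler_pM2l// ltW// ltNge; apply/negP => /nmin.
  by rewrite ltnn.
split => //; have l2 : 0 < ln 2 :> R by rewrite ln_gt0// ltr1n.
rewrite /log2 -(ler_pM2r l2) mulrDl mul1r divfK ?gt_eqF// -lnM ?posrE//.
by rewrite [X in X <= _]mulr_natl -lnXn// ler_ln ?posrE ?exprn_gt0// mulr_gt0.
Qed.

End final_estimates.

Section eigenvalue_count.
Context {R : realType}.
Local Notation T := (measurableTypeR R * measurableTypeR R)%type.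
Local Notation mu := (@leb2 R).
Local Notation c0 := ((2 * pi)^-1 : R).

Lemma rint_in_square (E : set T) (b : R) : 0 <= b -> measurable E ->
  (forall x, E x -> in_square 0 b x) ->
  rint mu (\1_E : T -> R) /\ \int[mu]_x (\1_E x : R) <= (2 * b + 1) ^+ 2.
Proof.
move=> b0 mE Eb.
have Ebox x : E x -> box (- b - 1) (- b - 1 + (2 * b + 1)) (- b - 1) (- b - 1 + (2 * b + 1)) x.
  move=> /Eb[]; rewrite !subr0 !ler_norml => /andP[? ?] /andP[? ?].
  by split; rewrite /= in_itv/=; apply/andP; split; lra.
have rB := rint_box (- b - 1) (- b - 1 + (2 * b + 1)) (- b - 1) (- b - 1 + (2 * b + 1)).
have le x : (\1_E x : R) <= \1_(box (- b - 1) (- b - 1 + (2 * b + 1)) (- b - 1) (- b - 1 + (2 * b + 1))) x.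
  rewrite !indicE; case: (boolP (x \in E)) => [/set_mem/Ebox xB|_] //.
  by rewrite (mem_set xB).
have rE : rint mu (\1_E : T -> R).
  apply: (@rint_le _ T R mu _ _ _ _ rB); first exact: measurable_indic.
  by move=> x; rewrite ger0_norm// indicE.
split => //; rewrite -(rintegral_square (- b - 1) (- b - 1)); last by lra.
exact: rintegral_le.
Qed.

(** Since r / eps > 2, its logarithm is at least 1 and absorbs additive constants and lower powers.
    The last clause uses r^3 / eps <= (r / eps)^3. *)
Lemma log2_pos_facts (eps r : R) : 0 < eps < 1 / 2 -> 1 < r ->
  [/\ 1 <= log2 (r / eps), 0 <= log2 r, log2 r <= log2 (r / eps) &
   forall D, 1 <= D -> 1 <= D * r ^+ 3 / eps /\
     log2 (D * r ^+ 3 / eps) <= log2 D + 3 * log2 (r / eps)].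
Proof.
move=> /andP[e0 e2] r1; have r0 : 0 < r by lra.
have l2 : 0 < ln 2 :> R by rewrite ln_gt0// ltr1n.
have mono (x y : R) : 0 < x -> x <= y -> log2 x <= log2 y.
  by move=> x0 xy; rewrite /log2 ler_pM2r ?invr_gt0// ler_ln ?posrE// (lt_le_trans x0).
have re : 2 <= r / eps by rewrite ler_pdivlMr//; nra.
have re0 : 0 < r / eps by lra.
have e1 : 1 <= eps^-1 by rewrite invf_ge1//; lra.
split.
- by rewrite -[1](divff (lt0r_neq0 l2)); exact: mono re.
- by apply: divr_ge0; [exact/ln_ge0/ltW|exact: ltW].
- by apply: mono => //; rewrite ler_pMr.
move=> D D1; have D0 : 0 < D by lra.
have r31 : 1 <= r ^+ 3 by rewrite exprn_ege1// ltW.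
split; first by rewrite -mulrA; apply: mulr_ege1 => //; exact: mulr_ege1.
apply: (@le_trans _ _ (log2 (D * (r / eps) ^+ 3))).
  apply: mono; first by rewrite divr_gt0// mulr_gt0// exprn_gt0.
  rewrite expr_div_n -mulrA; apply: ler_wpM2l; first exact: ltW.
  apply: ler_wpM2l; first by rewrite exprn_ge0// ltW.
  by rewrite -exprVn; exact: ler_eXnr.
have pre : 0 < (r / eps) ^+ 3 by rewrite exprn_gt0.
have -> : log2 (D * (r / eps) ^+ 3) = log2 D + 3 * log2 (r / eps).
  by rewrite /log2 (lnM D0 pre) (lnXn 3 re0) mulrDl mulrA mulr_natl.
exact: lexx.
Qed.

Lemma ellipse_eigenvalue_count (F S : set (R * R)) :
  centered_ellipse F -> domain S -> well_shaped S ->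
  exists2 C : R, 0 <= C & forall (eps r : R) (lambda : nat -> R),
    0 < eps < 1 / 2 -> 1 < r ->
    eigenvalue_sequence (space_band_limit (dilate r F) S) lambda ->
    let A := [set k : nat | eps < lambda k < 1 - eps] in
    finite_set A /\ (#|` fset_set A|)%:R <= C * r * log2 (r / eps) ^+ 3.
Proof.
move=> hF dS wS; have [u [a [b [a0 b0 ui FE]]]] := ellipse_plane_iso hF.
have [C C0 HC] := ellipse_codim ui a0 b0 dS wS.
have mS : measurable (S : set T) by apply: open_measurable2; have [] := dS.
set k := 5 * c0 * _ in HC.
have k0 : 0 <= k by rewrite !mulr_ge0 ?sqrtr_ge0 ?c0_ge0.
(* The leak 96 r^2 k 2^-n is multiplied by the factor (4 b + 2) r that passes from [norm1] to the
   L^2 norm; D collects these constants, and the summand 1 gives D >= 1, hence a nonnegative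
   logarithm. *)
pose D : R := 2 * (96 * k * (4 * b + 2)) + 1.
have b2 : 0 <= 4 * b + 2 by lra.
have K2 : 0 <= 96 * k * (4 * b + 2) by apply: mulr_ge0 => //; exact: mulr_ge0.
have D1 : 1 <= D by rewrite /D lerDr mulr_ge0.
(* From n + 1 <= 2 + log2 D + 3 log2 (r / eps), where the constant terms are multiplied by the
   logarithm, which is at least 1. *)
pose c3 : R := 2 + log2 D + 3.
exists (6 * C * c3 ^+ 2); first by apply: mulr_ge0; [exact: mulr_ge0|exact: sqr_ge0].
move=> eps r lambda eps2 r1 hl A.
have [L1 lr0 lrL HD] := log2_pos_facts eps2 r1.
have r0 : 0 < r by exact: lt_trans r1.
rewrite (FE r r0) in hl.
have br0 : 0 <= b * r by rewrite mulr_ge0// ltW.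
have mE := measurable_ell ui r.
have [rE areaE] := rint_in_square br0 mE (ell_square ui (r := r)).
have [X1 Xlog] := HD D D1.
(* The number of averages is n + 1: this is positive, as [ellipse_codim] requires, and it gains the
   factor 2 that brings the leak down to eps / 2. *)
have [n [nX _ nlog]] := pow2_between X1.
have [J [rJ Jr Jlog]] := pow2_between (ltW r1).
have [M MC [L [mL LQ]]] := HC r n.+1 J r1 (ltn0Sn n) rJ Jr.
have [e0 e2] := andP eps2.
(* The choice eta = eps / 2 meets eta^2 < eps (1 - eps) because eps < 1 / 2. *)
have eta0 : 0 <= eps / 2 by rewrite divr_ge0// ltW.
have eta2 : (eps / 2) ^+ 2 < eps * (1 - eps) by nra.
have small : 96 * r ^+ 2 * (k * (1 / 2) ^+ n.+1) *
    Num.sqrt (2 * \int[mu]_x (\1_(ell u r) x : R)) <= eps / 2.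
  have h1 : Num.sqrt (2 * \int[mu]_x (\1_(ell u r) x : R)) <= (4 * b + 2) * r.
    have B0 : 0 <= (4 * b + 2) * r by rewrite mulr_ge0// ltW.
    rewrite -[leRHS]ger0_norm// -sqrtr_sqr ler_wsqrtr//.
    apply: (@le_trans _ _ (2 * (2 * (b * r) + 1) ^+ 2)); first by rewrite ler_pM2l.
    have : 2 * (b * r) + 1 <= (2 * b + 1) * r by lra.
    have : 0 <= 2 * (b * r) + 1 by lra.
    have -> : (4 * b + 2) * r = 2 * ((2 * b + 1) * r) by ring.
    move: (2 * (b * r) + 1) ((2 * b + 1) * r) => x y; nra.
  have h2 : 2 ^+ n.+1 * (1 / 2) ^+ n.+1 = 1 :> R.
    by rewrite -exprMn (_ : 2 * (1 / 2) = 1 :> R) ?expr1n//; field.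
  set q := (1 / 2) ^+ n.+1 in h2 *; have q0 : 0 <= q by rewrite exprn_ge0// divr_ge0.
  have h3 : D * r ^+ 3 * q <= eps / 2.
    have : D * r ^+ 3 / eps * q <= 1 / 2.
      move: h2; rewrite exprS => h2; have := ler_wpM2r q0 nX; lra.
    rewrite mulrAC ler_pdivrMr//; lra.
  have K0 : 0 <= 96 * r ^+ 2 * (k * q).
    by apply: mulr_ge0; apply: mulr_ge0 => //; exact: sqr_ge0.
  apply: le_trans (ler_wpM2l K0 h1) _.
  apply: le_trans h3.
  have -> : 96 * r ^+ 2 * (k * q) * ((4 * b + 2) * r) = 96 * k * (4 * b + 2) * (r ^+ 3 * q).
    by ring.
  rewrite -[leRHS]mulrA; apply: ler_wpM2r; first by rewrite mulr_ge0// exprn_ge0// ltW.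
  rewrite /D; lra.
have N2 N (i : 'I_N -> nat) : injective i -> (forall j, A (i j)) -> (N <= M + M)%N.
  move=> ii Ai.
  apply: (eigenfamily_size mE rE mS hl eps2 eta0 eta2 mL _ ii Ai).
  move=> f f1 f2 fE fL v v1 v2 vE.
  have := LQ f fL f1 f2 v v1 v2 vE; rewrite fE => /le_trans; apply.
  rewrite ler_wpM2r ?sqrtr_ge0//.
  have nf := norm1_le_ip mE rE f2 fE.
  apply: (@le_trans _ _ (96 * r ^+ 2 * (k * (1 / 2) ^+ n.+1) *
    (Num.sqrt (2 * \int[mu]_x (\1_(ell u r) x : R)) * Num.sqrt (ip f f)))).
    apply: ler_wpM2l => //.
    have q0 : 0 <= (1 / 2 : R) ^+ n.+1 by rewrite exprn_ge0// divr_ge0.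
    by apply: mulr_ge0; apply: mulr_ge0 => //; exact: sqr_ge0.
  by rewrite [leLHS]mulrA; apply: ler_wpM2r; [exact: sqrtr_ge0|exact: small].
have [fA cA] := finite_card_bound N2; split => //.
have : (#|` fset_set A|)%:R <= (M + M)%:R :> R by rewrite ler_nat.
move=> /le_trans; apply; rewrite natrD.
move: (log2 (r / eps)) L1 lrL Xlog => l l1 lrL Xlog.
have D2 : 0 <= log2 D by rewrite /log2 divr_ge0 ?ln_ge0// ler1n.
have hJ : J.+1%:R <= 3 * l by rewrite -natr1; lra.
have hn : n.+1%:R <= c3 * l.
  rewrite -natr1 /c3; have : log2 D <= log2 D * l by rewrite ler_peMr.
  lra.
have hn2 : n.+1%:R ^+ 2 <= (c3 * l) ^+ 2 by rewrite lerXn2r// nnegrE// (le_trans _ hn).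
have h : C * n.+1%:R ^+ 2 * r * J.+1%:R <= C * (c3 * l) ^+ 2 * r * (3 * l).
  rewrite ler_pM//; first by rewrite mulr_ge0 ?(ltW r0)// mulr_ge0// sqr_ge0.
  by rewrite ler_wpM2r ?(ltW r0)// ler_wpM2l.
have -> : 6 * C * c3 ^+ 2 * r * l ^+ 3 = 2 * (C * (c3 * l) ^+ 2 * r * (3 * l)) by ring.
lra.
Qed.

End eigenvalue_count.

Theorem theorem1p1 (R : realType) (F S : set (R * R))
    (hF : centered_ellipse F) (hSd : domain S) (hSw : well_shaped S) :
  (forall (r : R) (lambda : nat -> R), 1 < r ->
     eigenvalue_sequence (space_band_limit (dilate r F) S) lambda ->
     forall k : nat, 0 <= lambda k <= 1) /\
  (forall s : R, 1 < s -> exists C : R,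
     forall (eps r : R) (lambda : nat -> R), 0 < eps < 1 / 2 -> 1 < r ->
       eigenvalue_sequence (space_band_limit (dilate r F) S) lambda ->
       let A := [set k : nat | eps < lambda k < 1 - eps] in
       finite_set A /\
       (#|` fset_set A|)%:R <= C * r * log2 (r / eps) `^ (1 + 2 * s)).
Proof.
split=> [r lambda r1 hl k|s s1].
  have [u [a [b [_ b0 ui FE]]]] := ellipse_plane_iso hF.
  have r0 : 0 < r by exact: lt_trans r1.
  have br0 : 0 <= b * r by rewrite mulr_ge0// ltW.
  rewrite (FE r r0) in hl; have mE := measurable_ell ui r.
  have [rE _] := rint_in_square br0 mE (ell_square ui (r := r)).
  have mS := open_measurable2 (let: And3 _ oS _ := hSd in oS).
  exact: (eigenvalue_sequence_01 mE rE mS hl k).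
have [C C0 HC] := ellipse_eigenvalue_count hF hSd hSw.
exists C => eps r lambda eps2 r1 hl A; have [fA cA] := HC eps r lambda eps2 r1 hl.
have [L1 _ _ _] := log2_pos_facts eps2 r1.
split => //; apply: (le_trans cA); apply: ler_wpM2l; first by rewrite mulr_ge0// ltW// (lt_trans _ r1).
(* The base log2 (r / eps) is at least 1, so passing from exponent 3 to 1 + 2 s increases the
   power. *)
rewrite -powR_mulrn; last by rewrite (le_trans _ L1).
by apply: ler_powR => //; lra.
Qed.
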